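(* Let $G$ be a finite insoluble para-$\mathfrak{Nil}$-Hamiltonian group. Then $G\cong A_5$ or $G\cong \mathrm{SL}(2,5)$. In particular, the only prime divisors of the order of $G$ are $2$, $3$ and $5$.
   Context: A group is minimal non-nilpotent if it is not nilpotent but all its proper subgroups are nilpotent. A group $G$ is para-$\mathfrak{Nil}$-Hamiltonian if $G$ is non-nilpotent and every non-normal subgroup of $G$ is either nilpotent or minimal non-nilpotent. *)

(* Defs.v *)
From HB Require Import structures.
From mathcomp Require Import all_boot all_order all_algebra all_fingroup.
From mathcomp Require Import all_solvable.

Set Implicit Arguments.
Unset Strict Implicit.
Unset Printing Implicit Defensive.

Import GroupScope GRing.Theory.

Section ParaNilHamiltonian.

Variable gT : finGroupType.
Implicit Types A : {set gT}.

Definition minimal_nonnilpotent A : bool :=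
  ~~ nilpotent A && [forall H : {group gT}, (H \proper A) ==> nilpotent H].

Definition para_nil_hamiltonian A : bool :=
  ~~ nilpotent A &&
  [forall H : {group gT}, (H \subset A) && ~~ (H <| A) ==>
     (nilpotent H || minimal_nonnilpotent H)].

End ParaNilHamiltonian.

Section SpecialLinearGroup.

Variables (n : nat) (R : finComUnitRingType).

(* As for 'GL_n[R], the matrices have size n.-1.+1, so n = 0 behaves as n = 1. *)
Definition SLgroup : {set {'GL_n[R]}} := [set u : {'GL_n[R]} | (\det u == 1)%R].

Lemma SLgroup_group_set : group_set SLgroup.
Proof.
apply/group_setP; split=> [|u v]; first by rewrite inE GL_1E det1.
by rewrite !inE GL_ME det_mulmx => /eqP-> /eqP->; rewrite mulr1.
Qed.
Canonical SLgroup_group := Group SLgroup_group_set.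

End SpecialLinearGroup.

Arguments SLgroup n%_N R%_type.
Arguments SLgroup_group n%_N R%_type.

Notation "''SL_' n [ R ]" := (SLgroup n R)
  (at level 8, n at level 2, format "''SL_' n [ R ]") : group_scope.
Notation "''SL_' n ( p )" := (SLgroup n 'F_p)
  (at level 8, n at level 2, p at level 10, format "''SL_' n ( p )") : group_scope.
Notation "''SL_' n [ R ]" := (SLgroup_group n R) : Group_scope.
Notation "''SL_' n ( p )" := (SLgroup_group n 'F_p) : Group_scope.

(* Main.v *)
(* Let N be maximal normal in a minimal insoluble subgroup K of G. In the simple
   group S = K / N every proper subgroup is nilpotent or minimal non-nilpotent.
   Transfer, together with a count of the elements of mixed order, shows that each
   Sylow subgroup P of S is elementary abelian, is the centralizer of each of its
   nontrivial elements, and is the kernel of a Frobenius group N_S(P) = P : Q with Q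
   of prime order; so S is partitioned by its Sylow subgroups. Suzuki's
   exceptional characters exclude odd order. If T is a Sylow 2-subgroup and y = |T|,
   Bender's count of the involutions in the cosets of N_S(T) gives
   |S| = (y - 1) y (y + 1), and counting the products of two involutions shows
   that y - 1 and y + 1 are prime, so y = 4, |S| = 60 and S is A_5.
   The preimages in K of the normalizers of Sylow 3- and 5-subgroups of S are minimal
   non-nilpotent, hence have only two prime divisors: N is a central 2-group, of
   order at most 2 by transfer, and two perfect double covers of A_5 are isomorphic
   because the derived subgroup of their fibre product over A_5 maps injectively to
   both. Finally K is normal in G, and if K < G then N_G(P), for P a Sylow 3-subgroup
   of K, properly contains the non-nilpotent group N_K(P), so is normal in G, which
   makes P normal in K. *)

Require Import Defs.
From mathcomp Require Import all_boot all_order all_algebra all_fingroup.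
From mathcomp Require Import all_solvable all_field all_character.
From mathcomp Require Import zify ring.

Set Implicit Arguments.
Unset Strict Implicit.
Unset Printing Implicit Defensive.

Import GroupScope.

(** * Transfer and fusion *)

(** The hypothesis on [G] is silent about normal subgroups, so the local work is done in a simple
    section, where no nontrivial proper subgroup is normal; a quotient of a minimal non-nilpotent
    group is again nilpotent or minimal non-nilpotent. The condition is used in two ways: a
    non-nilpotent subgroup of a proper subgroup M is all of M, which identifies normalizers, and
    strictly smaller subgroups are nilpotent, which turns coprime normalization into centralization.
    Local arguments stop at a symmetric configuration of two non-abelian Sylow subgroups, each
    complemented in its normalizer by the centre of the other; only counting elements removes it.
    Odd order needs characters because there are no involutions to count. What replaces them is
    parity: every family of exceptional characters then has even size, so the value 1 of the trivial
    character cannot be cancelled in an orthogonality relation. *)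

(** The transfer into the abelian group P / P0 kills [g], which lies in G'. Along the cycles of [g]
    on the cosets of [P] each factor is a conjugate of a power of [g], equal to that power modulo
    [P0], so the transfer is g ^ |G : P| and the index is prime to p. Asking for fusion of powers of
    a single [g] serves both the focal bound and the central case. *)
Lemma Sylow_transfer (gT : finGroupType) (p : nat) (G P P0 : {group gT}) g :
    p.-Sylow(G) P -> P0 \subset P -> P^`(1) \subset P0 -> g \in P :&: G^`(1) ->
    (forall n x, x \in G -> (g ^+ n) ^ x \in P -> [~ g ^+ n, x] \in P0) ->
  g \in P0.
Proof.
move=> sylP sP0P sP'P0 /setIP[Pg G'g] focg.
have [sPG pP p'iP] := and3P sylP.
have nP0P : P \subset 'N(P0) by rewrite sub_der1_norm.
pose alpha := restrm_morphism nP0P (coset_morphism P0).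
have abA : abelian (alpha @* P).
  by rewrite morphim_restrm setIid; apply: sub_der1_abelian.
pose V := transfer_morphism G abA.
pose fm := restrm (transfer_morph_subproof (H := P) alpha) (FiniteModule.fmod abA \o alpha).
have alphaP x : x \in P -> alpha x \in alpha @* P by move=> Px; apply: mem_morphim.
have fmM : {in P &, {morph fm : x y / (x * y)%g >-> (x + y)%R}}.
  by move=> x y Px Py; rewrite /fm /restrm /= -FiniteModule.fmodM -?morphM //; apply: alphaP.
have fmX x n : x \in P -> fm (x ^+ n) = (fm x *+ n)%R.
  move=> Px; elim: n => [|n IHn].
    by rewrite expg0 /fm /restrm /= morph1 FiniteModule.fmod1.
  by rewrite expgS fmM ?groupX // IHn GRing.mulrS.
have fmP0 x : x \in P0 -> fm x = 0%R.
  by move=> P0x; rewrite /fm /restrm /= /restrm coset_id // FiniteModule.fmod1.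
have Gg := subsetP sPG g Pg.
have V0 : V g = 0%R.
  have: V g \in (V @* G)^`(1) by rewrite -morphim_der // mem_morphim.
  have /derG1P-> : abelian (V @* G).
    by apply/centsP=> u _ v _; apply: GRing.addrC.
  by move/set1P.
have [X trX] : exists X, is_transversal X (rcosets P G :* <[g]>) G.
  have partX := rcosets_cycle_partition sPG Gg.
  by exists (transversal (rcosets P G :* <[g]>) G); exact: transversalP.
have VE : V g = (fm g *+ #|G : P|)%R.
  rewrite [V g](transfer_cycle_expansion sPG abA Gg trX).
  rewrite -(sum_index_rcosets_cycle sPG Gg trX) -GRing.sumrMnr.
  (* [n] is the length of the cycle of [g] through the coset P x, so [g ^+ n] fixes that coset. *)
  apply: eq_bigr => x Xx; set n := #|_ : _|.
  have Gx : x \in G by apply: (subsetP (transversal_sub trX)).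
  have Pgn : g ^+ n \in P by rewrite groupX.
  have Pgnx : (g ^+ n) ^ x^-1 \in P.
    have := mulg_exp_card_rcosets P g x; rewrite mem_rcoset.
    by rewrite conjgE invgK mulgA.
  rewrite -fmX // conjg_mulR -/fm.
  have P0c : [~ g ^+ n, x^-1] \in P0 by rewrite focg ?groupV.
  have := fmM _ _ Pgn (subsetP sP0P _ P0c); rewrite (fmP0 _ P0c) => E.
  by apply: (etrans E); apply: GRing.addr0.
have coP : coprime #|P| #|G : P| by rewrite (pnat_coprime pP).
rewrite -(expgK coP Pg) groupX // coset_idr ?(subsetP nP0P) ?groupX //.
have := congr1 (@FiniteModule.fmval _ _ _) VE; rewrite V0 -fmX //
  /fm /restrm /= FiniteModule.fmodK => [E|]; first exact: esym E.
by apply: alphaP; rewrite groupX.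
Qed.

Lemma Sylow_focal (gT : finGroupType) (p : nat) (G P P0 : {group gT}) :
    p.-Sylow(G) P -> P0 \subset P -> P^`(1) \subset P0 ->
    {in P & G, forall x u, x ^ u \in P -> [~ x, u] \in P0} ->
  P :&: G^`(1) \subset P0.
Proof.
move=> sylP sP0P sP'P0 focP; apply/subsetP=> g PG'g.
apply: (Sylow_transfer sylP) => // n x; apply: focP.
by rewrite groupX //; case/setIP: PG'g.
Qed.

(** For central [g] the commutators in the fusion condition are trivial. This later bounds the
    kernel of a perfect central extension. *)
Lemma Sylow_cap_center (gT : finGroupType) (p : nat) (G P Z : {group gT}) :
    p.-Sylow(G) P -> G \subset G^`(1) -> Z \subset 'C(G) ->
  P :&: Z \subset P^`(1).
Proof.
move=> sylP perfG cGZ; apply/subsetP=> g /setIP[Pg Zg].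
apply: (Sylow_transfer sylP) => //; first exact: der_sub.
  by rewrite inE Pg (subsetP perfG) // (subsetP (pHall_sub sylP)).
move=> n x Gx _; rewrite (_ : [~ _, _] = 1) ?group1 //.
by apply/eqP/commgP/commute_sym/commuteX; apply: commute_sym; apply: (centsP cGZ).
Qed.

(* Fusion in a trivial-intersection Sylow subgroup P takes place in N(P). *)
Lemma TI_Sylow_focal (gT : finGroupType) (p : nat) (G P P0 : {group gT}) :
    p.-Sylow(G) P -> P0 \subset P -> P^`(1) \subset P0 ->
    normedTI P^# G 'N_G(P) -> [~: P, 'N_G(P)] \subset P0 ->
  P :&: G^`(1) \subset P0.
Proof.
move=> sylP sP0P sP'P0 tiP foc; apply: (Sylow_focal sylP) => // x u Px Gu Pxu.
have [->|ntx] := eqVneq x 1; first by rewrite comm1g group1.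
apply: (subsetP foc); rewrite mem_commg //.
have [_ _ tiPP] := normedTI_memJ_P tiP.
by rewrite -(tiPP x) // !inE ?ntx ?conjg_eq1 ?ntx.
Qed.

(** [D] is an intersection of [P] with a different conjugate, of largest possible order. A normal
    Sylow p-subgroup of N(D) would contain the normalizers of [D] in both conjugates, and maximality
    would identify them. *)
Lemma nonTI_Sylow (gT : finGroupType) (p : nat) (G P : {group gT}) :
    p.-Sylow(G) P -> P :!=: 1 -> ~~ normedTI P^# G 'N_G(P) ->
  exists D : {group gT}, [/\ D :!=: 1, D \proper 'N_P(D), D \subset P
    & forall R : {group gT}, p.-Sylow('N_G(D)) R -> ~~ (R <| 'N_G(D))].
Proof.
move=> sylP ntP nTI; have [sPG pP _] := and3P sylP.
pose bad x := [&& x \in G, P :&: P :^ x != 1 & P :^ x != P].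
have [x0 bx0] : exists x, bad x.
  apply/existsP; apply: contraR nTI => /existsPn nbad.
  apply/normedTI_memJ_P; split; [|exact: subsetIl|].
    by rewrite setD_eq0 subG1.
  move=> a g /setD1P[nta Pa] Gg.
  rewrite !inE conjg_eq1 nta Gg /=; apply/idP/idP=> [Pag | nPg]; last first.
    by rewrite memJ_norm // inE.
  have := nbad g^-1; rewrite /bad groupV Gg /= negb_and !negbK.
  case/orP=> [/eqP triv | /eqP eqP1]; last by rewrite -{1}eqP1 actKV.
  have: a \in P :&: P :^ g^-1 by rewrite inE Pa mem_conjg invgK.
  by rewrite triv => /set1P a1; rewrite a1 eqxx in nta.
have [x bx maxx] :
    {x | bad x & forall y, bad y -> #|P :&: P :^ y| <= #|P :&: P :^ x|}.
  by case: (arg_maxnP (fun x => #|P :&: P :^ x|) bx0) => x bx mx; exists x.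
have /and3P[Gx ntD neP] := bx.
pose D := (P :&: P :^ x)%G.
have sylPx : p.-Sylow(G) (P :^ x) by rewrite pHallJ.
have sDP : D \subset P by apply: subsetIl.
have sDPx : D \subset P :^ x by apply: subsetIr.
have prPD (R : {group gT}) : p.-Sylow(G) R -> D \subset R -> D :!=: R -> D \proper 'N_R(D).
  move=> sylR sDR neDR; apply: nilpotent_proper_norm; last by rewrite properEneq neDR.
  exact: pgroup_nil (pHall_pgroup sylR).
have neDP : D :!=: P.
  apply: contra neP => /eqP defD; rewrite eq_sym eqEcard cardJg leqnn andbT.
  by rewrite -{1}defD.
have neDPx : D :!=: P :^ x.
  apply: contra neP => /eqP defD; rewrite eqEcard cardJg leqnn andbT.
  by rewrite -{1}defD.
have prP := prPD P sylP sDP neDP; have prPx := prPD (P :^ x)%G sylPx sDPx neDPx.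
exists D; split=> // R sylR; apply/negP => nsR.
have sNR (Q : {group gT}) : p.-Sylow(G) Q -> 'N_Q(D) \subset R.
  move=> sylQ; rewrite (sub_normal_Hall sylR nsR).
    exact: pgroupS (subsetIl _ _) (pHall_pgroup sylQ).
  by rewrite setSI // (pHall_sub sylQ).
have [y Gy sRPy] : exists2 y, y \in G & R \subset P :^ y.
  apply: (Sylow_subJ sylP); last exact: pHall_pgroup sylR.
  exact: subset_trans (pHall_sub sylR) (subsetIl _ _).
(* A conjugate of [P] properly containing [D] meets P^y in more than [D], so by maximality it is
   P^y. The cases z = 1 and z = x contradict [neP]. *)
have eqPy z : z \in G -> D \subset P :^ z -> D :!=: P :^ z -> P :^ z = P :^ y.
  move=> Gz sDPz neDPz; apply/eqP; rewrite -(inj_eq (act_inj 'Js z^-1)) /= actK eq_sym.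
  have sylPz : p.-Sylow(G) (P :^ z) by rewrite pHallJ.
  have: D \proper P :^ z :&: P :^ y.
    apply: proper_sub_trans (prPD (P :^ z)%G sylPz sDPz neDPz) _.
    by rewrite subsetI subsetIl (subset_trans (sNR (P :^ z)%G sylPz)).
  move/proper_card; rewrite -[X in _ < X](cardJg _ z^-1) conjIg conjsgK -conjsgM => ltD.
  apply: contraTT (ltD) => ne; rewrite -leqNgt maxx // /bad ne groupM ?groupV //= andbT.
  apply: contraTneq ltD => eq1.
  by rewrite -leqNgt eq1 cards1 cardG_gt0.
have eqP1 : P :^ y = P by rewrite -(eqPy 1) ?group1 ?conjsg1.
by case/eqP: neP; rewrite (eqPy x).
Qed.

(** * Minimal non-nilpotent groups *)

Lemma simple_insol_perfect (gT : finGroupType) (G : {group gT}) :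
  simple G -> ~~ solvable G -> G^`(1) = G.
Proof.
move=> /simpleP[_ simG] insolG; case: (simG (G^`(1))%G (der_normal 1 G)) => // /derG1P.
by move/abelian_sol; rewrite (negPf insolG).
Qed.

Lemma simple_norm_proper (gT : finGroupType) (G D : {group gT}) :
    simple G -> ~~ solvable G -> D \subset G -> D :!=: 1 -> solvable D ->
  'N_G(D) \proper G.
Proof.
move=> /simpleP[_ simG] insolG sDG ntD solD; rewrite properE subsetIl.
apply: contra insolG => /subsetIP[_ nDG].
by case: (simG D) => [|D1|<- //]; [apply/andP | rewrite D1 eqxx in ntD].
Qed.

(** In a perfect group the focal argument puts [P] inside [P, N(P)], but in a nilpotent normalizer
    this commutator is a proper subgroup of [P]. *)
Lemma TI_Sylow_nil_not_perfect (gT : finGroupType) (p : nat) (G P : {group gT}) :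
    p.-Sylow(G) P -> P :!=: 1 -> normedTI P^# G 'N_G(P) -> nilpotent 'N_G(P) ->
  ~~ (G \subset G^`(1)).
Proof.
move=> sylP ntP tiP nilN; apply: contra ntP => perfG.
have sPN : P \subset 'N_G(P) by rewrite subsetI (pHall_sub sylP) normG.
have sP0P : [~: P, 'N_G(P)] \subset P by rewrite commg_subl subsetIr.
have sPP0 : P \subset [~: P, 'N_G(P)].
  rewrite -{1}(setIidPl (subset_trans (pHall_sub sylP) perfG)).
  by apply: (TI_Sylow_focal (P0 := [~: P, 'N_G(P)]%G) sylP _ _ tiP) => //=; rewrite commgS.
apply: contraTT sPP0 => ntP;
  have sNN : 'N_G(P) \subset 'N_('N_G(P))(P) by rewrite subsetI subxx subsetIr.
by have := nil_comm_properl nilN sPN ntP sNN; rewrite properE => /andP[].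
Qed.

Lemma nil_Sylow_normal (gT : finGroupType) (p : nat) (G P : {group gT}) :
  nilpotent G -> p.-Sylow(G) P -> P <| G.
Proof. by move=> nilG /(nilpotent_Hall_pcore nilG)->; apply: pcore_normal. Qed.

Lemma exists_nontrivial_Sylow (gT : finGroupType) (G : {group gT}) (p : nat) :
  p \in \pi(G) -> exists2 P : {group gT}, p.-Sylow(G) P & P :!=: 1.
Proof.
have [P sylP] := Sylow_exists p G => piGp; exists P => //.
by rewrite -(p_part_gt1) -(card_Hall sylP) cardG_gt1 in piGp.
Qed.

(** If insoluble, all p-local subgroups would be nilpotent, hence would have normal Sylow subgroups;
    so [P] would be TI with nilpotent normalizer, against perfectness. *)
Lemma simple_proper_nil_sol (gT : finGroupType) (G : {group gT}) :
    simple G -> (forall H : {group gT}, H \proper G -> nilpotent H) ->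
  solvable G.
Proof.
move=> simG nilG; apply/idPn => insolG.
have ntG : 1 < #|G| by rewrite cardG_gt1; case/simpleP: simG.
have [P sylP ntP] : exists2 P : {group gT}, (pdiv #|G|).-Sylow(G) P & P :!=: 1.
  by apply: exists_nontrivial_Sylow; rewrite pi_pdiv.
have pP := pHall_pgroup sylP; have sPG := pHall_sub sylP.
have nilN (D : {group gT}) : D \subset P -> D :!=: 1 -> nilpotent 'N_G(D).
  move=> sDP ntD; apply: nilG; apply: simple_norm_proper => //.
    exact: subset_trans sDP sPG.
  exact: pgroup_sol (pgroupS sDP pP).
have tiP : normedTI P^# G 'N_G(P).
  apply/idPn=> /(nonTI_Sylow sylP ntP)[D [ntD _ sDP]].
  have [R sylR] := Sylow_exists (pdiv #|G|) 'N_G(D).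
  by move/(_ R sylR)/negP; apply; apply: nil_Sylow_normal sylR; apply: nilN.
have := TI_Sylow_nil_not_perfect sylP ntP tiP (nilN P (subxx P) ntP).
by rewrite simple_insol_perfect // subxx.
Qed.

Lemma min_nonnilP (gT : finGroupType) (G : {group gT}) :
  reflect (~~ nilpotent G /\ forall H : {group gT}, H \proper G -> nilpotent H)
          (minimal_nonnilpotent G).
Proof.
by apply: (iffP andP) => -[nnG] => [/forall_inP | nilG]; split=> //; apply/forall_inP.
Qed.

Lemma min_nonnil_sol (gT : finGroupType) (G : {group gT}) :
  minimal_nonnilpotent G -> solvable G.
Proof.
case/min_nonnilP=> nnG nilG.
have [|N maxN] := @ex_maxnormal_ntrivg _ G.
  by apply: contraNneq nnG => ->; apply: nilpotent1.
have nsNG := maxnormal_normal maxN; rewrite (series_sol nsNG).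
rewrite (nilpotent_sol (nilG _ (maxnormal_proper maxN))).
apply: simple_proper_nil_sol => [|H prH]; first by rewrite quotient_simple.
have [K defH sNK sKG] := inv_quotientS nsNG (proper_sub prH).
rewrite defH quotient_nil // nilG // properEneq sKG andbT.
by apply: contraTneq prH => eqKG; rewrite defH eqKG properxx.
Qed.

(** A maximal normal subgroup is nilpotent of prime index, and the index must be p, so its p'-part K
    is a normal Hall subgroup of [G]. If M is maximal in [P], then KM is normal, proper and
    nilpotent, which puts M inside O_p(G); hence an element of [P] outside O_p(G) lies in no maximal
    subgroup and generates [P]. *)
Lemma min_nonnil_nonnormal_cyclic (gT : finGroupType) (p : nat) (G P : {group gT}) :
  minimal_nonnilpotent G -> p.-Sylow(G) P -> ~~ (P <| G) -> cyclic P.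
Proof.
move=> mnG sylP nnP; have solG := min_nonnil_sol mnG.
have [nnG nilG] := min_nonnilP _ mnG.
have [sPG pP _] := and3P sylP.
have [|N maxN] := @ex_maxnormal_ntrivg _ G.
  by apply: contraNneq nnG => ->; apply: nilpotent1.
have nsNG := maxnormal_normal maxN; have sNG := normal_sub nsNG.
have nilN := nilG _ (maxnormal_proper maxN).
have prI := index_maxnormal_sol_prime solG maxN.
have p_pr : prime p.
  have ntP : P :!=: 1 by apply: contraNneq nnP => ->; apply: normal1.
  by case: (pgroup_pdiv pP ntP).
have defp : #|G : N| = p.
  apply/eqP; apply: contraR nnP => nep.
  have sPN : P \subset N.
    rewrite -quotient_sub1 ?(subset_trans sPG (normal_norm nsNG)) // subG1 trivg_card1.
    have dvdPN : #|P / N| %| #|G : N| by rewrite -card_quotient ?normal_norm // cardSg ?quotientS.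
    apply/eqP/(pnat_1 (quotient_pgroup N pP))/(pnat_dvd dvdPN).
    by rewrite pnatE // !inE.
  have sylPN : p.-Sylow(N) P by apply: pHall_subl sylP.
  rewrite (nilpotent_Hall_pcore nilN sylPN); exact: gFnormal_trans.
pose K := 'O_p^'(N)%G.
have nsKG : K <| G by apply: gFnormal_trans.
have hallK : p^'.-Hall(G) K.
  rewrite pHallE (normal_sub nsKG) /= -(Lagrange sNG) defp.
  rewrite (card_Hall (nilpotent_pcore_Hall _ nilN)) partnM ?cardG_gt0 ?(prime_gt0 p_pr) //.
  by rewrite [X in (_ * X)%N]part_p'nat ?muln1 // pnatNK pnat_id.
have coKP : coprime #|K| #|P|.
  by rewrite coprime_sym; apply: pnat_coprime pP _; apply: pHall_pgroup hallK.
have defG : K * P = G.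
  apply/eqP; rewrite eqEcard mulG_subG (normal_sub nsKG) sPG /= coprime_cardMg //.
  by rewrite (card_Hall hallK) (card_Hall sylP) mulnC partnC ?leqnn.
have [x Px notOx] : exists2 x, x \in P & x \notin 'O_p(G).
  apply/subsetPn; apply: contra nnP => sPO.
  have -> : P = 'O_p(G)%G by apply/val_inj/eqP; rewrite /= eqEsubset sPO pcore_sub_Hall.
  exact: pcore_normal.
have [->|neX] := eqVneq P <[x]>%G; first exact: cycle_cyclic.
have sXP : <[x]> \subset P by rewrite cycle_subG.
have [eqXP|[M maxM sXM]] := maximal_exists sXP.
  by case/eqP: neX; apply/val_inj; rewrite /= eqXP.
case/negP: notOx; rewrite -cycle_subG (subset_trans sXM) //.
have nsMP := p_maximal_normal pP maxM; have sMP := normal_sub nsMP.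
have nKP : P \subset 'N(K) := subset_trans sPG (normal_norm nsKG).
have nKM := subset_trans sMP nKP.
have tiKM : K :&: M = 1.
  apply: coprime_TIg; rewrite coprime_sym (pnat_coprime (pgroupS sMP pP)) //.
  exact: pHall_pgroup hallK.
have nsKMG : K <*> M <| G.
  rewrite /normal join_subG (normal_sub nsKG) (subset_trans sMP sPG) /=.
  rewrite -defG mulG_subG; apply/andP; split.
    by rewrite normsG ?joing_subl.
  by rewrite normsY ?(normal_norm nsMP).
have prKM : K <*> M \proper G.
  rewrite properEcard (normal_sub nsKMG) norm_joinEr //= TI_cardMg // -defG.
  rewrite TI_cardMg ?ltn_pmul2l ?cardG_gt0 ?(proper_card (maxgroupp maxM)) //.
  apply: coprime_TIg; rewrite coprime_sym (pnat_coprime pP) //.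
  exact: pHall_pgroup hallK.
have sylM : p.-Sylow(K <*> M) M.
  rewrite /pHall joing_subr (pgroupS sMP pP) /= -divgS ?joing_subr //=.
  rewrite norm_joinEr // TI_cardMg // mulnK ?cardG_gt0 //.
  exact: pHall_pgroup hallK.
apply: pcore_max; first exact: pgroupS pP.
rewrite (nilpotent_Hall_pcore (nilG _ prKM) sylM).
exact: gFnormal_trans.
Qed.

(** Some Sylow subgroup Q of a complement fails to centralize [P]; then PQ is not nilpotent, so it
    cannot be proper. *)
Lemma min_nonnil_sdprod (gT : finGroupType) (p : nat) (G P : {group gT}) :
    minimal_nonnilpotent G -> p.-Sylow(G) P -> P <| G -> P :!=: 1 ->
  exists q, exists Q : {group gT},
    [/\ prime q, q != p, q.-group Q, P ><| Q = G & ~~ (Q \subset 'C(P))].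
Proof.
move=> mnG sylP nsPG ntP; have [nnG nilG] := min_nonnilP _ mnG.
have /splitsP[K complK] := SchurZassenhaus_split (pHall_Hall sylP) nsPG.
have sdG : P ><| K = G by apply/sdprod_normal_complP; rewrite // complgC.
have [_ defG nPK tiPK] := sdprodP sdG.
have p'K : p^'.-group K.
  by move: (sylP) => /and3P[_ _]; rewrite -(index_sdprod sdG).
have prK : K \proper G.
  rewrite properEcard -defG mulG_subr /= TI_cardMg //.
  by rewrite -{1}[#|K|]mul1n ltn_pmul2r ?cardG_gt0 // cardG_gt1.
have pP := pHall_pgroup sylP.
have ncPK : ~~ (K \subset 'C(P)).
  apply: contra nnG => cPK; rewrite -defG mulg_nil ?(pgroup_nil pP) //.
  exact: nilG.
have [Q sylQ ncPQ] : exists2 Q : {group gT}, Sylow K Q & ~~ (Q \subset 'C(P)).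
  apply/exists_inP; apply: contraR ncPK; rewrite negb_exists_in => /forall_inP cPQ.
  rewrite -(Sylow_gen K) gen_subG; apply/bigcupsP=> Q sylQ.
  by have := cPQ Q sylQ; rewrite negbK.
have /SylowP[q q_pr sylqQ] := sylQ.
have qQ := pHall_pgroup sylqQ; have sQK := pHall_sub sylqQ.
have ntQ : Q :!=: 1 by apply: contraNneq ncPQ => ->; apply: sub1G.
have neqp : q != p.
  have [_ dvq _] := pgroup_pdiv qQ ntQ.
  have := pgroupP (pgroupS sQK p'K) q q_pr dvq.
  by rewrite !inE.
exists q, Q; split=> //.
have nPQ := subset_trans sQK nPK.
rewrite sdprodE ?(coprime_TIg _) //; last first.
  by rewrite coprime_sym (p'nat_coprime (pgroupS sQK p'K)).
apply/eqP; rewrite eqEproper mulG_subG (normal_sub nsPG).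
rewrite (subset_trans sQK (proper_sub prK)) -norm_joinEr //=.
apply: contra ncPQ => /nilG nilPQ.
apply: (sub_nilpotent_cent2 nilPQ); rewrite ?joing_subl ?joing_subr //.
by rewrite coprime_sym (p'nat_coprime (pgroupS sQK p'K)).
Qed.

(** * Local structure of the simple section *)

(** Burnside's argument: [P] and P^u are both Sylow in the centralizer of x^u, hence conjugate
    there. *)
Lemma abelian_Sylow_fusion (gT : finGroupType) (p : nat) (G P : {group gT}) x u :
    p.-Sylow(G) P -> abelian P -> x \in P -> u \in G -> x ^ u \in P ->
  exists2 v, v \in 'N_G(P) & x ^ v = x ^ u.
Proof.
move=> sylP abP Px Gu Pxu.
have sPC y : y \in P -> P \subset 'C_G[y].
  by move=> Py; rewrite subsetI (pHall_sub sylP) sub_cent1 (subsetP abP).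
have sylC (R : {group gT}) : p.-Sylow(G) R -> R \subset 'C_G[x ^ u] -> p.-Sylow('C_G[x ^ u]) R.
  by move=> sylR sRC; apply: pHall_subl sylR => //; apply: subsetIl.
have sylPu : p.-Sylow(G) (P :^ u) by rewrite pHallJ.
have sPuC : P :^ u \subset 'C_G[x ^ u] by rewrite -(conjGid Gu) cent1J -conjIg conjSg sPC.
have [c /setIP[Gc cxc] defP] :=
  Sylow_trans (sylC (P :^ u)%G sylPu sPuC) (sylC P sylP (sPC _ Pxu)).
exists (u * c); first by rewrite inE groupM //=; apply/normP; rewrite conjsgM -defP.
by rewrite conjgM conjgE -(cent1P cxc) mulKg.
Qed.

(** Divided by [n], the right side is at least 1/p + 1/q + (1 - 1/p)(1 - 1/q) minus 1/(pqu) +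
    1/(pqv). The first three terms sum to 1 + 1/(pq), and u, v >= 2 bounds the loss by 1/(pq). *)
Lemma mixed_order_count (n p q u v n1 n2 n3 l : nat) :
    (n1 * (p * u * q) = n -> n2 * (q * v * p) = n -> n3 * l = n ->
     0 < n -> 1 < p -> 1 < q -> 1 < u -> 1 < v -> l <= p * q ->
   n <= (p * u).-1 * n1 + (q * v).-1 * n2 + (p.-1 * q.-1) * n3)%N.
Proof.
have half u' n' : (1 < u' -> n' * (p * u' * q) = n -> 2 * (n' * (p * q)) <= n)%N.
  move=> u'_gt1 <-; have -> : (n' * (p * u' * q) = u' * (n' * (p * q)))%N by ring.
  by rewrite leq_mul2r u'_gt1 orbT.
have half2 : (2 * (n1 * (p * q)) <= n -> 2 * (n2 * (p * q)) <= n ->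
    n * (p.-1 * q.-1) <= p.-1 * q.-1 * n3 * (p * q) ->
    (p * u).-1 * n1 * (p * q) + n1 * (p * q) = p * n ->
    (q * v).-1 * n2 * (p * q) + n2 * (p * q) = q * n ->
    n * (p.-1 * q.-1) + p * n + q * n = n * (p * q) + n ->
  n * (p * q) <= (p * u).-1 * n1 * (p * q) + (q * v).-1 * n2 * (p * q) +
    p.-1 * q.-1 * n3 * (p * q))%N.
  move: (n1 * _)%N (n2 * _)%N (n * (_ * _))%N (p.-1 * _ * _ * _)%N => *; lia.
move=> def1 def2 def3 n_gt0 p_gt1 q_gt1 u_gt1 v_gt1 le_l.
have pq_gt0 : (0 < p * q)%N by rewrite muln_gt0 (ltnW p_gt1) (ltnW q_gt1).
have pred_mul a b : (0 < a -> a.-1 * b + b = a * b)%N by case: a => //= a _; ring.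
rewrite -(leq_pmul2r pq_gt0) !mulnDl; apply: half2; first exact: half def1.
- by apply: half v_gt1 _; rewrite -def2; ring.
- by rewrite -def3 mulnC -!mulnA !leq_mul2l le_l !orbT.
- by rewrite -mulnA pred_mul -?def1; [ring | rewrite muln_gt0 (ltnW p_gt1) (ltnW u_gt1)].
- by rewrite -mulnA pred_mul -?def2; [ring | rewrite muln_gt0 (ltnW q_gt1) (ltnW v_gt1)].
by case: (p) (q) p_gt1 q_gt1 => // p' [] // q' _ _ /=; ring.
Qed.

Section SimpleLocal.

Variables (gT : finGroupType) (G : {group gT}).
Hypotheses (simG : simple G) (insolG : ~~ solvable G).
Hypothesis nilG : forall H : {group gT},
  H \proper G -> nilpotent H || minimal_nonnilpotent H.

Lemma nonnil_eq (H K : {group gT}) :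
  H \subset K -> K \proper G -> ~~ nilpotent H -> H :=: K.
Proof.
move=> sHK prK nnH; apply/eqP; rewrite eqEproper sHK; apply: contra nnH => prH.
by case/orP: (nilG prK) => [|/min_nonnilP[_]]; [apply: nilpotentS|apply].
Qed.

(** Otherwise N(D) is minimal non-nilpotent with a non-normal, hence cyclic, Sylow subgroup. Then
    [D] is characteristic in N_P(D), so P = N_P(D) is cyclic. Transfer makes N(P) = P : Q
    non-nilpotent; Q centralizes [D], so D x [P, Q] lies in a cyclic p-group and one factor is
    trivial. *)
Lemma simple_Sylow_TI (p : nat) (P : {group gT}) :
  p.-Sylow(G) P -> P :!=: 1 -> normedTI P^# G 'N_G(P).
Proof.
move=> sylP ntP; have [sPG pP _] := and3P sylP.
apply/idPn=> /(nonTI_Sylow sylP ntP)[D [ntD prD sDP nnR]].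
have solD := pgroup_sol (pgroupS sDP pP).
have prN : 'N_G(D) \proper G by apply: simple_norm_proper (subset_trans sDP sPG) _ _.
have sNPN : 'N_P(D) \subset 'N_G(D) by rewrite setSI.
have [R sylR sNR] := Sylow_superset sNPN (pgroupS (subsetIl _ _) pP).
have mnN : minimal_nonnilpotent 'N_G(D).
  case/orP: (nilG prN) => // nilN.
  by case/negP: (nnR R sylR); apply: nil_Sylow_normal sylR.
have cycN : cyclic 'N_P(D).
  exact: cyclicS sNR (min_nonnil_nonnormal_cyclic mnN sylR (nnR R sylR)).
have chD : D \char 'N_P(D) by rewrite sub_cyclic_char // proper_sub.
have defP : P :=: 'N_P(D).
  apply: (nilpotent_sub_norm (pgroup_nil pP)); first exact: subsetIl.
  by rewrite subsetI subsetIl /=; apply: subset_trans (subsetIr _ _) (char_norms chD).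
rewrite -defP in prD cycN chD => {mnN sNPN sNR}.
have abP := cyclic_abelian cycN.
have sP0P : [~: P, 'N_G(P)] \subset P by rewrite commg_subl subsetIr.
have ncP : P \subset [~: P, 'N_G(P)].
  have sPG' : P \subset P :&: G^`(1).
    by rewrite subsetI subxx (simple_insol_perfect simG insolG).
  apply: subset_trans sPG' _; apply: (Sylow_focal (P0 := [~: P, 'N_G(P)]%G) sylP) => //=.
    by rewrite (derG1P abP) sub1G.
  move=> x u Px Gu Pxu; have [v Nv eq_xv] := abelian_Sylow_fusion sylP abP Px Gu Pxu.
  by rewrite commgEl -eq_xv -commgEl mem_commg.
have prNP : 'N_G(P) \proper G by apply: simple_norm_proper (pgroup_sol pP).
have sPN : P \subset 'N_G(P) by rewrite subsetI sPG normG.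
have sylPN : p.-Sylow('N_G(P)) P by apply: pHall_subl sylP => //; apply: subsetIl.
have mnN : minimal_nonnilpotent 'N_G(P).
  case/orP: (nilG prNP) => // nilN.
  have sNN : 'N_G(P) \subset 'N_('N_G(P))(P) by rewrite subsetI subxx subsetIr.
  by have := nil_comm_properl nilN sPN ntP sNN; rewrite properE ncP andbF.
have [q [Q [q_pr neq qQ defN ncPQ]]] := min_nonnil_sdprod mnN sylPN (normalSG sPG) ntP.
have [_ eqPQ nPQ tiPQ] := sdprodP defN.
have coPQ : coprime #|P| #|Q| by apply: pnat_coprime pP (pi_pnat qQ _).
have nDQ : Q \subset 'N(D) := char_norm_trans chD nPQ.
have cDQ : Q \subset 'C(D).
  have: nilpotent (D <*> Q).
    have [_] := min_nonnilP _ mnN; apply; rewrite properEcard /= join_subG.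
    rewrite (subset_trans sDP sPN) -eqPQ mulG_subr /= norm_joinEr //.
    rewrite TI_cardMg; last by apply/trivgP; rewrite -tiPQ setSI.
    by rewrite -eqPQ TI_cardMg // ltn_pmul2r ?cardG_gt0 // (proper_card prD).
  move=> nilDQ; apply: (sub_nilpotent_cent2 nilDQ); rewrite ?joing_subl ?joing_subr //.
  exact: coprimeSg sDP coPQ.
have sRP : [~: P, Q] \subset P by rewrite commg_subl.
have tiDR : D :&: [~: P, Q] = 1.
  have/trivgP := coprime_abel_cent_TI nPQ coPQ abP => sC1; apply/trivgP.
  by apply: subset_trans sC1; rewrite /= setIC setIS // centsC.
have cDR : [~: P, Q] \subset 'C(D) by rewrite (centSS sRP sDP).
have sDR : D <*> [~: P, Q] \subset P by rewrite join_subG sDP.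
have dpC : D \x [~: P, Q] = D <*> [~: P, Q] by rewrite dprodEY.
case: (cyclic_pgroup_dprod_trivg (pgroupS sDR pP) (cyclicS sDR cycN) dpC).
  by case=> D1; rewrite D1 eqxx in ntD.
by case=> /eqP; rewrite (sameP eqP commG1P) centsC (negPf ncPQ).
Qed.

(** Let Q0 be maximal in Q. It centralizes [P], since P Q0 is nilpotent. If Q0 is nontrivial, TI
    puts [P] in N(R) for a Sylow subgroup R above Q, so N(P) = N(R) and Q = R; then [P] and Q
    normalize each other and commute, a contradiction. *)
Lemma simple_norm_Sylow (p : nat) (P : {group gT}) :
    p.-Sylow(G) P -> P :!=: 1 ->
  exists q, exists Q : {group gT},
    [/\ prime q, q != p, #|Q| = q, P ><| Q = 'N_G(P) & ~~ (Q \subset 'C(P))].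
Proof.
move=> sylP ntP; have [sPG pP _] := and3P sylP.
have tiP := simple_Sylow_TI sylP ntP.
have prNP : 'N_G(P) \proper G by apply: simple_norm_proper (pgroup_sol pP).
have sPN : P \subset 'N_G(P) by rewrite subsetI sPG normG.
have sylPN : p.-Sylow('N_G(P)) P by apply: pHall_subl sylP => //; apply: subsetIl.
have nnN : ~~ nilpotent 'N_G(P).
  apply: contraTN (subxx G) => nilN; have := TI_Sylow_nil_not_perfect sylP ntP tiP nilN.
  by rewrite simple_insol_perfect.
have mnN : minimal_nonnilpotent 'N_G(P).
  by case/orP: (nilG prNP) => // nilN; rewrite nilN in nnN.
have [q [Q [q_pr neq qQ defN ncPQ]]] := min_nonnil_sdprod mnN sylPN (normalSG sPG) ntP.
exists q, Q; split=> //.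
have [_ eqPQ nPQ tiPQ] := sdprodP defN.
have coPQ : coprime #|P| #|Q| by apply: pnat_coprime pP (pi_pnat qQ _).
have ntQ : Q :!=: 1 by apply: contraNneq ncPQ => ->; apply: sub1G.
have [Q1|[Q0 maxQ0 _]] := maximal_exists (sub1G Q); first by rewrite Q1 eqxx in ntQ.
have prQ0 := maxgroupp maxQ0; have sQ0Q := proper_sub prQ0.
have cPQ0 : P \subset 'C(Q0).
  have: nilpotent (P <*> Q0).
    have [_] := min_nonnilP _ mnN; apply; rewrite properEcard /= join_subG sPN /=.
    rewrite norm_joinEr ?(subset_trans sQ0Q nPQ) // -eqPQ.
    rewrite (subset_trans sQ0Q (mulG_subr _ _)) /=.
    rewrite !TI_cardMg //; last by apply/trivgP; rewrite -tiPQ setIS.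
    by rewrite ltn_pmul2l ?cardG_gt0 // (proper_card prQ0).
  move=> nilPQ; apply: (sub_nilpotent_cent2 nilPQ); rewrite ?joing_subl ?joing_subr //.
  by rewrite coprime_sym; apply: coprimegS sQ0Q coPQ.
have [Q01|ntQ0] := eqVneq Q0 1%G.
  by rewrite -(p_maximal_index qQ maxQ0) Q01 indexg1.
have sQG : Q \subset G by apply: subset_trans (subsetIl G 'N(P)); rewrite -eqPQ mulG_subr.
have [R sylR sQR] := Sylow_superset sQG qQ.
have [sRG qR _] := and3P sylR.
have ntR : R :!=: 1 by apply: contraNneq ntQ => R1; rewrite -subG1 -R1.
have tiR := simple_Sylow_TI sylR ntR.
have [y Q0y nty] := trivgPn _ ntQ0.
have sPNR : P \subset 'N_G(R).
  apply: subset_trans (cent1_normedTI tiR (x := y) _); last first.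
    by rewrite !inE nty (subsetP sQR) ?(subsetP sQ0Q).
  by rewrite subsetI sPG; apply: subset_trans cPQ0 _; rewrite -cent_set1 centS ?sub1set.
have prNR : 'N_G(R) \proper G by apply: simple_norm_proper (pgroup_sol qR).
have eqN : 'N_G(P) = 'N_G(R).
  apply: nonnil_eq => //; rewrite -eqPQ mulG_subG sPNR (subset_trans sQR) //.
  by rewrite subsetI sRG normG.
have sRN : R \subset 'N_G(P) by rewrite eqN subsetI sRG normG.
have sylQ : q.-Sylow('N_G(P)) Q.
  rewrite /pHall qQ -{1}eqPQ mulG_subr /= -divgS -?eqPQ ?mulG_subr //=.
  rewrite TI_cardMg // mulnK ?cardG_gt0 //; apply: pi_pnat pP _.
  by rewrite !inE eq_sym.
have defQ : Q :=: R.
  apply/eqP; rewrite eqEcard sQR (card_Hall sylQ).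
  by rewrite -(part_pnat_id qR) dvdn_leq ?part_gt0 // partn_dvd ?cardG_gt0 ?cardSg.
case/negP: ncPQ; rewrite (sameP commG1P trivgP) -tiPQ subsetI commg_subl.
rewrite commg_subr nPQ /= defQ; apply: subset_trans sPNR (subsetIr _ _).
Qed.

(** For a proper Q-invariant [X] the group XQ is nilpotent, so [Q] centralizes [X]. Hence [P, Q] = P
    and [Q] centralizes every proper characteristic subgroup, which makes a non-abelian [P] special
    with C_P(Q) = Z(P). *)
Lemma simple_Sylow_cent (p : nat) (P Q : {group gT}) :
    p.-Sylow(G) P -> P :!=: 1 -> P ><| Q = 'N_G(P) -> ~~ (Q \subset 'C(P)) ->
    coprime #|P| #|Q| ->
  [/\ forall X : {group gT}, X \proper P -> Q \subset 'N(X) -> Q \subset 'C(X),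
      abelian P -> 'C_P(Q) = 1
    & ~~ abelian P -> 'C_P(Q) = 'Z(P) /\ 'Z(P) != 1].
Proof.
move=> sylP ntP defN ncPQ coPQ; have [sPG pP _] := and3P sylP.
have prNP : 'N_G(P) \proper G by apply: simple_norm_proper (pgroup_sol pP).
have [_ eqPQ nPQ tiPQ] := sdprodP defN.
have cXQ (X : {group gT}) : X \proper P -> Q \subset 'N(X) -> Q \subset 'C(X).
  move=> prX nXQ; have sXP := proper_sub prX.
  have prXQ : X <*> Q \proper 'N_G(P).
    rewrite properEcard /= -eqPQ norm_joinEr // mulSg //=.
    rewrite TI_cardMg; last by apply/trivgP; rewrite -tiPQ setSI.
    by rewrite TI_cardMg // ltn_pmul2r ?cardG_gt0 // (proper_card prX).
  have nilXQ : nilpotent (X <*> Q).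
    apply: contraTT (prXQ) => nnXQ.
    by rewrite /= (nonnil_eq (proper_sub prXQ)) ?properxx.
  apply: (sub_nilpotent_cent2 nilXQ); rewrite ?joing_subl ?joing_subr //.
  exact: coprimeSg sXP coPQ.
have solP := pgroup_sol pP.
have sRP : [~: P, Q] \subset P by rewrite commg_subl.
have defR : [~: P, Q] = P.
  apply/eqP; rewrite eqEproper sRP /=; apply: contra ncPQ => prR.
  have := cXQ [~: P, Q]%G prR (commg_normr _ _).
  move=> cRQ; have nRP := commg_norml P Q; have nRQ := commg_normr Q P.
  have cPQR : P / [~: P, Q] \subset 'C(Q / [~: P, Q]) by rewrite quotient_cents2 ?subxx.
  have := coprime_quotient_cent sRP nRQ coPQ solP; rewrite (setIidPl cPQR) => eqC.
  rewrite centsC; apply/setIidPl/eqP; rewrite eqEsubset subsetIl /=.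
  have sRC : [~: P, Q] \subset 'C_P(Q) by rewrite subsetI sRP centsC.
  by rewrite -(quotientSGK nRP sRC) eqC.
split=> // [abP | nabP].
  by rewrite -{1}defR coprime_abel_cent_TI.
have [[_ defP'] defC] : special P /\ 'C_P(Q) = 'Z(P).
  apply: (abelian_charsimple_special pP coPQ defR).
  apply/bigcupsP=> H /andP[chH abH]; rewrite centsC; apply: cXQ (char_norm_trans chH nPQ).
  by rewrite properEneq char_sub // andbT; apply: contraNneq nabP => <-.
split=> //; rewrite -defP'; apply: contra nabP => /eqP/derG1P; exact.
Qed.

(** Z(P) centralizes a nontrivial element of the TI group [R], so it normalizes [R]; the complement
    in N(R) has prime order, so Z(P) has order p and is such a complement. The conclusion reproduces
    the hypotheses with (P, Q) replaced by (R, Z(P)), so the lemma can be applied a second time. *)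
Lemma simple_Sylow_center (p q : nat) (P Q R : {group gT}) :
    prime p -> prime q -> q != p -> p.-Sylow(G) P -> P :!=: 1 ->
    P ><| Q = 'N_G(P) -> #|Q| = q -> ~~ (Q \subset 'C(P)) ->
    'C_P(Q) != 1 -> q.-Sylow(G) R -> Q \subset R ->
  [/\ ~~ abelian P, #|'Z(P)| = p & 'C_P(Q) = 'Z(P)] /\
  [/\ R ><| 'Z(P) = 'N_G(R), ~~ ('Z(P) \subset 'C(R)) & 'C_R('Z(P)) != 1].
Proof.
move=> p_pr q_pr neq sylP ntP defN oQ ncPQ ntC sylR sQR.
have pP := pHall_pgroup sylP; have qR := pHall_pgroup sylR.
have coPR : coprime #|P| #|R| by apply: pnat_coprime pP (pi_pnat qR _).
have coPQ : coprime #|P| #|Q| := coprimegS sQR coPR.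
have [_ abC nabC] := simple_Sylow_cent sylP ntP defN ncPQ coPQ.
have nabP : ~~ abelian P by apply: contra ntC => /abC->.
have [defC ntZ] := nabC nabP.
have ntQ : Q :!=: 1 by rewrite -cardG_gt1 oQ prime_gt1.
have ntR : R :!=: 1 by apply: contraNneq ntQ => R1; rewrite -subG1 -R1.
have tiR := simple_Sylow_TI sylR ntR.
have cZQ : 'Z(P) \subset 'C(Q) by rewrite -defC subsetIr.
have [b Qb ntb] := trivgPn _ ntQ.
have sZP : 'Z(P) \subset P := center_sub P.
have sZNR : 'Z(P) \subset 'N_G(R).
  apply: subset_trans (cent1_normedTI tiR (x := b) _); last first.
    by rewrite !inE ntb (subsetP sQR).
  rewrite subsetI (subset_trans sZP (pHall_sub sylP)).
  by apply: subset_trans cZQ _; rewrite -cent_set1 centS ?sub1set.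
have [r [A0 [r_pr _ oA0 defNR ncRA0]]] := simple_norm_Sylow sylR ntR.
have pZ := pgroupS sZP pP.
have [_ dvpZ _] := pgroup_pdiv pZ ntZ.
have oNR := sdprod_card defNR.
have dvp : p %| #|R| * r by rewrite -oA0 oNR (dvdn_trans dvpZ) ?cardSg.
have p'R : p^'.-group R by apply: pi_pnat qR _.
have defr : r = p.
  move: dvp; rewrite Euclid_dvdM // => /orP[dvR|]; last first.
    by rewrite dvdn_prime2 // => /eqP.
  by have := pgroupP p'R p p_pr dvR; rewrite !inE eqxx.
have oZ : #|'Z(P)| = p.
  apply/eqP; rewrite eqn_dvd dvpZ andbT.
  have oRp : ((#|R| * p)`_p = p)%N.
    rewrite partnM ?cardG_gt0 ?(prime_gt0 p_pr) // (part_p'nat p'R) mul1n.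
    by rewrite part_pnat_id ?pnat_id.
  rewrite -(part_pnat_id pZ) -[X in _ %| X]oRp.
  rewrite partn_dvd ?muln_gt0 ?cardG_gt0 ?(prime_gt0 p_pr) //.
  by rewrite -defr -oA0 oNR cardSg.
have tiRZ : R :&: 'Z(P) = 1.
  by apply: coprime_TIg; rewrite coprime_sym (coprimeSg sZP).
have nRZ : 'Z(P) \subset 'N(R) := subset_trans sZNR (subsetIr _ _).
have defNRZ : R ><| 'Z(P) = 'N_G(R).
  rewrite sdprodE //; apply/eqP; rewrite eqEcard mul_subG ?sZNR //=; last first.
    by rewrite subsetI (pHall_sub sylR) normG.
  by rewrite TI_cardMg // -oNR oA0 oZ defr.
have coRA0 : coprime #|R| #|A0| by rewrite oA0 defr coprime_sym (pnat_coprime (pnat_id p_pr)).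
have ncRZ : ~~ ('Z(P) \subset 'C(R)).
  apply: contra ncRA0 => cRZ; have [_ eqN _ _] := sdprodP defNRZ.
  have nilN : nilpotent 'N_G(R).
    by rewrite -eqN mulg_nil // (pgroup_nil qR) (pgroup_nil pZ).
  have [_ eqN0 _ _] := sdprodP defNR.
  by apply: (sub_nilpotent_cent2 nilN); rewrite // -eqN0 ?mulG_subl ?mulG_subr.
split; split=> //; apply/trivgPn; exists b => //.
by rewrite inE (subsetP sQR) //; apply: (subsetP _ b Qb); rewrite centsC.
Qed.

(** Otherwise Z(P) and Z(R) commute and have orders p and q. The products of their nontrivial
    elements form a TI set [W], and the conjugates of P^#, R^# and [W] are pairwise disjoint:
    together with 1 they are more elements than [G] has. *)
Lemma simple_Sylow_regular (p q : nat) (P Q : {group gT}) :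
    prime p -> prime q -> q != p -> p.-Sylow(G) P -> P :!=: 1 ->
    P ><| Q = 'N_G(P) -> #|Q| = q -> ~~ (Q \subset 'C(P)) ->
  'C_P(Q) = 1.
Proof.
move=> p_pr q_pr neq sylP ntP defN oQ ncPQ; apply/eqP/idPn => ntC.
have qQ : q.-group Q by rewrite /pgroup oQ pnat_id.
have [_ eqPQ nPQ _] := sdprodP defN.
have sQG : Q \subset G by apply: subset_trans (subsetIl G 'N(P)); rewrite -eqPQ mulG_subr.
have [R sylR sQR] := Sylow_superset sQG qQ.
have [[nabP oA _] [defNR ncRA ntCR]] := simple_Sylow_center p_pr q_pr neq sylP ntP defN oQ ncPQ
  ntC sylR sQR.
have ntR : R :!=: 1 by apply: contraNneq ntCR => ->; rewrite /= setI1g.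
have nepq : p != q by rewrite eq_sym.
have [[nabR oB defCR] [defNP _ _]] :=
  simple_Sylow_center q_pr p_pr nepq sylR ntR defNR oA ncRA ntCR sylP (center_sub P).
have pP := pHall_pgroup sylP; have qR := pHall_pgroup sylR.
have sAP := center_sub P; have sBR := center_sub R.
have cAB : 'Z(R) \subset 'C('Z(P)) by rewrite -defCR subsetIr.
have tiP := simple_Sylow_TI sylP ntP; have tiR := simple_Sylow_TI sylR ntR.
have [_ _ tiPJ] := normedTI_memJ_P tiP; have [_ _ tiRJ] := normedTI_memJ_P tiR.
(* The factors of a product are its p-part and q-part, so an element conjugating a member of [W]
   into [W] conjugates the factors as well. *)
have constA a b : a \in 'Z(P) -> b \in 'Z(R) -> (a * b).`_p = a /\ (a * b).`_q = b.
  move=> Aa Bb; have cab : commute a b by apply: commute_sym; apply: (centsP cAB).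
  have pa := mem_p_elt (pgroupS sAP pP) Aa; have qb := mem_p_elt (pgroupS sBR qR) Bb.
  rewrite !consttM // (constt_p_elt pa) (constt_p_elt qb).
  rewrite !(constt1P _) ?mulg1 ?mul1g //.
    by apply: pi_pnat pa _; rewrite !inE.
  by apply: pi_pnat qb _; rewrite !inE.
pose W := [set x.1 * x.2 | x in setX ('Z(P))^# ('Z(R))^#].
have WP w : w \in W -> exists a b, [/\ a \in ('Z(P))^#, b \in ('Z(R))^# & w = a * b].
  by case/imsetP=> [[a b]]; rewrite inE /= => /andP[Aa Bb] ->; exists a, b.
pose L := ('N_G(P) :&: 'N_G(R))%G.
have tiW : normedTI W G L.
  apply/normedTI_memJ_P; split; last first.
  - move=> w g /WP[a [b [/setD1P[nta Aa] /setD1P[ntb Bb] ->]]] Gg.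
    have [abp abq] := constA a b Aa Bb.
    apply/idP/idP=> [/WP[a' [b' [/setD1P[nta' Aa'] /setD1P[ntb' Bb'] def]]] | ].
      have [abp' abq'] := constA a' b' Aa' Bb'.
      have Pa : a \in P^# by rewrite !inE nta (subsetP sAP).
      have Rb : b \in R^# by rewrite !inE ntb (subsetP sBR).
      apply/setIP; split.
        rewrite -(tiPJ a) // -{1}abp -consttJ def abp'.
        by rewrite !inE nta' (subsetP sAP).
      rewrite -(tiRJ b) // -{1}abq -consttJ def abq'.
      by rewrite !inE ntb' (subsetP sBR).
    case/setIP=> /setIP[_ nPg] /setIP[_ nRg]; apply/imsetP.
    exists (a ^ g, b ^ g); last by rewrite conjMg.
    have nAg : g \in 'N('Z(P)) by apply: (subsetP (char_norms (center_char P))).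
    have nBg : g \in 'N('Z(R)) by apply: (subsetP (char_norms (center_char R))).
    by apply/setXP; split; apply/setD1P; rewrite conjg_eq1 memJ_norm.
  - by rewrite subIset ?subsetIl.
  have [a Aa nta] : exists2 a, a \in 'Z(P) & a != 1 by apply/trivgPn;
    rewrite -cardG_gt1 oA prime_gt1.
  have [b Bb ntb] : exists2 b, b \in 'Z(R) & b != 1 by apply/trivgPn;
    rewrite -cardG_gt1 oB prime_gt1.
  by apply/set0Pn; exists (a * b); apply/imsetP; exists (a, b) => //; apply/setXP; split;
    apply/setD1P.
have cardD1 (X : {group gT}) : #|X^#| = #|X|.-1 by rewrite (cardsD1 1 X) group1.
have cardW : #|W| = (p.-1 * q.-1)%N.
  rewrite card_in_imset ?cardsX ?cardD1 /= ?oA ?oB //.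
  move=> [a b] [a' b'] /setXP[/= /setD1P[_ Aa] /setD1P[_ Bb]] /setXP[/= /setD1P[_ Aa'] /setD1P[_
    Bb']] eqab.
  have [ea eb] := constA a b Aa Bb; have [ea' eb'] := constA a' b' Aa' Bb'.
  by congr (_, _); [rewrite -ea eqab | rewrite -eb eqab].
have oNP := sdprod_card defNP; have oNR := sdprod_card defNR.
rewrite oB in oNP; rewrite oA in oNR.
(* The p-part of |L| divides that of |R| p, which is p; the p'-part divides that of |P| q, which is
   q. *)
have leL : #|L| <= p * q.
  have dvL1 : #|L| %| #|P| * q by rewrite oNP cardSg ?subsetIl.
  have dvL2 : #|L| %| #|R| * p by rewrite oNR cardSg ?subsetIr.
  have oRp : ((#|R| * p)`_p = p)%N.
    rewrite partnM ?cardG_gt0 ?(prime_gt0 p_pr) // part_p'nat ?mul1n.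
      by rewrite part_pnat_id ?pnat_id.
    by apply: pi_pnat qR _; rewrite !inE.
  have oPq : ((#|P| * q)`_p^' = q)%N.
    rewrite partnM ?cardG_gt0 ?(prime_gt0 q_pr) // (@part_p'nat p^') ?pnatNK // mul1n.
    by rewrite part_pnat_id ?pnatE ?inE.
  rewrite -(partnC p (cardG_gt0 L)) dvdn_leq ?muln_gt0 ?(prime_gt0 p_pr) ?(prime_gt0 q_pr) //.
  by rewrite dvdn_mul //
    -[X in _ %| X](oRp, oPq) partn_dvd ?muln_gt0 ?cardG_gt0 ?(prime_gt0 p_pr) ?(prime_gt0 q_pr).
have divZ (X : {group gT}) : ~~ abelian X -> exists2 u, #|X| = (#|'Z(X)| * u)%N & 1 < u.
  move=> nabX; exists #|X : 'Z(X)|; first by rewrite Lagrange ?center_sub.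
  by rewrite indexg_gt1; apply: contra nabX => sXZ; apply: subset_trans sXZ (subsetIr _ _).
have [u oP u_gt1] := divZ P nabP; have [v oR v_gt1] := divZ R nabR.
rewrite oA in oP; rewrite oB in oR.
have := mixed_order_count (n := #|G|) (p := p) (q := q) (u := u) (v := v)
  (n1 := #|G : 'N_G(P)|) (n2 := #|G : 'N_G(R)|) (n3 := #|G : L|) (l := #|L|).
rewrite -oP -oR oNP oNR !(mulnC #|G : _|) !Lagrange ?subIset ?subsetIl ?subxx //.
move/(_ erefl erefl erefl (cardG_gt0 G) (prime_gt1 p_pr) (prime_gt1 q_pr) u_gt1 v_gt1 leL).
rewrite -cardW -(card_support_normedTI tiW).
rewrite -!cardD1 -(card_support_normedTI tiP) -(card_support_normedTI tiR) leqNgt => /negP; apply.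
have cst_cs (A : {set gT}) r x : x \in class_support A G -> exists2 a, a \in A & (x.`_r == 1) =
  (a.`_r == 1).
  by case/imset2P=> a g Aa _ ->; exists a; rewrite // consttJ conjg_eq1.
have cs1 x : x \in class_support P^# G -> (x.`_p == 1) = false /\ (x.`_q == 1).
  move=> csx; have [a /setD1P[nta Pa] ->] := cst_cs _ p x csx.
  have pa := mem_p_elt pP Pa; rewrite (constt_p_elt pa) (negPf nta); split=> //.
  have [a' /setD1P[_ Pa'] ->] := cst_cs _ q x csx.
  by apply/eqP/constt1P; apply: pi_pnat (mem_p_elt pP Pa') _; rewrite !inE.
have cs2 x : x \in class_support R^# G -> (x.`_q == 1) = false /\ (x.`_p == 1).
  move=> csx; have [a /setD1P[nta Ra] ->] := cst_cs _ q x csx.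
  have qa := mem_p_elt qR Ra; rewrite (constt_p_elt qa) (negPf nta); split=> //.
  have [a' /setD1P[_ Ra'] ->] := cst_cs _ p x csx.
  by apply/eqP/constt1P; apply: pi_pnat (mem_p_elt qR Ra') _; rewrite !inE.
have cs3 x : x \in class_support W G -> (x.`_p == 1) = false /\ (x.`_q == 1) = false.
  move=> csx; have [w /WP[a [b [/setD1P[nta Aa] /setD1P[_ Bb] ->]]] ->] := cst_cs _ p x csx.
  have [w' /WP[a' [b' [/setD1P[_ Aa'] /setD1P[ntb' Bb'] ->]]] ->] := cst_cs _ q x csx.
  by have [-> _] := constA a b Aa Bb; have [_ ->] := constA a' b' Aa' Bb';
    rewrite (negPf nta) (negPf ntb').
have d12 : class_support P^# G :&: class_support R^# G = set0.
  by apply/setP=> x; rewrite !inE; apply/andP=> -[/cs1[_ e] /cs2[]]; rewrite e.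
have d3 : (class_support P^# G :|: class_support R^# G) :&: class_support W G = set0.
  apply/setP=> x; rewrite in_setI in_setU in_set0; apply/andP=> -[/orP[/cs1[_ e]|/cs2[_ e]] /cs3[]].
    by rewrite e.
  by rewrite e.
have: #|class_support P^# G :|: class_support R^# G :|: class_support W G| < #|G|.
  rewrite [X in _ < X](cardsD1 1 G) group1 add1n ltnS subset_leq_card //.
  have sWG : W \subset G.
    apply/subsetP=> _ /WP[a [b [/setD1P[_ Aa] /setD1P[_ Bb] ->]]].
    apply: groupM; first by rewrite (subsetP (pHall_sub sylP)) ?(subsetP sAP).
    by rewrite (subsetP (pHall_sub sylR)) ?(subsetP sBR).
  apply/subsetP=> x cs_x; rewrite !inE; apply/andP; split.
    apply: contraTneq cs_x => ->; rewrite !in_setU.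
    by apply/negP=> /orP[/orP[/cs1[]|/cs2[]]|/cs3[]]; rewrite constt1 eqxx.
  case/setUP: cs_x => [/setUP[]|]; apply: (subsetP (class_support_subG _)) => //;
    apply: subset_trans (subsetDl _ _) _.
    exact: pHall_sub sylP.
  exact: pHall_sub sylR.
by rewrite cardsU d3 cards0 subn0 cardsU d12 cards0 subn0.
Qed.

(** C_P(Q) = 1 rules out the non-abelian case and makes [Q] act irreducibly on [P], so Omega_1(P) =
    P. Centralizers stay in N(P) by TI and then in the Frobenius kernel. *)
Lemma simple_Sylow_structure (p : nat) (P : {group gT}) :
    prime p -> p.-Sylow(G) P -> P :!=: 1 ->
  [/\ p.-abelem P, {in P^#, forall x, 'C_G[x] = P}
    & exists q, exists Q : {group gT},
      [/\ prime q, q != p, #|Q| = q, [Frobenius 'N_G(P) = P ><| Q]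
        & forall X : {group gT}, X \proper P -> Q \subset 'N(X) -> X :=: 1]].
Proof.
move=> p_pr sylP ntP; have [sPG pP _] := and3P sylP.
have [q [Q [q_pr neq oQ defN ncPQ]]] := simple_norm_Sylow sylP ntP.
have regQ := simple_Sylow_regular p_pr q_pr neq sylP ntP defN oQ ncPQ.
have coPQ : coprime #|P| #|Q|.
  by rewrite oQ; apply: pnat_coprime pP _; rewrite pnatE ?inE.
have [cXQ _ nabC] := simple_Sylow_cent sylP ntP defN ncPQ coPQ.
have abP : abelian P.
  by apply/idPn=> /nabC[defZ]; rewrite -defZ regQ eqxx.
have irrQ (X : {group gT}) : X \proper P -> Q \subset 'N(X) -> X :=: 1.
  move=> prX nXQ; apply/trivgP; rewrite -regQ subsetI proper_sub //.
  by rewrite centsC cXQ.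
have [_ _ nPQ _] := sdprodP defN.
have frobN : [Frobenius 'N_G(P) = P ><| Q].
  by apply/prime_FrobeniusP; rewrite ?oQ.
split; last by exists q, Q.
  have chO := Ohm_char 1 P; have ntO : 'Ohm_1(P) != 1 by rewrite Ohm1_eq1.
  rewrite -[P : {set gT}](_ : 'Ohm_1(P) = P) ?Ohm1_abelem //.
  apply/eqP; rewrite eqEproper Ohm_sub /=; apply: contra ntO => prO.
  by apply/eqP; apply: (irrQ 'Ohm_1(P)%G) => //; apply: char_norm_trans chO nPQ.
move=> x P1x; have [ntx Px] := setD1P P1x.
apply/eqP; rewrite eqEsubset subsetI sPG sub_cent1 (subsetP abP x Px) !andbT.
have sCN := cent1_normedTI (simple_Sylow_TI sylP ntP) P1x.
apply: subset_trans (Frobenius_cent1_ker frobN P1x).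
by rewrite subsetI sCN subsetIr.
Qed.

(** A power of [x] of prime order lies in a Sylow subgroup, which is its whole centralizer and so
    contains [x]. *)
Lemma simple_element_Sylow x :
  x \in G^# -> exists p, exists2 P : {group gT}, p.-Sylow(G) P & prime p /\ x \in P.
Proof.
case/setD1P=> ntx Gx; have n_gt1 : 1 < #[x] by rewrite order_gt1.
pose p := pdiv #[x]; have p_pr : prime p := pdiv_prime n_gt1.
have dvp : p %| #[x] := pdiv_dvd _.
pose y := x ^+ (#[x] %/ p).
have oy : #[y] = p by rewrite orderXdiv ?dvdn_div // divnA ?mulKn.
have py : p.-group <[y]> by rewrite /pgroup -orderE oy pnat_id.
have syG : <[y]> \subset G by rewrite cycle_subG groupX.
have [P sylP syP] := Sylow_superset syG py.
exists p, P => //; split=> //.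
have nty : y != 1 by rewrite -order_gt1 oy prime_gt1.
rewrite cycle_subG in syP.
have ntP : P :!=: 1 by apply/trivgPn; exists y.
have [_ cP _] := simple_Sylow_structure p_pr sylP ntP.
have: x \in 'C_G[y] by rewrite inE Gx; apply/cent1P; rewrite /commute /y -expgS -expgSr.
by rewrite cP // !inE nty.
Qed.

End SimpleLocal.

(** * Exceptional characters and odd order *)

Section ExceptionalCharacters.

Import Order.TTheory GRing.Theory Num.Theory.
Local Open Scope ring_scope.

Variables (gT : finGroupType) (G L H : {group gT}).
Hypotheses (abH : abelian H) (tiH : normedTI H^# G L).
Hypothesis frobL : [Frobenius L with kernel H].

(** These are the irreducible characters of [L] induced from nontrivial linear characters of [H]:
    there are (u - 1) / q of them, of degree [q], vanishing off [H]. *)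
Let S := [set j : Iirr L | ~~ (H \subset cfker 'chi_j)].
Let q := #|L : H|.
Let u := #|H|.

Let sLG : L \subset G. Proof. by case/normedTI_memJ_P: tiH. Qed.
Let nsHL : H <| L. Proof. by case/Frobenius_kerP: frobL. Qed.
Let sHL : H \subset L. Proof. exact: normal_sub. Qed.
Let oL : (u * q)%N = #|L|. Proof. exact: Lagrange. Qed.

Lemma Frobenius_irr_deg j : j \in S -> 'chi_j 1%g = q%:R.
Proof.
rewrite inE => /(Frobenius_Ind_irrP frobL)[i _ ->].
have /char_abelianP/(_ i)/lin_char1 chi1 := abH.
by rewrite cfInd1 // chi1 mulr1.
Qed.

Lemma Frobenius_irr_off j x : j \in S -> x \notin H -> 'chi_j x = 0.
Proof.
rewrite inE => /(Frobenius_Ind_irrP frobL)[i _ ->] notHx.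
exact: (cfun_onP (cfInd_normal _ nsHL)).
Qed.

Lemma irr_ker_val j x : j \notin S -> x \in H -> 'chi_j x = 'chi_j 1%g.
Proof. by rewrite inE negbK => sHK Hx; rewrite cfker1 // (subsetP sHK). Qed.

Lemma sum_irr_ker x : x \in H -> \sum_(j | j \notin S) `|'chi[L]_j x| ^+ 2 = q%:R.
Proof.
move=> Hx; rewrite (eq_bigl (fun j => H \subset cfker 'chi_j)); last first.
  by move=> j; rewrite inE negbK.
rewrite -sum_norm_irr_quo ?(subsetP sHL) //.
have := second_orthogonality_relation (coset H x) (group1 (L / H)%G).
rewrite coset_id // cent11T setIT class_refl card_quotient ?normal_norm // mulr1n => <-.
by apply: eq_bigr => j _; rewrite normCK.
Qed.

Lemma sum_Frobenius_irr_norm x :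
  x \in H^# -> \sum_(j in S) `|'chi_j x| ^+ 2 = u%:R - q%:R.
Proof.
move=> H1x; have [ntx Hx] := setD1P H1x.
have := second_orthogonality_relation x (subsetP sHL x Hx).
rewrite class_refl mulr1n (_ : 'C_L[x] = H); last first.
  apply/eqP; rewrite eqEsubset; have [_ _ _ -> //] := Frobenius_kerP frobL.
  by rewrite subsetI sHL sub_cent1 (subsetP abH).
rewrite (bigID (mem S)) /= => <-.
rewrite -[q%:R](sum_irr_ker Hx) -[X in _ = _ - X](eq_bigr _ (fun j _ => esym (normCK _))).
by rewrite addrK; apply: eq_bigr => j _; rewrite normCK.
Qed.

Lemma sum_Frobenius_irr x : x \in H^# -> \sum_(j in S) 'chi_j x = -1.
Proof.
move=> H1x; have [ntx Hx] := setD1P H1x.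
have q_neq0 : q%:R != 0 :> algC by rewrite pnatr_eq0 -lt0n indexg_gt0.
have := second_orthogonality_relation x (group1 L).
rewrite class1G inE (negPf ntx) mulr0n (bigID (mem S)) /=.
rewrite (eq_bigr (fun j => 'chi_j x * q%:R)) => [|j Sj]; last first.
  by rewrite Frobenius_irr_deg // conjC_nat.
rewrite [X in _ + X](eq_bigr (fun j => `|'chi_j x| ^+ 2)) => [|j nSj]; last first.
  by rewrite normCK -(irr_ker_val nSj Hx).
rewrite sum_irr_ker // -mulr_suml => /eqP; rewrite addr_eq0 => /eqP eqS.
by apply: (mulIf q_neq0); rewrite mulN1r.
Qed.

Lemma card_Frobenius_irr : (q * #|S|)%N = u.-1.
Proof.
apply/eqP; rewrite -(eqn_pmul2l (indexg_gt0 L H)) -(eqr_nat algC).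
have := second_orthogonality_relation 1%g (group1 L).
rewrite class_refl mulr1n cent11T setIT (bigID (mem S)) /=.
rewrite (eq_bigr (fun j => q%:R * q%:R)) => [|j Sj]; last first.
  by rewrite Frobenius_irr_deg // conjC_nat.
rewrite [X in _ + X](eq_bigr (fun j => `|'chi_j 1%g| ^+ 2)) => [|j nSj]; last first.
  by rewrite normCK.
rewrite sum_irr_ker // sumr_const -oL => /eqP.
rewrite -[_ *+ #|S|]mulr_natr -!natrM -natrD !eqr_nat => /eqP eqS.
rewrite -/q -(eqn_add2r q) mulnA eqS.
by rewrite -mulnSr prednK ?cardG_gt0 // mulnC.
Qed.

Lemma Frobenius_irr_sum j : j \in S -> \sum_(x in H^#) 'chi_j x = - q%:R.
Proof.
move=> Sj; have j_neq0 : j != 0.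
  by apply: contraTneq Sj => ->; rewrite inE negbK irr0 cfker_cfun1.
have := cfdot_irr j 0; rewrite (negPf j_neq0) irr0 cfdotE.
move/eqP; rewrite mulr0n mulf_eq0 invr_eq0 (negPf (neq0CG L)) /=.
rewrite (big_setID H) /= (setIidPr sHL) [X in _ + X]big1 => [|x /setDP[_ notHx]]; last first.
  by rewrite Frobenius_irr_off ?mul0r.
rewrite addr0 (big_setD1 1%g) //= cfun11 conjC1 mulr1 Frobenius_irr_deg // addrC addr_eq0.
move/eqP=> <-; apply: eq_bigr => x /setD1P[_ Hx].
by rewrite cfun1E (subsetP sHL) // conjC1 mulr1.
Qed.

Lemma Frobenius_irr_sum_norm j :
  j \in S -> \sum_(x in H^#) `|'chi_j x| ^+ 2 = (u * q)%:R - q%:R ^+ 2.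
Proof.
move=> Sj; have := cfdot_irr j j; rewrite eqxx cfdotE => /(canRL (mulVKf (neq0CG L))).
rewrite mulr1 oL => <-.
rewrite [X in _ = X - _](big_setID H) /= (setIidPr sHL) [X in _ = _ + X - _]big1 => [|x /setDP[_
  notHx]]; last first.
  by rewrite Frobenius_irr_off ?mul0r.
rewrite addr0 [X in _ = X - _](big_setD1 1%g) //= Frobenius_irr_deg // conjC_nat -expr2 addrC addrK.
by apply: eq_bigr => x _; rewrite normCK.
Qed.

(** At x in H^# a term of the induction formula with x^y in H^# has y in [L], so the sum collapses
    to the original value. *)
Lemma cfInd_TI (phi : 'CF(L)) :
    phi \in 'CF(L, H^#) ->
  {in H^#, 'Ind[G] phi =1 phi} /\ 'Ind[G] phi \in 'CF(G, class_support H^# G).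
Proof.
move=> Hphi; have [_ _ tiJ] := normedTI_memJ_P tiH; split.
  move=> x H1x; rewrite cfIndE // (big_setID L) /= (setIidPr sLG).
  rewrite [X in _ + X]big1 => [|y /setDP[Gy notLy]]; last first.
    by rewrite (cfun_onP Hphi) // tiJ.
  rewrite addr0 (eq_bigr (fun _ => phi x)) => [|y Ly]; last by rewrite cfunJ.
  by rewrite sumr_const -[phi x *+ _]mulr_natl mulKf // pnatr_eq0 -lt0n cardG_gt0.
apply/cfun_onP=> x notSx; rewrite cfIndE // big1 ?mulr0 // => y Gy.
rewrite (cfun_onP Hphi) //; apply: contra notSx => H1xy.
by apply/imset2P; exists (x ^ y)%g y^-1%g; rewrite ?groupV ?conjgK.
Qed.

Lemma Frobenius_irr_diff_on j k : j \in S -> k \in S -> 'chi_j - 'chi_k \in 'CF(L, H^#).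
Proof.
move=> Sj Sk; apply/cfun_onP=> x; rewrite !inE negb_and negbK !cfunE.
by case/predU1P=> [->|notHx]; rewrite ?Frobenius_irr_deg ?Frobenius_irr_off ?subrr.
Qed.

Lemma Frobenius_irr_Ind_dot j k l m :
    j \in S -> k \in S -> l \in S -> m \in S ->
  '['Ind[G] ('chi_j - 'chi_k), 'Ind[G] ('chi_l - 'chi_m)] =
  '['chi_j - 'chi_k, 'chi_l - 'chi_m].
Proof.
move=> Sj Sk Sl Sm; rewrite -cfdot_Res_l; apply: eq_cfdotl (Frobenius_irr_diff_on Sl Sm) _.
move=> x H1x; have [eqI _] := cfInd_TI (Frobenius_irr_diff_on Sj Sk).
rewrite -[RHS](eqI x H1x).
by rewrite cfResE // (subsetP sHL) //; case/setD1P: H1x.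
Qed.

(** Inner product 1 means that two differences share exactly one constituent, with the same sign. If
    a j and a k differ, then b j = b k, and any other a l differs from one of them, so [b] is
    constant. *)
Lemma shared_irr_diff (T : finType) (A : {set T}) (a b : T -> Iirr G) :
    {in A, forall j, a j != b j} ->
    {in A &, forall j k, j != k ->
       '['chi_(a j) - 'chi_(b j), 'chi_(a k) - 'chi_(b k)] = 1} ->
  [/\ {in A &, forall j k, j != k -> (a j == a k) = (b j != b k)},
      {in A &, forall j k, a j != b k}
    & {in A &, forall j k, a j = a k} \/ {in A &, forall j k, b j = b k}].
Proof.
move=> neab dot1.
have dotE j k : j \in A -> k \in A -> j != k ->
    ((a j == a k) + (b j == b k) = 1 + (a j == b k) + (b j == a k))%N.
  move=> Aj Ak nejk; apply/eqP; rewrite -(eqr_nat algC) !natrD; apply/eqP.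
  have := dot1 j k Aj Ak nejk.
  rewrite cfdotBl !cfdotBr !cfdot_irr => E.
  by rewrite -addrA -[X in X + (_ + _)]E; ring.
have xorE : {in A &, forall j k, j != k -> (a j == a k) = (b j != b k) /\ (a j != b k)}.
  move=> j k Aj Ak nejk; have := dotE j k Aj Ak nejk.
  have := neab j Aj; have := neab k Ak.
  case: (eqVneq (a j) (a k)) => [->|_]; case: (eqVneq (b j) (b k)) => [->|_] /=.
  - by move=> /negPf nek _; rewrite nek eq_sym nek.
  - by move=> nek _ _.
  - by move=> _ nek _.
  by [].
split.
- by move=> j k Aj Ak nejk; case: (xorE j k).
- move=> j k Aj Ak; have [<-|nejk] := eqVneq j k; first exact: neab.
  by case: (xorE j k).
case: (boolP [forall j in A, forall k in A, a j == a k]) => [/forall_inP eqa | ].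
  by left=> j k Aj Ak; apply/eqP; apply: (forall_inP (eqa j Aj)).
rewrite negb_forall_in => /exists_inP[j Aj]; rewrite negb_forall_in => /exists_inP[k Ak neajk].
have nejk : j != k by apply: contraNneq neajk => ->.
have eqb l m : l \in A -> m \in A -> a l != a m -> b l = b m.
  move=> Al Am neal; have nelm : l != m by apply: contraNneq neal => ->.
  have [E _] := xorE l m Al Am nelm; apply/eqP; by rewrite E negbK in neal.
have eqbj l : l \in A -> b l = b j.
  move=> Al; have [eqal|neal] := eqVneq (a l) (a j); last exact: eqb.
  rewrite (eqb j k) //; apply: eqb => //; by rewrite eqal.
by right=> l m Al Am; rewrite !eqbj.
Qed.

(** The induced differences from a fixed [j0] have norm 2, degree 0 and mutual inner products 1:
    each is a difference of two irreducibles, and all share one of them. *)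
Lemma exceptional_map :
    (1 < #|S|)%N ->
  exists e : bool, exists2 f : Iirr L -> Iirr G, {in S &, injective f} &
    {in S &, forall j k, 'Ind[G] ('chi_j - 'chi_k) = (-1) ^+ e *: ('chi_(f j) - 'chi_(f k))}.
Proof.
case/card_gt1P=> j0 [j1 [Sj0 Sj1 ne01]].
pose S' := S :\ j0; pose beta j := 'Ind[G] ('chi_j - 'chi_j0).
have S'S j : j \in S' -> j \in S by case/setD1P.
have S'j1 : j1 \in S' by rewrite /S' in_setD1 eq_sym ne01.
have dotb j k : j \in S' -> k \in S' -> '[beta j, beta k] = 1 + (j == k)%:R.
  move=> S'j S'k; rewrite Frobenius_irr_Ind_dot ?(S'S _ S'j) ?(S'S _ S'k) //.
  have [/negPf nj _] := setD1P S'j; have [/negPf nk _] := setD1P S'k.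
  rewrite cfdotBl !cfdotBr !cfdot_irr eqxx nj (eq_sym j0 k) nk /= !mulr0n subr0 sub0r opprK addrC
    //.
have [ab abP] : exists ab : Iirr L -> Iirr G * Iirr G, forall j, j \in S' ->
    (ab j).2 != (ab j).1 /\ beta j = 'chi_(ab j).1 - 'chi_(ab j).2.
  apply: (fin_all_exists (P := fun j (x : Iirr G * Iirr G) => j \in S' ->
    x.2 != x.1 /\ beta j = 'chi_x.1 - 'chi_x.2)) => j.
  case S'j: (j \in S'); last by exists (0, 0).
  have Zb : beta j \in 'Z[irr G, G^#].
    rewrite zcharD1E cfInd_vchar ?rpredB ?irr_vchar //=.
    by rewrite cfInd1 // !cfunE (Frobenius_irr_deg (S'S _ S'j)) (Frobenius_irr_deg Sj0) subrr mulr0.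
  have [|a [b ne_ba def_b]] := vchar_norm2 Zb; first by rewrite dotb // eqxx.
  by exists (a, b).
pose a j := (ab j).1; pose b j := (ab j).2.
have neab : {in S', forall j, a j != b j} by move=> j /abP[]; rewrite eq_sym.
have [|xorE crossE constE] := shared_irr_diff neab.
  move=> j k S'j S'k nejk; have [_ <-] := abP j S'j; have [_ <-] := abP k S'k.
  by rewrite dotb // (negPf nejk) addr0.
have beta0 : beta j0 = 0 by rewrite /beta subrr linear0.
have betaB j k : 'Ind[G] ('chi_j - 'chi_k) = beta j - beta k.
  by rewrite /beta -linearB /=; congr ('Ind[G] _); rewrite opprB addrA subrK.
have wrap (e : bool) (f : Iirr L -> Iirr G) : {in S &, injective f} ->
    {in S', forall j, beta j = (-1) ^+ e *: ('chi_(f j) - 'chi_(f j0))} ->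
  exists e : bool, exists2 f : Iirr L -> Iirr G, {in S &, injective f} &
    {in S &, forall j k, 'Ind[G] ('chi_j - 'chi_k) = (-1) ^+ e *: ('chi_(f j) - 'chi_(f k))}.
  move=> injf bf; exists e, f => // j k Sj Sk; rewrite betaB.
  have bE l : l \in S -> beta l = (-1) ^+ e *: ('chi_(f l) - 'chi_(f j0)).
    move=> Sl; have [->|nel] := eqVneq l j0; first by rewrite beta0 subrr scaler0.
    by apply: bf; apply/setD1P.
  by rewrite !bE // -scalerBr opprB addrA subrK.
have injD (f : Iirr L -> Iirr G) : {in S' &, injective f} -> {in S', forall j, f j != f j0} ->
    {in S &, injective f}.
  move=> inj' ne0 j k Sj Sk eqf; have [ej|nej] := eqVneq j j0; have [ek|nek] := eqVneq k j0.
  - by rewrite ej.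
  - have := ne0 k; rewrite -eqf ej eqxx => /(_ _)/negP[] //; exact/setD1P.
  - have := ne0 j; rewrite eqf ek eqxx => /(_ _)/negP[] //; exact/setD1P.
  by apply: inj' => //; apply/setD1P.
(* If the positive constituents agree, the common one becomes the image of [j0] and the sign is -1;
   if the negative ones agree, the sign is +1. *)
case: constE => constE.
  pose f j := if j == j0 then a j1 else b j.
  have fE j : j \in S' -> f j = b j by case/setD1P=> /negPf nej _; rewrite /f nej.
  have f0 : f j0 = a j1 by rewrite /f eqxx.
  apply: (wrap true f).
    apply: injD => [j k S'j S'k | j S'j]; last first.
      by rewrite fE // f0 eq_sym crossE.
    rewrite !fE // => eqb; apply/eqP/idPn => nejk.
    by have := xorE j k S'j S'k nejk; rewrite eqb eqxx (constE j k) ?eqxx.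
  move=> j S'j; rewrite fE // f0 expr1 scaleN1r opprB.
  by have [_ ->] := abP j S'j; rewrite -/(a j) (constE j j1).
pose f j := if j == j0 then b j1 else a j.
have fE j : j \in S' -> f j = a j by case/setD1P=> /negPf nej _; rewrite /f nej.
have f0 : f j0 = b j1 by rewrite /f eqxx.
apply: (wrap false f).
  apply: injD => [j k S'j S'k | j S'j]; last first.
    by rewrite fE // f0 crossE.
  rewrite !fE // => eqa; apply/eqP/idPn => nejk.
  by have := xorE j k S'j S'k nejk; rewrite eqa eqxx (constE j k) ?eqxx.
move=> j S'j; rewrite fE // f0 expr0 scale1r.
by have [_ ->] := abP j S'j; rewrite -/(b j) (constE j j1).
Qed.

(* The integer [d - e * 'chi_j x] is the value on H^# of the exceptional
   character matched with 'chi_j; only its consequences are recorded. *)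
Theorem exceptional_characters :
    (1 < #|S|)%N ->
  exists E : {set Iirr G},
    [/\ #|E| = #|S|, 0 \notin E,
        {in E &, forall i k, {in ~: class_support H^# G, 'chi_i =1 'chi_k}},
        {in ~: E, forall i, exists2 c, c \in Num.int & {in H^#, forall x, 'chi_i x = c}}
      & {in H^#, forall x, u%:R - q%:R <= \sum_(i in E) `|'chi_i x| ^+ 2} /\
        {in E, forall i, (u * q)%:R - q%:R ^+ 2 <= \sum_(x in H^#) `|'chi_i x| ^+ 2}].
Proof.
move=> S_gt1; have [e [f injf IndE]] := exceptional_map S_gt1.
have [j0 [j1 [Sj0 Sj1 ne01]]] := card_gt1P S_gt1.
pose s : algC := (-1) ^+ e.
have s2 : s * s = 1 by rewrite -expr2 sqrr_sign.
have diffE j k : j \in S -> k \in S ->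
    'chi_(f j) - 'chi_(f k) = s *: 'Ind[G] ('chi_j - 'chi_k).
  by move=> Sj Sk; rewrite IndE // scalerA s2 scale1r.
pose a i j := '['Res[L] 'chi[G]_i, 'chi_j].
have Za i j : a i j \in Num.int.
  by apply: Cint_cfdot_vchar_irr; rewrite cfRes_vchar ?irr_vchar.
(* By reciprocity the multiplicities of members of [S] in the restriction of ['chi_i] are equal,
   except for a correction when [i] is a matched character. *)
have aE i j : j \in S -> a i j = a i j0 - s * (i == f j0)%:R + s * (i == f j)%:R.
  move=> Sj; have: '['chi_i, 'Ind[G] ('chi_j - 'chi_j0)] = s * ((i == f j)%:R - (i == f j0)%:R).
    by rewrite IndE // cfdotZr rmorph_sign cfdotBr !cfdot_irr.
  by rewrite -cfdot_Res_l cfdotBr -/(a i j) -/(a i j0) => /(canRL (subrK _))->; ring.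
(* The characters outside [S] are constant on [H], and the common multiplicity on [S] contributes
   its negative because the members of [S] sum to -1 on H^#. *)
pose D i := \sum_(j | j \notin S) a i j * 'chi_j 1%g - (a i j0 - s * (i == f j0)%:R).
have ZD i : D i \in Num.int.
  apply: rpredB; first by apply: rpred_sum => j _; rewrite rpredM ?Za // intr_nat // Cnat_irr1.
  by apply: rpredB; rewrite ?Za // rpredM ?rpred_sign ?rpred_nat.
have valE i x : x \in H^# -> 'chi_i x = D i + s * \sum_(j in S) (i == f j)%:R * 'chi_j x.
  move=> H1x; have [ntx Hx] := setD1P H1x; have Lx := subsetP sHL x Hx.
  have := congr1 (fun phi : 'CF(L) => phi x) (cfun_sum_cfdot ('Res[L] 'chi_i)).
  rewrite cfResE // sum_cfunE (bigID (mem S)) /= => ->.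
  rewrite (eq_bigr (fun j => (a i j0 - s * (i == f j0)%:R) * 'chi_j x +
      s * ((i == f j)%:R * 'chi_j x))); last first.
    by move=> j Sj; rewrite cfunE -/(a i j) aE //; ring.
  rewrite big_split /= -!mulr_sumr sum_Frobenius_irr // mulrN1.
  rewrite [X in _ + X](eq_bigr (fun j => a i j * 'chi_j 1%g)); last first.
    by move=> j nSj; rewrite cfunE (irr_ker_val nSj Hx).
  by rewrite /D; ring.
have valf j x : j \in S -> x \in H^# -> 'chi_(f j) x = D (f j) + s * 'chi_j x.
  move=> Sj H1x; rewrite valE // (bigD1 j) //= eqxx mul1r big1 ?addr0 // => k /andP[Sk nekj].
  by rewrite (inj_in_eq injf) // eq_sym (negPf nekj) mul0r.
have [h H1h] : exists h, h \in H^#.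
  by apply/set0Pn; case/normedTI_P: tiH.
have DE j : j \in S -> D (f j) = D (f j0).
  move=> Sj; have := congr1 (fun phi : 'CF(G) => phi h) (diffE j j0 Sj Sj0).
  have [eqI _] := cfInd_TI (Frobenius_irr_diff_on Sj Sj0).
  rewrite !cfunE eqI // !valf // !cfunE => E.
  apply: (addIr (s * 'chi_j h - D (f j0) - s * 'chi_j0 h)).
  by rewrite -[RHS]addr0 -[0](subrr (s * ('chi_j h - 'chi_j0 h))) -{1}E; ring.
pose d := D (f j0).
have Zd : d \in Num.int by apply: ZD.
have w_ge2 : 2%:R <= #|S|%:R :> algC by rewrite ler_nat.
have s_real : s \is Num.real by rewrite rpredX ?rpredN ?rpred1.
(* Both norm bounds reduce to this: an integer d satisfies |d| <= d^2, and [S] has at least two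
   members. *)
have pos : 0 <= #|S|%:R * d ^+ 2 - 2%:R * s * d.
  have [->|d_neq0] := eqVneq d 0; first by rewrite expr0n !mulr0 subr0.
  have d_real : d \is Num.real by rewrite Rreal_int.
  have n_sd : `|s * d| <= d ^+ 2.
    rewrite normrM normr_sign mul1r -real_normK //; apply: ler_eXnr => //.
    by rewrite norm_intr_ge1.
  rewrite subr_ge0 -mulrA; apply: le_trans (_ : 2%:R * d ^+ 2 <= _).
    rewrite ler_pM2l ?ltr0n //; apply: le_trans n_sd.
    by rewrite real_ler_norm ?rpredM.
  by rewrite ler_wpM2r ?real_exprn_even_ge0.
have conj_s : s^* = s by rewrite rmorph_sign.
have conj_d : d^* = d by rewrite conj_intr.
have normE j x : j \in S -> x \in H^# -> `|'chi_(f j) x| ^+ 2 =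
    `|'chi_j x| ^+ 2 + (s * d) * ('chi_j x + ('chi_j x)^*) + d ^+ 2.
  move=> Sj H1x; rewrite valf // DE // -/d normCK rmorphD rmorphM /= conj_s conj_d normCK.
  by rewrite -[X in X + _ + _]mul1r -s2; ring.
exists (f @: S); split.
- exact: card_in_imset.
- apply/imsetP=> -[j Sj j0E].
  have [k Sk nekj] : exists2 k, k \in S & k != j.
    by have [->|nej] := eqVneq j j0; [exists j1; rewrite // eq_sym | exists j0; rewrite // eq_sym].
  have nS0 l : l \in S -> (l == 0) = false.
    by move=> Sl; apply: contraTF Sl => /eqP->; rewrite inE negbK irr0 cfker_cfun1.
  have: '['chi_(f j) - 'chi_(f k), 'chi_(f j)] = 0.
    rewrite diffE // cfdotZl -j0E irr0 -cfdot_Res_r cfRes_cfun1 // -irr0.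
    by rewrite cfdotBl !cfdot_irr !nS0 // subrr mulr0.
  rewrite cfdotBl !cfdot_irr eqxx (inj_in_eq injf) // (negPf nekj) subr0 => /eqP.
  by rewrite oner_eq0.
- move=> _ _ /imsetP[j Sj ->] /imsetP[k Sk ->] x; rewrite inE => notSx.
  apply/eqP; rewrite -subr_eq0; have := congr1 (fun phi : 'CF(G) => phi x) (diffE j k Sj Sk).
  have [_ suppI] := cfInd_TI (Frobenius_irr_diff_on Sj Sk).
  by rewrite !cfunE (cfun_onP suppI) // mulr0 => ->.
- move=> i; rewrite inE => notEi; exists (D i) => // x H1x.
  rewrite valE // big1 ?mulr0 ?addr0 // => j Sj.
  by rewrite (negPf (contraNneq _ notEi)) ?mul0r // => ->; rewrite imset_f.
split=> [x H1x | _ /imsetP[j Sj ->]].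
  rewrite big_imset //= (eq_bigr _ (fun j Sj => normE j x Sj H1x)) !big_split /=.
  rewrite sum_Frobenius_irr_norm // -mulr_sumr big_split /= -rmorph_sum.
  rewrite sum_Frobenius_irr // sumr_const -mulr_natl -addrA lerDl.
  by apply: le_trans pos _; rewrite rmorphN1; rewrite le_eqVlt; apply/orP; left; apply/eqP; ring.
rewrite (eq_bigr _ (fun x H1x => normE j x Sj H1x)) !big_split /=.
rewrite Frobenius_irr_sum_norm // -mulr_sumr big_split /= -rmorph_sum.
rewrite Frobenius_irr_sum // sumr_const -mulr_natl -addrA lerDl.
have -> : #|H^#| = (q * #|S|)%N by rewrite card_Frobenius_irr /u (cardsD1 1%g H) group1.
have q_ge0 : 0 <= q%:R :> algC by rewrite ler0n.
apply: le_trans (mulr_ge0 q_ge0 pos) _.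
by rewrite rmorphN /= conjC_nat -[_ *+ (q * _)]mulr_natr natrM le_eqVlt; apply/orP; left;
  apply/eqP; ring.
Qed.

End ExceptionalCharacters.

Section OddTIData.

Local Open Scope nat_scope.

(* With x_r = m r * (u r).-1 / n the hypotheses say that the x_r sum to almost 1,
   that the out-neighbours of r have total weight w below q r, and that the
   in-neighbours of p have total x below q p / u p. At r of minimal q these
   bounds leave no room for the total. *)
Lemma odd_TI_data_false (I : finType) (u q w m : I -> nat) (n : nat) (out : rel I) :
    (forall r, m r * (u r * q r) = n) -> (forall r, u r = w r * q r + 1) ->
    (forall r, 1 < w r) -> (forall r, ~~ odd (w r)) -> (forall r, 2 < q r) ->
    injective u -> n = 1 + \sum_r m r * (u r).-1 -> 1 < n ->
    (forall r, \sum_(t | out r t) w t < q r) ->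
    (forall p, \sum_(r | out r p) m r * (u r).-1 <= m p * q p ^ 2) ->
    (forall r t, r != t -> out r t || out t r) -> (forall r, ~~ out r r) ->
  False.
Proof.
move=> muq uE w_gt1 w_even q_gt2 inj_u nE n_gt1 outW inM tourn irr.
have [r0 _ | noI] := pickP I; last by move: nE n_gt1; rewrite big_pred0 // => ->.
have [r _ minr] : {r : I | true & forall t, q r <= q t}.
  by case: (arg_minnP q (erefl (I r0))) => r _ minr; exists r => // t; apply: minr.
set l := q r in minr; set W := w r.
have l_gt2 : 2 < l by apply: q_gt2.
have W_gt1 : 1 < W by apply: w_gt1.
pose g t := m t * (u t).-1.
(* That is, x_t = w t / u t, so a lower bound on [u] over the out-neighbours bounds their total. *)
have ug t : u t * g t = w t * n.
  by rewrite /g -(muq t) {2}uE addn1 /=; ring.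
have split_sum : n <= 1 + g r + \sum_(t | out r t) g t + \sum_(t | out t r) g t.
  rewrite [X in X <= _]nE (bigD1 r) //= -!addnA !leq_add2l.
  rewrite big_mkcond [X in _ <= X + _]big_mkcond [X in _ <= _ + X]big_mkcond -big_split /=.
  apply: leq_sum => t _; case: eqP => [//|/eqP netr] /=.
  by case/orP: (tourn t r netr) => ->; rewrite ?leq_addr ?leq_addl.
have out_bound U : (forall t, out r t -> U <= u t) -> U * \sum_(t | out r t) g t <= (l - 1) * n.
  move=> leU; rewrite big_distrr /=; apply: leq_trans (_ : \sum_(t | out r t) w t * n <= _).
    by apply: leq_sum => t /leU le; rewrite -ug leq_mul2r le orbT.
  rewrite -big_distrl /= leq_mul2r; apply/orP; right.
  by rewrite -ltnS subn1 prednK ?outW // (ltn_trans _ l_gt2).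
have in_bound : u r * \sum_(t | out t r) g t <= l * n.
  apply: leq_trans (_ : u r * (m r * q r ^ 2) <= _); first by rewrite leq_mul2l inM orbT.
  by rewrite -(muq r) -/l; apply: eq_leq; ring.
have n_ge : u r * l <= n.
  rewrite -(muq r) leq_pmull //; case: (m r) (muq r) => // e; move: n_gt1; by rewrite -e.
have urE : u r = W * l + 1 by apply: uE.
have ugr : u r * g r = W * n by apply: ug.
have out_neq t : out r t -> t != r by apply: contraTneq => ->; apply: irr.
have u_ge t : 2 * l + 1 <= u t by rewrite uE leq_add2r leq_mul.
set X := \sum_(t | out r t) g t in split_sum out_bound.
set Y := \sum_(t | out t r) g t in split_sum in_bound.
(* With U = 2 l + 1 the case W = 2 is borderline: the three shares add up to exactly 1. There
   oddness and injectivity of [u] improve the bound to 2 l + 3; for W >= 4 the bound 2 l + 1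
   suffices. *)
have [W2 | W_neq2] := eqVneq W 2.
  have u3 t : out r t -> 2 * l + 3 <= u t.
    move=> /out_neq netr; have neu : u t != u r by rewrite (inj_eq inj_u).
    have oddu : odd (u t) by rewrite uE oddD oddM (negPf (w_even t)).
    move: (u_ge t) neu oddu; rewrite urE W2; lia.
  have := out_bound _ u3; rewrite urE W2 in ugr in_bound n_ge.
  clear -split_sum in_bound n_ge ugr l_gt2; rewrite -(subnK l_gt2) in n_ge ugr in_bound *.
  move: (l - 3) (g r) split_sum n_ge ugr in_bound => k z split_sum n_ge ugr in_bound out_bound.
  have e2 : k + 3 - 1 = k + 2 by lia.
  rewrite {}e2 in out_bound.
  have := leq_mul (leqnn ((2 * (k + 3) + 3) * (2 * (k + 3) + 1))) split_sum.
  have -> : (2 * (k + 3) + 3) * (2 * (k + 3) + 1) * (1 + z + X + Y) =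
    (2 * (k + 3) + 3) * (2 * (k + 3) + 1) + (2 * (k + 3) + 3) * ((2 * (k + 3) + 1) * z) +
    (2 * (k + 3) + 1) * ((2 * (k + 3) + 3) * X) + (2 * (k + 3) + 3) * ((2 * (k + 3) + 1) * Y) by
      ring.
  have := leq_mul (leqnn (2 * (k + 3) + 3)) in_bound.
  have := leq_mul (leqnn (2 * (k + 3) + 1)) out_bound.
  have := leq_mul (leqnn (2 * k + 4)) n_ge.
  rewrite ugr; clear.
  move: (_ * (_ * X)) (_ * (_ * Y)) => X' Y' h1 h2 h3 h4.
  have {h1} : 4 * (k * k * k) + 34 * (k * k) + 94 * k + 84 <= 2 * (k * n) + 4 * n by lia.
  have {h2 h3 h4} : 2 * (k * n) + 4 * n <= 4 * (k * k) + 32 * k + 63 by lia.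
  move: (k * n) (k * k) => ? ?; lia.
have W_ge4 : 3 < W by move: (w_even r); rewrite -/W; move: W_gt1 W_neq2; case: (W) => [|[|[|[]]]].
have := out_bound _ (fun t _ => u_ge t).
rewrite urE in ugr in_bound n_ge; clear -split_sum in_bound n_ge ugr l_gt2 W_ge4.
rewrite -(subnK l_gt2) -(subnK W_ge4) in n_ge ugr in_bound *.
move: (l - 3) (W - 4) (g r) split_sum n_ge ugr in_bound => j k z split_sum n_ge ugr in_bound
  out_bound.
have e2 : j + 3 - 1 = j + 2 by lia.
rewrite {}e2 in out_bound.
set V := (k + 4) * (j + 3) + 1 in n_ge ugr in_bound.
have V_gt0 : 0 < V by rewrite /V addn1.
have := leq_mul (leqnn ((2 * (j + 3) + 1) * V)) split_sum.
have -> : (2 * (j + 3) + 1) * V * (1 + z + X + Y) =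
  (2 * (j + 3) + 1) * V + (2 * (j + 3) + 1) * (V * z) +
  V * ((2 * (j + 3) + 1) * X) + (2 * (j + 3) + 1) * (V * Y) by ring.
have := leq_mul (leqnn (2 * (j + 3) + 1)) in_bound.
have := leq_mul (leqnn V) out_bound.
have n_ge' : V * ((j + 3) * ((k + 2) * (j * j + 6 * j + 8))) <= n * ((k + 2) * (j * j + 6 * j + 8)).
  by rewrite mulnA leq_mul2r n_ge orbT.
rewrite ugr; move: (_ * (_ * X)) (_ * (_ * Y)) => X' Y' h1 h2 h3.
have h4 : n * ((k + 2) * (j * j + 6 * j + 8)) <= V * (2 * j + 7).
  by move: h1 h2 h3; rewrite /V; clear; lia.
have := leq_trans n_ge' h4; rewrite leq_pmul2l //.
have : (j + 3) * (2 * 8) <= (j + 3) * ((k + 2) * (j * j + 6 * j + 8)).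
  by rewrite leq_mul2l leq_mul ?orbT //; lia.
lia.
Qed.

End OddTIData.

Lemma sum_class_support (R : nmodType) (gT : finGroupType) (A : {set gT})
    (G L : {group gT}) (F : gT -> R) :
    normedTI A G L -> (forall x y, y \in G -> F (x ^ y) = F x) ->
  (\sum_(x in class_support A G) F x = (\sum_(x in A) F x) *+ #|G : L|)%R.
Proof.
move=> tiA FJ; rewrite (set_partition_big _ (partition_normedTI tiA)) /=.
case/and3P: tiA => _ _ /eqP <-; rewrite -card_conjugates -GRing.sumr_const.
apply: eq_bigr => _ /imsetP[y Gy ->]; rewrite big_imset /=; last by move=> ? ? _ _;
  apply: conjg_inj.
by apply: eq_bigr => x _; apply: FJ.
Qed.

Lemma sum_TI_cover (R : nmodType) (gT : finGroupType) (G : {group gT}) (I : finType)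
    (H L : I -> {group gT}) (F : gT -> R) :
    (forall i, H i \subset G) -> (forall i, normedTI (H i)^# G (L i)) ->
    (forall i j, i != j ->
      [disjoint class_support (H i)^# G & class_support (H j)^# G]) ->
    G^# \subset \bigcup_i class_support (H i)^# G ->
    (forall x y, y \in G -> F (x ^ y) = F x) ->
  (\sum_(x in G) F x = F 1%g + \sum_i (\sum_(x in (H i)^#) F x) *+ #|G : L i|)%R.
Proof.
move=> sHG tiH disjH coverH FJ; rewrite (big_setD1 1) //=; congr (_ + _)%R.
have -> : G^# = \bigcup_i class_support (H i)^# G.
  apply/eqP; rewrite eqEsubset coverH; apply/bigcupsP=> i _.
  apply/subsetP=> _ /imset2P[a y /setD1P[nta Ha] Gy ->].
  by rewrite !inE conjg_eq1 nta groupJ // (subsetP (sHG i)).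
rewrite partition_disjoint_bigcup //=; apply: eq_bigr => i _.
exact: sum_class_support.
Qed.

(* Suzuki's argument: the exceptional characters attached to the H i exhaust the
   nontrivial irreducible characters; each is an integer constant on the classes
   of the other H j, and parity makes too many of these constants nonzero for the
   orthogonality relations. *)
Section OddTIPartition.

Import Order.TTheory GRing.Theory Num.Theory.
Local Open Scope ring_scope.

Variables (gT : finGroupType) (G : {group gT}) (I : finType) (H : I -> {group gT}).
Hypotheses (oddG : odd #|G|) (ntG : G :!=: 1%g).
Hypothesis abH : forall i, abelian (H i).
Hypothesis tiH : forall i, normedTI (H i)^# G 'N_G(H i).
Hypothesis frobH : forall i, [Frobenius 'N_G(H i) with kernel H i].
Hypothesis centH : forall i, {in (H i)^#, forall x, 'C_G[x] = H i}.
Hypothesis disjH :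
  forall i j, i != j -> [disjoint class_support (H i)^# G & class_support (H j)^# G].
Hypothesis coverH : G^# \subset \bigcup_i class_support (H i)^# G.
Hypothesis inj_oH : injective (fun i => #|H i|).

Let L i := 'N_G(H i)%G.
Let u i := #|H i|.
Let q i := #|L i : H i|.
Let m i := #|G : L i|.
Let S i := [set j : Iirr (L i) | ~~ (H i \subset cfker 'chi_j)].
Let w i := #|S i|.

Let nsHL i : H i <| L i. Proof. by case/Frobenius_kerP: (frobH i). Qed.
Let sLG i : L i \subset G. Proof. exact: subsetIl. Qed.
Let sHG i : H i \subset G. Proof. exact: subset_trans (normal_sub (nsHL i)) (sLG i). Qed.

Let qw i : (q i * w i)%N = (u i).-1.
Proof. exact: (card_Frobenius_irr (abH i) (frobH i)). Qed.

Let muq i : (m i * (u i * q i))%N = #|G|.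
Proof. by rewrite Lagrange ?normal_sub // mulnC Lagrange. Qed.

Let u_gt1 i : (1 < u i)%N.
Proof. by rewrite cardG_gt1; case/Frobenius_kerP: (frobH i). Qed.

Let u_odd i : odd (u i). Proof. exact: oddSg (sHG i) oddG. Qed.

Let q_odd i : odd (q i).
Proof. by move: oddG; rewrite -(muq i) !oddM => /and3P[]. Qed.

Let q_gt2 i : (2 < q i)%N.
Proof.
have: (1 < q i)%N.
  rewrite indexg_gt1; have [_ + _ _] := Frobenius_kerP (frobH i).
  by rewrite properE => /andP[].
by move: (q_odd i); case: (q i) => [|[|[]]].
Qed.

Let w_even i : ~~ odd (w i).
Proof.
have := u_odd i; rewrite -(prednK (ltnW (u_gt1 i))) -qw /= oddM q_odd.
by case: (odd _).
Qed.

Let w_gt1 i : (1 < w i)%N.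
Proof.
have: (0 < q i * w i)%N by rewrite qw -subn1 subn_gt0.
by rewrite muln_gt0 => /andP[_]; move: (w_even i); case: (w i) => [|[]].
Qed.

Let sum_G (F : gT -> algC) : (forall x y, y \in G -> F (x ^ y)%g = F x) ->
  \sum_(x in G) F x = F 1%g + \sum_i (\sum_(x in (H i)^#) F x) *+ m i.
Proof. exact: sum_TI_cover. Qed.

Lemma odd_TI_partition_false : False.
Proof.
have [E Eprop] := fin_all_exists (fun i =>
  exceptional_characters (abH i) (tiH i) (frobH i) (w_gt1 i)).
rewrite -/u -/q in Eprop.
have csH i x : x \in (H i)^# -> x \in class_support (H i)^# G.
  exact: subsetP (sub_class_support _ _) x.
have notcs i j x : i != j -> x \in (H j)^# -> x \notin class_support (H i)^# G.
  by move=> ij /csH csx; rewrite (disjointFl (disjH ij) csx).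
(* Differences within [E i] and within [E j] vanish off disjoint sets, so they are orthogonal; a
   common member would give inner product 1, or make one difference zero. *)
have Edisj i j : i != j -> [disjoint E i & E j].
  move=> neij; apply/pred0P=> k /=; apply/andP=> -[Eik Ejk].
  have [Ei1 _ Ei_off _ _] := Eprop i; have [Ej1 _ Ej_off _ _] := Eprop j.
  have [k1 Eik1 nek1] : exists2 k1, k1 \in E i & k1 != k.
    have /card_gt1P[a [b [Ea Eb neab]]] : (1 < #|E i|)%N by rewrite Ei1 w_gt1.
    by have [ak|] := eqVneq a k; [exists b; rewrite // -ak eq_sym | exists a].
  have [k2 Ejk2 nek2] : exists2 k2, k2 \in E j & k2 != k.
    have /card_gt1P[a [b [Ea Eb neab]]] : (1 < #|E j|)%N by rewrite Ej1 w_gt1.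
    by have [ak|] := eqVneq a k; [exists b; rewrite // -ak eq_sym | exists a].
  have off x : ('chi_k x - 'chi_k1 x) * ('chi_k x - 'chi_k2 x)^* = 0.
    have [csx|ncsx] := boolP (x \in class_support (H i)^# G).
      rewrite (Ej_off k k2) ?subrr ?conjC0 ?mulr0 // inE.
      by rewrite (disjointFr (disjH neij) csx).
    by rewrite (Ei_off k k1) ?subrr ?mul0r // inE.
  have dot0 : '['chi_k - 'chi_k1, 'chi_k - 'chi_k2] = 0.
    by rewrite cfdotE big1 ?mulr0 // => x _; rewrite !cfunE off.
  have [eq12|ne12] := eqVneq k1 k2.
    have /eqP : 'chi_k1 = 'chi_k.
      apply/cfunP=> x; have := off x; rewrite -eq12 => /eqP.
      by rewrite mul_conjC_eq0 subr_eq0 => /eqP.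
    by rewrite (inj_eq irr_inj) (negPf nek1).
  move/eqP: dot0; rewrite cfdotBl !cfdotBr !cfdot_irr eqxx (negPf nek1) (negPf ne12) (eq_sym k
    k2) (negPf nek2).
  by rewrite !subr0 oner_eq0.
have FJ k : forall x y, y \in G -> `|'chi[G]_k (x ^ y)%g| ^+ 2 = `|'chi_k x| ^+ 2.
  by move=> x y Gy; rewrite cfunJ.
have rowsum k : #|G|%:R = `|'chi[G]_k 1%g| ^+ 2 + \sum_i (\sum_(x in (H i)^#) `|'chi_k x| ^+ 2)
  *+ m i.
  rewrite -(sum_G (FJ k)); have := cfdot_irr k k;
    rewrite eqxx cfdotE => /(canRL (mulVKf (neq0CG G))).
  by rewrite mulr1 => <-; apply: eq_bigr => x _; rewrite normCK.
have colsum x : x \in G -> \sum_k `|'chi[G]_k x| ^+ 2 = #|'C_G[x]|%:R.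
  move=> Gx; have := second_orthogonality_relation x Gx; rewrite class_refl mulr1n => <-.
  by apply: eq_bigr => k _; rewrite normCK.
have H1G i x : x \in (H i)^# -> x \in G by case/setD1P=> _; apply: (subsetP (sHG i)).
have card1 i : #|(H i)^#| = (q i * w i)%N by rewrite qw /u (cardsD1 1%g (H i)) group1.
(* Counting classes: the row norms summed over all irreducibles equal the sum of the centralizer
   orders, which are u i on (H i)^#. *)
have oIrr : Nirr G = (1 + \sum_i w i)%N.
  have n_gt0 := cardG_gt0 G; apply/eqP; rewrite -(eqn_pmul2l n_gt0) -(eqr_nat algC).
  have -> : (#|G| * Nirr G)%:R = \sum_(k : Iirr G) #|G|%:R :> algC.
    by rewrite sumr_const card_ord natrM mulr_natr.
  rewrite (eq_bigr _ (fun k _ => rowsum k)) big_split /= colsum //.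
  rewrite cent11T setIT exchange_big /= mulnDr muln1 natrD.
  apply/eqP; congr (_ + _); rewrite big_distrr /= natr_sum; apply: eq_bigr => i _.
  rewrite sumrMnl exchange_big /= (eq_bigr (fun _ => (u i)%:R)) => [|x H1x]; last first.
    by rewrite colsum ?(H1G i) // (centH H1x).
  by rewrite sumr_const card1 -!mulrnA -(muq i); congr (_ *+ _); ring.
(* By cardinality the disjoint families [E i] and the trivial character exhaust the irreducible
   characters. *)
have Iall (F : Iirr G -> algC) : \sum_k F k = F 0 + \sum_i \sum_(k in E i) F k.
  have <- : \sum_(k in \bigcup_i E i) F k = \sum_i \sum_(k in E i) F k.
    by rewrite partition_disjoint_bigcup.
  have n0E : 0 \notin \bigcup_i E i by apply/bigcupP=> -[i _]; case: (Eprop i) => _ /negPf->.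
  rewrite -(big_setU1 0) //=.
  have -> : 0 |: \bigcup_i E i = [set: Iirr G].
    apply/eqP; rewrite eqEcard subsetT cardsT card_ord /=.
    apply: leq_trans (eq_leq oIrr) _; rewrite cardsU1 n0E leq_add2l.
    rewrite -sum1_card partition_disjoint_bigcup //= leq_sum // => i _.
    by rewrite sum1_card; case: (Eprop i) => ->.
  by apply: eq_bigl => k; rewrite inE.
have ex_x i : exists x, x \in (H i)^# by apply/set0Pn; case/normedTI_P: (tiH i).
have [xr xrP] := fin_all_exists ex_x.
have ex_k i : exists k, k \in E i.
  by apply/card_gt0P; have [-> _ _ _ _] := Eprop i; apply: (ltnW (w_gt1 i)).
have [ch chP] := fin_all_exists ex_k.
(* The common integer value of all members of [E p] on (H r)^#, for p different from r; [out r p]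
   will say that it is nonzero. *)
pose c p r := 'chi_(ch p) (xr r).
have cE p r k x : p != r -> k \in E p -> x \in (H r)^# -> 'chi_k x = c p r.
  move=> nepr Epk H1x; have [_ _ Ep_off _ _] := Eprop p; have [_ _ _ Er_const _] := Eprop r.
  have [|c0 _ c0E] := Er_const k; first by rewrite inE (disjointFr (Edisj p r nepr)).
  rewrite c0E // -(c0E (xr r)) // (Ep_off k (ch p)) // inE.
  exact: notcs (xrP r).
have Zc p r : p != r -> c p r \in Num.int.
  move=> nepr; have [_ _ _ Er_const _] := Eprop r.
  have [|c0 Zc0 c0E] := Er_const (ch p); first by rewrite inE (disjointFr (Edisj p r nepr)).
  by rewrite /c c0E.
have c_ge1 p r : p != r -> c p r != 0 -> 1 <= `|c p r| ^+ 2.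
  by move=> nepr nz; rewrite exprn_ege1 // norm_intr_ge1 ?Zc.
pose out r p := (p != r) && (c p r != 0).
apply: (@odd_TI_data_false I u q w m #|G| out) => //.
- by move=> r; rewrite mulnC qw addn1 prednK // ltnW.
- apply/eqP; rewrite -(eqr_nat algC) -sumr_const.
  rewrite (@sum_G (fun=> 1) (fun _ _ _ => erefl)) natrD natr_sum; apply/eqP; congr (_ + _).
  by apply: eq_bigr => i _; rewrite sumr_const card1 qw -mulrnA mulnC.
- by rewrite cardG_gt1.
(* Column norm at [xr r]: of the total u r, the family [E r] takes at least u r - q r and the
   trivial character 1; each out-neighbour t contributes at least w t. *)
- move=> r; rewrite -(ltr_nat algC).
  have [_ _ _ _ [/(_ _ (xrP r)) col _]] := Eprop r; have := colsum (xr r) (H1G r _ (xrP r)).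
  rewrite (centH (xrP r)) Iall irr0 cfun1E (H1G r _ (xrP r)) normr1 expr1n (bigD1 r) //=.
  move: col; set A := \sum_(j in E r) _; set B := \sum_(i | _) _ => col def.
  have leB : (\sum_(t | out r t) w t)%:R <= B.
    rewrite natr_sum (eq_bigl (fun t => (t != r) && (c t r != 0))) // big_mkcondr.
    apply: ler_sum => t netr; case: ifP => [nz | _]; last first.
      by apply: sumr_ge0 => k _; rewrite exprn_ge0.
    rewrite (eq_bigr (fun=> `|c t r| ^+ 2)) => [|k Etk]; last by rewrite (cE t r) ?xrP.
    by rewrite sumr_const; have [-> _ _ _ _] := Eprop t; rewrite lerMn2r c_ge1 ?orbT.
  apply: le_lt_trans leB _; have -> : B = (u r)%:R - A - 1 by rewrite -/(u r) in def;
    rewrite -def; ring.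
  rewrite ltrBlDr; apply: le_lt_trans (_ : (q r)%:R < _); last by rewrite ltrDl ltr01.
  by rewrite lerBlDr -lerBlDl.
(* Row norm of a member of [E p]: its part on the conjugates of [H p] leaves at most m p * q p ^ 2
   for the others. *)
- move=> p; rewrite -(ler_nat algC).
  have [_ _ _ _ [_ /(_ _ (chP p)) row]] := Eprop p; have := rowsum (ch p).
  rewrite (bigD1 p) //=; move: row; set A := \sum_(x in (H p)^#) _;
    set B := \sum_(i | _) _ => row def.
  have leB : (\sum_(r | out r p) m r * (u r).-1)%:R <= B.
    rewrite natr_sum (eq_bigl (fun r => (r != p) && (c p r != 0))); last first.
      by move=> r; rewrite /out eq_sym.
    rewrite big_mkcondr; apply: ler_sum => r nerp; case: ifP => [nz | _]; last first.
      by rewrite mulrn_wge0 // sumr_ge0 // => x _; rewrite exprn_ge0.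
    have nepr : p != r by rewrite eq_sym.
    rewrite (eq_bigr (fun=> `|c p r| ^+ 2)) => [|x H1x]; last by rewrite (cE p r) ?chP.
    by rewrite sumr_const card1 qw -mulrnA (mulnC (m r)) lerMn2r c_ge1 ?orbT.
  apply: le_trans leB _.
  have -> : B = #|G|%:R - `|'chi_(ch p) 1%g| ^+ 2 - A *+ m p by rewrite def; ring.
  apply: le_trans (_ : #|G|%:R - ((u p * q p)%:R - (q p)%:R ^+ 2) *+ m p <= _).
    by rewrite lerB ?lerMn2r ?row ?orbT // lerBlDr lerDl exprn_ge0.
  by rewrite -(muq p) -[_ *+ m p]mulr_natr !natrM le_eqVlt; apply/orP; left; apply/eqP; ring.
(* If both values vanish, orthogonality of the columns of [xr r] and [xr t] reads 1 + 2 Z = 0 with Z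
   an integer, all family sizes being even. *)
- move=> r t nert; rewrite /out (eq_sym t) nert /=; apply/norP=> -[];
  rewrite !negbK => /eqP c_tr /eqP c_rt.
  have Gt := H1G t _ (xrP t); have Gr := H1G r _ (xrP r).
  have := second_orthogonality_relation (xr r) Gt.
  have -> : (xr r \in xr t ^: G) = false.
    apply: contraNF (notcs t r (xr r) _ (xrP r)) => [/imsetP[y Gy ->]|]; last by rewrite eq_sym.
    by apply/imset2P; exists (xr t) y.
  rewrite mulr0n Iall irr0 !cfun1E Gt Gr conjC1 mulr1.
  pose z i : algC := if (i == r) || (i == t) then 0 else ((w i)./2)%:R * (c i r * c i t).
  have Zz : \sum_i z i \in Num.int.
    apply: rpred_sum => i _; rewrite /z; case: ifP => [_|/norP[nir nit]]; first exact: rpred0.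
    by rewrite !rpredM ?rpred_nat // Zc.
  have -> : \sum_i \sum_(k in E i) 'chi_k (xr r) * ('chi_k (xr t))^* = 2%:R * \sum_i z i.
    rewrite mulr_sumr; apply: eq_bigr => i _; rewrite /z.
    have [->|nir] := eqVneq i r.
      by rewrite /= mulr0 big1 // => k Ek; rewrite (cE r t k _ nert Ek (xrP t)) c_rt conjC0 mulr0.
    have [->|nit] /= := eqVneq i t.
      have netr : t != r by rewrite eq_sym.
      by rewrite mulr0 big1 // => k Ek; rewrite (cE t r k _ netr Ek (xrP r)) c_tr mul0r.
    rewrite (eq_bigr (fun=> c i r * c i t)) => [|k Ek]; last first.
      by rewrite (cE i r k _ nir Ek (xrP r)) (cE i t k _ nit Ek (xrP t)) conj_intr ?Zc.
    rewrite sumr_const; have [-> _ _ _ _] := Eprop i.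
    have w2 : w i = (2 * (w i)./2)%N.
      by rewrite -[LHS]odd_double_half (negPf (w_even i)) add0n mul2n.
    by rewrite -[#|_|]/(w i) [in LHS]w2 -[LHS]mulr_natl natrM; ring.
  move: (\sum_i z i) Zz => Z ZZ /eqP; rewrite addr_eq0 => /eqP def.
  have nzZ : Z != 0.
    by apply: contra_eq_neq def => ->; rewrite mulr0 oppr0 oner_eq0.
  have := norm_intr_ge1 ZZ nzZ; have := congr1 Num.norm def.
  rewrite normr1 normrN normrM normr_nat => def1; rewrite -(ler_pM2l (ltr0Sn _ 1)) -def1 mulr1.
  by rewrite (ler_nat _ 2 1).
by move=> r; rewrite /out eqxx.
Qed.

End OddTIPartition.

(** * Involutions and even order *)

(** By induction from (a - 1) + (b - 1) <= a b - 1, splitting off one primary part at a time. *)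
Lemma sum_part_pred (s : seq nat) (m : nat) :
  (uniq s -> 0 < m -> \sum_(p <- s) (m`_p).-1 <= m.-1)%N.
Proof.
elim: s m => [|p s IHs] m /=; first by rewrite big_nil.
case/andP=> notsp uniq_s m_gt0; rewrite big_cons.
have := IHs (m`_(p^'))%N uniq_s (part_gt0 _ _).
rewrite (eq_big_seq (fun r : nat => (m`_r).-1)%N) => [leS | r sr]; last first.
  rewrite -partnI (@eq_partn _ r) // => t; rewrite !inE andbC.
  by case: eqP => //= ->; apply: contraNneq notsp => <-.
apply: leq_trans (_ : ((m`_p).-1 + (m`_(p^')).-1 <= _)%N); first by rewrite leq_add2l.
rewrite -{3}(partnC p m_gt0); case: (m`_p)%N (part_gt0 p m) => // a _.
by case: (m`_(p^'))%N (part_gt0 p^' m) => // b _ /=; lia.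
Qed.

Lemma mulrn_nat (a b : nat) : (a *+ b)%R = (a * b)%N.
Proof. by elim: b => [|b IHb]; rewrite ?muln0 // GRing.mulrS IHb mulnS. Qed.

(** Here y = |T|, h = |G| / 2, and [S] is the sum of |P| - 1 over the odd Sylow subgroups with
    normalizer of order 2 |P|, one for each prime. The first equation counts pairs of involutions by
    their product. *)
Lemma involution_pairs_arith (y S h : nat) : (1 < y ->
  (y.-1 * y.+1) * (y.-1 * y.+1) = y.-1 * y.+1 + (y.-1 * y.-2 * y.+1 + S * h) ->
  2 * h = y.-1 * y * y.+1 -> S = 2 * y.-1)%N.
Proof.
case: y => [|[|z]] //= _ e1 e2.
have /eqP : ((z.+1 * z.+3 * z.+2) * S = (z.+1 * z.+3 * z.+2) * (2 * z.+1))%N.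
  have : (2 * (z.+1 * z.+3 * (z.+1 * z.+3)) = 2 * (z.+1 * z.+3) + (2 * (z.+1 * z * z.+3) + S * (2
    * h)))%N.
    by rewrite e1; ring.
  by rewrite e2; lia.
by rewrite eqn_pmul2l ?muln_gt0 // => /eqP.
Qed.

(** The hypotheses give p m <= p + m - 1, that is (p - 1)(m - 1) <= 0, so m = 1. *)
Lemma part_sum_arith (p m y S : nat) :
  (1 < p -> 0 < m -> p * m = y.+1 -> p.-1 + S = y -> S <= m.-1 -> y.+1 = p)%N.
Proof.
case: p => [|[|a]] // _; case: m => // b _; rewrite mulSn mulSn mulnS => e1 e2 le.
have ab0 : (a * b = 0)%N by move: le e1 e2; move: (a * b)%N => c /=; lia.
by move: le e1 e2; rewrite ab0 /=; lia.
Qed.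

Lemma dvdn3_mul3 n : 3 %| (n.-1 * n * n.+1)%N.
Proof.
case: n => // n; elim: n => // n IHn.
have -> : (n.+1 * n.+2 * n.+3 = n * n.+1 * n.+2 + 3 * (n.+1 * n.+2))%N by lia.
by rewrite dvdn_add // dvdn_mulr.
Qed.

Section SimpleOrder.

Variables (gT : finGroupType) (G : {group gT}).
Hypotheses (simG : simple G) (insolG : ~~ solvable G).
Hypothesis nilG : forall H : {group gT},
  H \proper G -> nilpotent H || minimal_nonnilpotent H.

Let TI_Sylow := simple_Sylow_TI simG insolG nilG.
Let Sylow_str := simple_Sylow_structure simG insolG nilG.

Let norm_index (p : nat) (P : {group gT}) :
    prime p -> p.-Sylow(G) P -> P :!=: 1 ->
  exists q, [/\ prime q, q != p, #|'N_G(P)| = (#|P| * q)%N, q %| #|P|.-1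
    & [Frobenius 'N_G(P) with kernel P]].
Proof.
move=> p_pr sylP ntP; have [_ _ [q [Q [q_pr neq oQ frobN _]]]] := Sylow_str p_pr sylP ntP.
exists q; have [defN _ _ _ _] := Frobenius_context frobN.
split=> //; first by rewrite -oQ (sdprod_card defN).
  by rewrite -oQ (Frobenius_dvd_ker1 frobN).
exact: FrobeniusWker frobN.
Qed.

(** For t outside [P], a nontrivial square of t would lie in [P] and have centralizer [P], which
    contains t. So t and t z are involutions and t inverts z; then every cyclic subgroup of [P] is
    invariant, and irreducibility makes [P] cyclic. *)
Lemma Sylow_dihedral_norm (p : nat) (P : {group gT}) :
    prime p -> p.-Sylow(G) P -> P :!=: 1 -> #|'N_G(P)| = (#|P| * 2)%N ->
  [/\ {in 'N_G(P) :\: P, forall t, #[t] = 2},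
      {in 'N_G(P) :\: P & P, forall t z, z ^ t = z^-1}
    & #|P| = p].
Proof.
move=> p_pr sylP ntP oN;
  have [abelP cP [q [Q [q_pr neq oQ frobN irrQ]]]] := Sylow_str p_pr sylP ntP.
have [defN ntQ _ _ _] := Frobenius_context frobN.
have [sPG pP _] := and3P sylP; have abP := abelem_abelian abelP.
have [_ eqPQ nPQ tiPQ] := sdprodP defN.
have sPN : P \subset 'N_G(P) by rewrite -eqPQ mulG_subl.
have nsPN : P <| 'N_G(P) by rewrite /normal sPN subsetIr.
have iN : #|'N_G(P) : P| = 2 by rewrite -divgS // oN mulKn ?cardG_gt0.
have inv t : t \in 'N_G(P) :\: P -> #[t] = 2.
  case/setDP=> Nt notPt; have Gt : t \in G by case/setIP: Nt.
  have Pt2 : t ^+ 2 \in P.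
    rewrite coset_idr ?groupX ?(subsetP (normal_norm nsPN)) //.
    rewrite morphX ?(subsetP (normal_norm nsPN)) //=.
    have Nbar : coset P t \in 'N_G(P) / P by apply: mem_quotient.
    by apply/eqP; rewrite -order_dvdn -iN -card_quotient ?normal_norm // order_dvdG.
  apply: nt_prime_order => //.
    apply/eqP; apply: contraR notPt => ntt2.
    have: t \in 'C_G[t ^+ 2] by rewrite inE Gt; apply/cent1P; rewrite /commute -expgS -expgSr.
    by rewrite cP // !inE ntt2.
  by apply: contraNneq notPt => ->; apply: group1.
have invz t z : t \in 'N_G(P) :\: P -> z \in P -> z ^ t = z^-1.
  move=> Nt Pz; have [NGt notPt] := setDP Nt.
  have Ntz : t * z \in 'N_G(P) :\: P.
    by rewrite inE groupMr // notPt groupM // (subsetP sPN).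
  have := inv _ Ntz; have := inv _ Nt => ot otz.
  have t2 : t * t = 1 by rewrite -(expgS t 1) -ot expg_order.
  have tz2 : t * z * (t * z) = 1 by rewrite -(expgS (t * z) 1) -otz expg_order.
  have tV : t^-1 = t by apply/eqP; rewrite eq_sym eq_mulgV1 invgK t2.
  apply/eqP; rewrite eq_mulgV1 invgK conjgE tV -mulgA.
  by rewrite !mulgA in tz2 *; rewrite tz2.
split=> //; have [z Pz ntz] := trivgPn _ ntP.
have nzQ : Q \subset 'N(<[z]>).
  apply/subsetP=> t Qt; have [-> |ntt] := eqVneq t 1; first exact: group1.
  rewrite inE -cycleJ cycle_subG invz ?groupV ?cycle_id // inE -eqPQ.
  rewrite (subsetP (mulG_subr _ _)) // andbT; apply: contra ntt => Pt.
  have : t \in P :&: Q by rewrite inE Pt.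
  by rewrite tiPQ => /set1P->.
case: (boolP (<[z]> \proper P)) => [/irrQ/(_ nzQ)/eqP|].
  by rewrite cycle_eq1 (negPf ntz).
rewrite properEneq cycle_subG Pz andbT negbK => /eqP <-.
by rewrite -orderE (abelem_order_p abelP).
Qed.

Let I := seq_sub (primes #|G|).
Let pr (i : I) := ssval i.
Let H i := odflt 1%G [pick P : {group gT} | (pr i).-Sylow(G) P].

Let pr_prime i : prime (pr i).
Proof. by case: i => p /=; rewrite mem_primes => /and3P[]. Qed.

Let sylH i : (pr i).-Sylow(G) (H i).
Proof.
rewrite /H; case: pickP => //= noP; have [P sylP] := Sylow_exists (pr i) G.
by rewrite noP in sylP.
Qed.

Let ntH i : H i :!=: 1.
Proof.
rewrite -cardG_gt1 (card_Hall (sylH i)) p_part_gt1.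
by case: i => p /=.
Qed.

Let sHG i : H i \subset G. Proof. exact: pHall_sub (sylH i). Qed.

Let cs_elt i x : x \in class_support (H i)^# G -> x != 1 /\ (pr i).-elt x.
Proof.
case/imset2P=> a g /setD1P[nta Ha] _ ->; rewrite conjg_eq1 p_eltJ; split=> //.
exact: mem_p_elt (pHall_pgroup (sylH i)) Ha.
Qed.

Let disjH i j : i != j ->
  [disjoint class_support (H i)^# G & class_support (H j)^# G].
Proof.
move=> neij; apply/pred0P=> x /=; apply/andP=> -[/cs_elt[ntx pix] /cs_elt[_ pjx]].
case/negP: ntx; rewrite -order_eq1; apply/eqP/(pnat_1 pix)/(pi_pnat pjx).
by rewrite !inE -(inj_eq val_inj) eq_sym in neij *.
Qed.

Let coverH : G^# \subset \bigcup_i class_support (H i)^# G.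
Proof.
apply/subsetP=> x G1x; have [p [P sylP [p_pr Px]]] := simple_element_Sylow simG insolG nilG G1x.
have [ntx Gx] := setD1P G1x.
have piGp : p \in primes #|G|.
  rewrite mem_primes p_pr cardG_gt0 (dvdn_trans _ (cardSg (pHall_sub sylP))) //.
  have ntP : P :!=: 1 by apply/trivgPn; exists x.
  by have [] := pgroup_pdiv (pHall_pgroup sylP) ntP.
apply/bigcupP; exists (SeqSub piGp) => //.
have [g Gg defP] := Sylow_trans (sylH (SeqSub piGp)) sylP.
apply/imset2P; exists (x ^ g^-1) g; rewrite ?conjgKV //.
by rewrite !inE conjg_eq1 ntx /= -mem_conjg -defP.
Qed.

Lemma simple_even : ~~ odd #|G|.
Proof.
apply/negP=> oddG; apply: (@odd_TI_partition_false gT G I H) => //.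
- by case/simpleP: simG.
- by move=> i; have [/abelem_abelian] := Sylow_str (pr_prime i) (sylH i) (ntH i).
- by move=> i; apply: TI_Sylow (sylH i) (ntH i).
- by move=> i; have [q [_ _ _ _]] := norm_index (pr_prime i) (sylH i) (ntH i).
- by move=> i; have [_ cP _] := Sylow_str (pr_prime i) (sylH i) (ntH i).
move=> i j /= eqo; apply: val_inj => /=.
have: pr i \in \pi(H j).
  rewrite /= -eqo; have [_ dvp _] := pgroup_pdiv (pHall_pgroup (sylH i)) (ntH i).
  by rewrite mem_primes pr_prime cardG_gt0.
by move/(pnatPpi (pHall_pgroup (sylH j)))/eqP.
Qed.

Let J := [set x in G | #[x] == 2].

Let JG x : x \in J -> x \in G. Proof. by rewrite inE => /andP[]. Qed.

Let Jinv x : x \in J -> x * x = 1.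
Proof. by rewrite inE => /andP[_ /eqP ox]; rewrite -(expgS x 1) -ox expg_order. Qed.

Let JV x : x \in J -> x^-1 = x.
Proof. by move=> Jx; apply/eqP; rewrite eq_sym eq_mulgV1 invgK Jinv. Qed.

Let Jnt x : x \in J -> x != 1.
Proof. by rewrite inE => /andP[_]; apply: contraTneq => ->; rewrite order1. Qed.

(* Bender's count: an average coset M x outside M contains |T| - 1 involutions, but
   at most |B x| <= q of them, so all these bounds are attained. *)
Section Involutions.

Variable T : {group gT}.
Hypotheses (sylT : 2.-Sylow(G) T) (ntT : T :!=: 1).
Let M := 'N_G(T)%G.
Let B x := (M :&: M :^ x)%G.

Let J_elt x : x \in J -> 2.-elt x.
Proof. by rewrite inE /p_elt => /andP[_ /eqP->]. Qed.

Let sMG : M \subset G. Proof. exact: subsetIl. Qed.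
Let sTG : T \subset G. Proof. exact: pHall_sub sylT. Qed.
Let tT : 2.-group T. Proof. exact: pHall_pgroup sylT. Qed.
Let nsTM : T <| M. Proof. by rewrite normalSG. Qed.
Let sTM : T \subset M. Proof. exact: normal_sub nsTM. Qed.
Let sylTM : 2.-Sylow(M) T. Proof. exact: pHall_subl sylT. Qed.
Let tiT : normedTI T^# G M. Proof. exact: TI_Sylow sylT ntT. Qed.

Let Tinv x : x \in T^# -> x \in J.
Proof.
have [abelT _ _] := Sylow_str (isT : prime 2) sylT ntT.
by case/setD1P=> ntx Tx; rewrite inE (subsetP sTG) // (abelem_order_p abelT).
Qed.

Let JT : J :&: M = T^#.
Proof.
apply/setP=> x; rewrite in_setI in_setD1; apply/andP/andP=> [[Jx Mx] | [ntx Tx]].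
  by rewrite Jnt // (mem_normal_Hall sylTM nsTM) ?J_elt.
by rewrite Tinv ?in_setD1 ?ntx // (subsetP sTM).
Qed.

Let JE : J = class_support T^# G.
Proof.
apply/setP=> x; apply/idP/idP=> [Jx | /imset2P[a g /Tinv Ja Gg ->]].
  have sxG : <[x]> \subset G by rewrite cycle_subG JG.
  have [g Gg sxTg] := Sylow_subJ sylT sxG (J_elt Jx).
  rewrite cycle_subG mem_conjg in sxTg.
  apply/imset2P; exists (x ^ g^-1) g; rewrite ?conjgKV //.
  by rewrite !inE conjg_eq1 Jnt.
by move: Ja; rewrite !inE orderJ => /andP[Ga ->]; rewrite groupJ.
Qed.

Let k_gt1 : 1 < #|G : M|.
Proof.
rewrite indexg_gt1; have : M \proper G.
  by apply: simple_norm_proper => //; apply: pgroup_sol tT.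
by rewrite properE => /andP[].
Qed.

Let cardJ : #|J| = (#|T|.-1 * #|G : M|)%N.
Proof.
by rewrite JE (card_support_normedTI tiT) (cardsD1 1 T) group1.
Qed.

Let cardJM : #|J :\: M| = (#|T|.-1 * #|G : M|.-1)%N.
Proof.
rewrite cardsD JT cardJ (cardsD1 1 T) group1 /=.
by case: #|G : M| k_gt1 => // k _; rewrite mulnS addKn.
Qed.

Let TB x : x \in G -> x \notin M -> T :&: B x = 1.
Proof.
move=> Gx notMx; have [_ _ tiTJ] := normedTI_memJ_P tiT.
apply/trivgP/subsetP=> z /setIP[Tz /setIP[_ Mxz]]; rewrite inE.
apply: contraR notMx => ntz; rewrite mem_conjg in Mxz.
have Tzx : z ^ x^-1 \in T.
  by rewrite (mem_normal_Hall sylTM nsTM) // p_eltJ (mem_p_elt tT).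
by rewrite -(tiTJ (z ^ x^-1)) ?conjgKV // !inE ?conjg_eq1 ntz.
Qed.

Let invB x h : x \in J -> h \in M -> h * x \in J -> h \in B x /\ h ^ x = h^-1.
Proof.
move=> Jx Mh Jhx; have hxV : h ^ x = h^-1.
  apply: (mulgI h); rewrite mulgV conjgE JV //.
  by rewrite -(Jinv Jhx) !mulgA.
split=> //; rewrite inE Mh mem_conjg JV //= hxV groupV //.
Qed.

Variable q : nat.
Hypotheses (q_pr : prime q) (q_neq2 : q != 2) (oM : #|M| = (#|T| * q)%N).
Hypothesis dvq : q %| #|T|.-1.

Let cardB x : x \in G -> x \notin M -> #|B x| <= q.
Proof.
move=> Gx notMx; rewrite -(leq_pmul2l (cardG_gt0 T)) -oM -TI_cardMg ?TB //.
by rewrite subset_leq_card // mul_subG ?subsetIl.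
Qed.

Let f (C : {set gT}) := [set x in J :\: M | M :* x == C].

Let fB x : x \in J :\: M -> (mulg^~ x^-1) @: f (M :* x) \subset B x.
Proof.
case/setDP=> Jx notMx; apply/subsetP=> _ /imsetP[z fz ->].
move: fz; rewrite inE => /andP[/setDP[Jz _] /eqP eqM].
have Mzx : z * x^-1 \in M by rewrite -mem_rcoset -eqM rcoset_refl.
by have [] := invB Jx Mzx; rewrite ?mulgKV.
Qed.

Let inj_fx (x : gT) : injective (mulg^~ x^-1).
Proof. exact: mulIg. Qed.

Let leqf C : #|f C| <= q.
Proof.
have [->|[x fx]] := set_0Vmem (f C); first by rewrite cards0.
move: (fx); rewrite inE => /andP[JMx /eqP <-].
rewrite -(card_imset (mem (f (M :* x))) (@inj_fx x)); apply: leq_trans (subset_leq_card (fB JMx)) _.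
by case/setDP: JMx => Jx notMx; apply: cardB; rewrite ?JG.
Qed.

(** The (|T| - 1)(|G : M| - 1) involutions outside [M] lie in |G : M| - 1 cosets with at most q <=
    |T| - 1 in each, so equality holds throughout. *)
Let count_f : q = #|T|.-1 /\ {in J :\: M, forall x, #|f (M :* x)| = q}.
Proof.
pose D := rcosets M G :\ (M : {set gT}).
have cardD : #|D| = #|G : M|.-1.
  rewrite /indexg (cardsD1 (M : {set gT}) (rcosets M G)).
  by rewrite -{1}(rcoset1 M) mem_rcosets (subsetP (mulG_subr _ _)) ?group1.
have Dx x : x \in J :\: M -> M :* x \in D.
  case/setDP=> Jx notMx; rewrite in_setD1 mem_rcosets.
  rewrite (subsetP (mulG_subr _ _)) ?JG // andbT.
  by apply: contraNneq notMx => <-; apply: rcoset_refl.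
have sumf : #|J :\: M| = \sum_(C in D) #|f C|.
  rewrite -sum1_card (partition_big (fun x => M :* x) (mem D)) //=.
  apply: eq_bigr => C _; rewrite -sum1_card; apply: eq_bigl => x.
  by rewrite [in RHS]inE.
have leq1 C : C \in D -> #|f C| <= q ?= iff (#|f C| == q).
  by move=> _; split; [apply: leqf | ].
have := leqif_sum leq1; rewrite -sumf cardJM sum_nat_const cardD.
have T1_gt0 : 0 < #|T|.-1 by rewrite -subn1 subn_gt0 cardG_gt1.
have k1_gt0 : 0 < #|G : M|.-1 by rewrite -subn1 subn_gt0.
have leqT := dvdn_leq T1_gt0 dvq.
case=> le1; have eqq : q = #|T|.-1.
  by apply/eqP; rewrite eqn_leq leqT; rewrite mulnC leq_pmul2l // in le1.
rewrite -eqq mulnC eqxx => /esym/forall_inP eqf; by split=> // x /Dx/eqf/eqP.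
Qed.

Let eqB x : x \in J :\: M -> #|B x| = q /\ {in B x, forall h, h ^ x = h^-1}.
Proof.
move=> JMx; have [_ /(_ x JMx) eqf] := count_f.
have [Jx notMx] := setDP JMx.
have eqB : (mulg^~ x^-1) @: f (M :* x) = B x.
  apply/eqP; rewrite eqEcard fB //= card_imset ?eqf; last exact: mulIg.
  by rewrite cardB // JG.
split=> [|h]; first by rewrite -eqB card_imset //; apply: mulIg.
rewrite -eqB => /imsetP[z fz ->]; move: fz; rewrite inE => /andP[/setDP[Jz _] /eqP eqM].
have Mzx : z * x^-1 \in M by rewrite -mem_rcoset -eqM rcoset_refl.
by have [] := invB Jx Mzx; rewrite ?mulgKV.
Qed.

(** [x] inverts [B x], so it normalizes the Sylow q-subgroup R which is the centralizer of each
    nontrivial element of [B x]. Hence N(R) has even order 2 |R|, R has order q, and R is [B x]. *)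
Let sylB x : x \in J :\: M ->
  [/\ q.-Sylow(G) (B x), x \in 'N_G(B x) & #|'N_G(B x)| = (#|B x| * 2)%N].
Proof.
move=> JMx; have [oB invBx] := eqB JMx; have [Jx notMx] := setDP JMx.
have qB : q.-group (B x) by rewrite /pgroup oB pnat_id.
have sBG : B x \subset G by rewrite subIset ?sMG.
have [R sylR sBR] := Sylow_superset sBG qB.
have ntB : B x :!=: 1 by rewrite -cardG_gt1 oB prime_gt1.
have ntR : R :!=: 1 by apply: contraNneq ntB => R1; rewrite -subG1 -R1.
have [_ cR _] := Sylow_str q_pr sylR ntR.
have [b Bb ntb] := trivgPn _ ntB.
have Rb c : c \in B x -> c != 1 -> 'C_G[c] = R.
  by move=> Bc ntc; apply: cR; rewrite !inE ntc (subsetP sBR).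
have Nx : x \in 'N_G(R).
  rewrite inE JG // inE -(Rb b) // conjIg conjGid ?JG // -cent1J invBx //.
  by rewrite !Rb ?groupV // ?invg_eq1 ?subxx.
have [r [r_pr _ oN _ _]] := norm_index q_pr sylR ntR.
have ev : 2 %| #|'N_G(R)|.
  by move: (Jx); rewrite inE => /andP[_ /eqP <-]; apply: order_dvdG.
have r2 : r = 2.
  move: ev; rewrite oN Euclid_dvdM // => /orP[|]; last first.
    by rewrite dvdn_prime2 // => /eqP.
  rewrite (card_Hall sylR) p_part Euclid_dvdX //.
  by rewrite dvdn_prime2 // eq_sym (negPf q_neq2).
rewrite r2 in oN.
have [_ _ oR] := Sylow_dihedral_norm q_pr sylR ntR oN.
have eqBR : B x :=: R by apply/eqP; rewrite eqEcard sBR oR oB leqnn.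
by rewrite eqBR.
Qed.

(** The involutions outside [M] are counted a second time, along the map sending x to [B x]: it
    reaches the |T| Sylow q-subgroups of [M], with q involutions over each. Comparison with (|T| -
    1)(|G : M| - 1) gives the index. *)
Lemma simple_even_order :
  [/\ q = #|T|.-1, #|G : M| = #|T|.+1, #|J| = (#|T|.-1 * #|T|.+1)%N
    & exists2 R : {group gT}, q.-Sylow(G) R & #|R| = q /\ #|'N_G(R)| = (#|R| * 2)%N].
Proof.
have [eqq _] := count_f.
have [x0 JMx0] : exists x0, x0 \in J :\: M.
  apply/set0Pn; rewrite -card_gt0 cardJM muln_gt0 -eqq prime_gt0 //=.
  by rewrite -subn1 subn_gt0.
have [sylB0 _ oNB0] := sylB JMx0; have [oB0 _] := eqB JMx0.
have sylM Q : (Q \in 'Syl_q(M)) ->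
  [/\ q.-Sylow(G) Q, #|Q| = q & #|'N_G(Q)| = (#|Q| * 2)%N].
  rewrite inE => sylQ; have sBM : B x0 \subset M by apply: subsetIl.
  have sylB0M := pHall_subl sBM sMG sylB0.
  have [g Mg ->] := Sylow_trans sylB0M sylQ; have Gg := subsetP sMG g Mg.
  rewrite pHallJ // cardJg; split=> //.
  by rewrite -oNB0 -(cardJg 'N_G(B x0) g) [in RHS]conjIg (conjGid Gg) -normJ.
have fiberB Q : Q \in 'Syl_q(M) -> [set x in J :\: M | B x == Q] = 'N_G(Q) :\: Q.
  move=> sylQ; have [sylGQ oQ oNQ] := sylM Q sylQ.
  have ntQ : Q :!=: 1 by rewrite -cardG_gt1 oQ prime_gt1.
  have sQM : Q \subset M by move: sylQ; rewrite inE => /pHall_sub.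
  have [invt invtz _] := Sylow_dihedral_norm q_pr sylGQ ntQ oNQ.
  apply/setP=> t; rewrite inE; apply/andP/idP=> [[JMt /eqP defQ] | Nt].
    have [_ Nt _] := sylB JMt; rewrite -defQ inE Nt andbT.
    by case/setDP: JMt => _; apply: contra => /setIP[].
  have [NGt notQt] := setDP Nt; have [Gt NQt] := setIP NGt.
  have Jt : t \in J by rewrite inE Gt invt.
  have notMt : t \notin M.
    (* An involution of [M] lies in [T], so its commutators with [Q] lie in both [T] and [Q] and are
       trivial; but [t] inverts [Q], of odd order. *)
    apply/negP=> Mt; have T1t : t \in T^# by rewrite -JT inE Jt.
    have [_ Tt] := setD1P T1t; have [b Qb ntb] := trivgPn _ ntQ.
    have tiTQ : T :&: Q = 1.
      by apply: coprime_TIg; apply: pnat_coprime tT _; rewrite /pgroup oQ pnatE.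
    have Qc : [~ t, b] \in T :&: Q.
      rewrite inE {1}commgEl groupM ?groupV ?memJ_norm //=; last first.
        by have /subsetP := normal_norm nsTM; apply; apply: (subsetP sQM).
      by rewrite commgEr groupM ?memJ_norm // groupV.
    rewrite tiTQ in Qc; have /commgP cbt : [~ t, b] == 1 by apply/eqP/set1P.
    have := invtz t b Nt Qb; rewrite conjgE -cbt mulKg => bV.
    have ob2 : #[b] %| 2 by rewrite order_dvdn expgS {2}bV mulgV.
    have obq : #[b] %| q by rewrite -oQ order_dvdG.
    have co2q : coprime 2 q by rewrite prime_coprime // dvdn_prime2 // eq_sym.
    by rewrite -order_eq1 -dvdn1 -(eqP co2q) dvdn_gcd ob2 obq in ntb.
  rewrite inE notMt Jt; split=> //; apply/eqP/val_inj/eqP.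
  have JMt : t \in J :\: M by rewrite inE notMt.
  have [oBt _] := eqB JMt; rewrite eq_sym eqEcard oBt oQ leqnn andbT.
  have sQB : Q \subset M :^ t by rewrite -(normP NQt) conjSg.
  by apply/subsetP=> z Qz; apply/setIP; rewrite (subsetP sQM) ?(subsetP sQB).
have cardfiber Q : Q \in 'Syl_q(M) -> #|'N_G(Q) :\: Q| = q.
  move=> /sylM[sylQ oQ oNQ].
  have sQN : Q \subset 'N_G(Q) by rewrite subsetI normG (pHall_sub sylQ).
  by rewrite cardsD (setIidPr sQN) oNQ oQ muln2 -addnn addnK.
have cardSyl : #|'Syl_q(M)| = #|T|.
  have sylB0M := pHall_subl (subsetIl _ _ : B x0 \subset M) sMG sylB0.
  rewrite (card_Syl sylB0M) -divgS ?subsetIl // oM /=.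
  (* Elements normalizing [B x0] but outside it lie in a fibre, hence outside [M]. *)
  suff -> : 'N_M(B x0) = B x0 by rewrite oB0 mulnK ?prime_gt0.
  apply/eqP; rewrite eqEsubset andbC subsetI subsetIl normG /=.
  apply/subsetP=> t /setIP[Mt Nt]; apply: contraLR (Mt) => notBt.
  have : t \in [set x in J :\: M | B x == B x0].
    by rewrite fiberB inE // notBt inE (subsetP sMG).
  by rewrite inE => /andP[/setDP[]].
have : #|J :\: M| = (#|T| * q)%N.
  rewrite -sum1_card (partition_big B (mem 'Syl_q(M))) /=.
    rewrite -cardSyl -sum_nat_const; apply: eq_bigr => Q sylQ.
    by rewrite -(cardfiber Q sylQ) -fiberB // -sum1_card; apply: eq_bigl => x; rewrite [in RHS]inE.
  move=> x JMx; rewrite inE; have [sylBx _ _] := sylB JMx.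
  exact: pHall_subl (subsetIl _ _) sMG sylBx.
rewrite cardJM cardJ -eqq mulnC => /eqP; rewrite eqn_pmul2r ?prime_gt0 // => /eqP eqk.
have eqk1 : #|G : M| = #|T|.+1 by rewrite -eqk prednK // ltnW.
by split=> //; [rewrite eqk1 | exists (B x0)].
Qed.

End Involutions.

(** The number of ways to write [z] as a product of two involutions, namely of t and t z. *)
Let N z := #|[set t in J | t * z \in J]|.

Let JJ x g : g \in G -> (x ^ g \in J) = (x \in J).
Proof. by move=> Gg; rewrite !inE orderJ groupJr. Qed.

Let NJ z g : g \in G -> N (z ^ g) = N z.
Proof.
move=> Gg; rewrite /N -[RHS](card_imset _ (conjg_inj g)).
apply: eq_card => t; apply/idP/imsetP=> [|[u]].
  rewrite inE => /andP[Jt Jtz]; exists (t ^ g^-1); rewrite ?conjgKV // inE JJ ?groupV // Jt.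
  by rewrite -(JJ _ Gg) conjMg conjgKV.
by case/setIdP=> Ju Juz ->; apply/setIdP; rewrite JJ // -conjMg JJ.
Qed.

Let sumN : (\sum_(z in G) N z = #|J| * #|J|)%N.
Proof.
rewrite /N; under eq_bigr do rewrite -sum1_card.
rewrite (exchange_big_dep (mem J)) /= => [|z t _]; last by rewrite inE => /andP[].
rewrite -sum_nat_const; apply: eq_bigr => t Jt.
rewrite -(card_imset (mem J) (mulgI t^-1)) -sum1_card; apply: eq_bigl => z.
apply/andP/imsetP=> [[Gz] | [j Jj ->]].
  by rewrite inE => /andP[_ Jtz]; exists (t * z); rewrite ?mulKg.
by rewrite groupM ?groupV ?JG // inE Jt mulKVg.
Qed.

Let N1 : N 1 = #|J|.
Proof. by apply: eq_card => t; rewrite inE mulg1 andbb. Qed.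

Let N_inv t z : t \in J -> t * z \in J -> z ^ t = z^-1.
Proof.
move=> Jt Jtz; have -> : z ^ t = z^-1 * (t^-1 * (t * z * (t * z)) * t).
  by rewrite conjgE !mulgA mulgKV mulVg mul1g JV.
by rewrite Jinv // mulg1 mulVg mulg1.
Qed.

(** Both factors commute with the involution [x], so they lie in the elementary abelian group [H i];
    only t = 1 and t = x are excluded. *)
Let N_even i x : pr i = 2 -> x \in (H i)^# -> N x = #|H i|.-2.
Proof.
move=> pr2 H1x; have [abelH cH _] := Sylow_str (pr_prime i) (sylH i) (ntH i).
rewrite pr2 in abelH; have H_J t : t \in (H i)^# -> t \in J.
  by case/setD1P=> ntt Ht; rewrite inE (subsetP (sHG i)) // (abelem_order_p abelH).
have -> : N x = #|(H i)^# :\ x|.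
  apply: eq_card => t; rewrite inE; apply/andP/setD1P=> [[Jt Jtx] | [neqtx H1t]].
    have xV : x^-1 = x by rewrite JV ?H_J.
    have tC : t \in 'C_G[x].
      by rewrite inE JG //; apply/cent1P/commute_sym/commgP/conjg_fixP; rewrite (N_inv Jt Jtx).
    rewrite cH // in tC; rewrite !inE tC Jnt //; split=> //.
    by apply: contraTneq Jtx => ->; rewrite (Jinv (H_J x H1x)); apply/negP=> J1; have := Jnt J1;
      rewrite eqxx.
  split; first exact: H_J.
  have [[_ Ht] [_ Hx]] := (setD1P H1t, setD1P H1x).
  apply: (H_J); rewrite in_setD1 groupM // andbT; apply: contra neqtx.
  by rewrite -eq_invg_mul (JV (H_J t H1t)).
by have := cardsD1 x (H i)^#; rewrite (cardsD1 1 (H i)) group1 H1x => ->.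
Qed.

(** The first factor inverts [x], hence normalizes its centralizer [H i]. In the dihedral case every
    element of the normalizer outside [H i] qualifies; otherwise the normalizer has odd order. *)
Let N_odd i x : pr i != 2 -> x \in (H i)^# ->
  N x = if #|'N_G(H i)| == (#|H i| * 2)%N then #|H i| else 0%N.
Proof.
move=> pr_odd H1x; have [abelH cH _] := Sylow_str (pr_prime i) (sylH i) (ntH i).
have oddH : odd #|H i|.
  rewrite (card_Hall (sylH i)) p_part oddX orbC.
  by case: (even_prime (pr_prime i)) pr_odd => [->|->] //; rewrite orbT.
have J_N t : t \in J -> t * x \in J -> t \in 'N_G(H i).
  move=> Jt Jtx; rewrite inE JG // inE -(cH x) // conjIg conjGid ?JG // -cent1J.
  rewrite (N_inv Jt Jtx) !cH ?subxx //; have [ntx Hx] := setD1P H1x.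
  by rewrite !inE groupV invg_eq1 ntx.
case: eqP => [oN | neN].
  have [invt invtz _] := Sylow_dihedral_norm (pr_prime i) (sylH i) (ntH i) oN.
  have sHN : H i \subset 'N_G(H i) by rewrite subsetI normG sHG.
  have -> : N x = #|'N_G(H i) :\: H i|.
    apply: eq_card => t; rewrite inE; apply/andP/idP=> [[Jt Jtx] | Nt].
      rewrite inE J_N // andbT; apply/negP=> Ht.
      have : #[t] %| #|H i| by apply: order_dvdG.
      by move: Jt; rewrite inE => /andP[_ /eqP->]; rewrite dvdn2 oddH.
    have NJt t1 : t1 \in 'N_G(H i) :\: H i -> t1 \in J.
      by move=> Nt1; rewrite inE invt // andbT; case/setDP: Nt1 => /setIP[].
    rewrite !NJt //; have [_ Hx] := setD1P H1x; have [NGt notHt] := setDP Nt.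
    by apply/setDP; split; [rewrite groupM // (subsetP sHN) | rewrite groupMr].
  by rewrite cardsD (setIidPr sHN) oN muln2 -addnn addnK.
apply/eqP; rewrite cards_eq0; apply/eqP/setP=> t; rewrite !inE.
apply/negP=> /andP[Jt Jtx]; have Nt : t \in 'N_G(H i) by apply: J_N; rewrite ?inE.
have [q [q_pr _ oN _ _]] := norm_index (pr_prime i) (sylH i) (ntH i).
have : #[t] %| #|'N_G(H i)| by apply: order_dvdG.
case/andP: Jt => _ /eqP->; rewrite dvdn2 oN oddM oddH /= => ev_q.
by case: (even_prime q_pr) ev_q => [q2 | ->] //; rewrite q2 in oN.
Qed.

Lemma simple_order_60 : #|G| = 60.
Proof.
have dv2 : 2 \in primes #|G|.
  by rewrite mem_primes /= cardG_gt0 dvdn2 simple_even.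
pose i2 : I := SeqSub dv2; pose T := H i2.
have sylT : 2.-Sylow(G) T := sylH i2; have ntT : T :!=: 1 := ntH i2.
have [q [q_pr q_neq2 oM dvq _]] := norm_index (isT : prime 2) sylT ntT.
have [eqq eqk eqJ [R sylR [oR oNR]]] :=
  simple_even_order sylT ntT q_pr q_neq2 oM dvq.
set y := #|T| in eqq eqk eqJ oM *.
have y_gt2 : 2 < y by have := prime_gt1 q_pr; rewrite eqq; lia.
have oG : #|G| = (y.-1 * y * y.+1)%N.
  rewrite -(Lagrange (subsetIl G 'N(T))) oM eqk eqq; congr (_ * _)%N.
  exact: mulnC.
have := @sum_TI_cover nat gT G I H (fun i => 'N_G(H i)%G) N sHG
  (fun i => TI_Sylow (sylH i) (ntH i)) disjH coverH (fun x g => @NJ x g).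
rewrite sumN N1.
have evG : (2 * #|G|./2 = #|G|)%N.
  by rewrite mul2n -[RHS]odd_double_half (negPf simple_even).
(* The odd primes whose Sylow subgroup [H i] has normalizer of order 2 |H i|. *)
pose D := [pred i : I | (pr i != 2) && (#|'N_G(H i)| == (#|H i| * 2)%N)].
have termE i : ((\sum_(x in (H i)^#) N x) *+ #|G : 'N_G(H i)|)%R =
  (if i == i2 then y.-1 * y.-2 * y.+1 else
   if D i then #|H i|.-1 * #|G|./2 else 0)%N :> nat.
  have H1 : #|(H i)^#| = #|H i|.-1 by rewrite (cardsD1 1 (H i)) group1.
  have -> : (i == i2) = (pr i == 2) by rewrite -(inj_eq val_inj).
  rewrite mulrn_nat; case: ifP => [/eqP pr2 | /negbT pr_odd].
    have eqi : i = i2 by [apply: val_inj]; subst i.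
    rewrite (eq_bigr (fun _ => y.-2)) => [|x H1x]; last exact: N_even.
    by rewrite sum_nat_const H1 eqk.
  rewrite (eq_bigr _ (fun x => N_odd pr_odd)) /= pr_odd /=.
  case: eqP => [oN | _]; last by rewrite big1.
  rewrite sum_nat_const H1 -mulnA; congr (_ * _)%N; apply/eqP.
  by rewrite -(eqn_pmul2l (ltn0Sn 1)) evG mulnA (mulnC 2) -oN Lagrange ?subsetIl.
rewrite (eq_bigr _ (fun i _ => termE i)) (bigD1 i2) // eqxx.
have -> : (\sum_(i | i != i2) (if i == i2 then y.-1 * y.-2 * y.+1 else
   if D i then #|H i|.-1 * #|G|./2 else 0) = (\sum_(i | D i) #|H i|.-1) * #|G|./2)%N.
  rewrite big_distrl /= [RHS]big_mkcond [LHS]big_mkcond /=; apply: eq_bigr => i _.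
  by case: (eqVneq i i2) => [-> | _] //=; rewrite if_same.
rewrite eqJ => eqS; have {eqS} := involution_pairs_arith (ltnW y_gt2) eqS _.
rewrite evG -oG => /(_ erefl).
have piGq : q \in primes #|G|.
  by rewrite mem_primes q_pr cardG_gt0 -oR cardSg // (pHall_sub sylR).
pose iq : I := SeqSub piGq.
have [g Gg defHq] := Sylow_trans sylR (sylH iq).
have Diq : D iq.
  rewrite /= q_neq2 defHq cardJg -oNR -(cardJg 'N_G(R) g).
  by rewrite conjIg (conjGid Gg) -normJ eqxx.
have oHq : #|H iq| = q by rewrite defHq cardJg.
rewrite (bigD1 iq) //= oHq => eqS.
(* The total over [D] is 2 (y - 1), and the prime q = y - 1 accounts for y - 2 of it. *)
have {eqS} sumD' : (\sum_(i | D i && (i != iq)) #|H i|.-1 = y)%N.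
  by apply: (@addnI q.-1); apply: etrans eqS _; rewrite eqq; move: (y) y_gt2 => [|[|z]] //= _;
    rewrite mul2n -addnn !addnS !addSn.
(* The prime is neither 2 nor q, so its part in (y - 1) y (y + 1) comes from y + 1. *)
have oH i : D i -> i != iq -> #|H i| = ((y.+1)`_(pr i))%N.
  move=> /andP[pr_odd _] neq; rewrite (card_Hall (sylH i)) oG.
  have y_gt0 : 0 < y by apply: ltnW (ltnW y_gt2).
  have y1_gt0 : 0 < y.-1 by rewrite -eqq prime_gt0.
  rewrite !partnM ?muln_gt0 ?y1_gt0 //.
  have [/= p2 pq] : pr i != 2 /\ pr i != q by rewrite -(inj_eq val_inj) in neq.
  rewrite -eqq (@part_p'nat (pr i) q) ?(@part_p'nat (pr i) y) ?mul1n //.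
    by apply: sub_in_pnat (pHall_pgroup sylT) => r _ /eqP ->; rewrite !inE eq_sym.
  by rewrite pnatE // !inE eq_sym.
have [i0 /andP[Di0 neq0] _] : exists2 i, D i && (i != iq) & true.
  case: (pickP [pred i | D i && (i != iq)]) => [i Di | no]; first by exists i.
  by move: sumD'; rewrite big_pred0 // => y0; rewrite -y0 in y_gt2.
have [_ _ opi0] := Sylow_dihedral_norm (pr_prime i0) (sylH i0) (ntH i0) (eqP (proj2 (andP Di0))).
have p_pr := pr_prime i0; set p := pr i0 in p_pr opi0.
(* With y + 1 = p m, the remaining terms are primary parts of m minus one, so they add up to at most
   m - 1, which forces m = 1. *)
have eqp : y.+1 = p.
  have ypE : ((y.+1)`_p)%N = p by rewrite -oH.
  have := partnC p (ltn0Sn y); rewrite ypE; set m := ((y.+1)`_(p^'))%N => eqm.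
  have m_gt0 : 0 < m by apply: part_gt0.
  rewrite (bigD1 i0) ?Di0 //= opi0 in sumD'.
  pose s := [seq pr i | i in [pred i | D i && (i != iq) && (i != i0)]].
  have uniq_s : uniq s by rewrite map_inj_uniq ?enum_uniq //; apply: val_inj.
  have le_s := sum_part_pred uniq_s m_gt0.
  have eqs : (\sum_(r <- s) (m`_r).-1 = \sum_(i | D i && (i != iq) && (i != i0)) #|H i|.-1)%N.
    rewrite big_map big_enum_cond; apply: eq_big => [i|i]; first by rewrite andbT.
    case/andP=> /andP[/andP[Di neqi] neqi0] _; rewrite oH //; congr _.-1.
    rewrite /m -partnI (@eq_partn _ (pr i)) // => r; rewrite !inE andbC.
    by case: eqP => //= ->; rewrite -(inj_eq val_inj) in neqi0.
  rewrite {}eqs in le_s; exact: part_sum_arith (prime_gt1 p_pr) m_gt0 eqm sumD' le_s.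
(* Among three consecutive numbers, y is a power of 2, so 3 is one of the primes y - 1 and y + 1;
   the latter would give y = 2. *)
have := dvdn3_mul3 y.
rewrite !Euclid_dvdM // eqp -eqq (dvdn_prime2 _ q_pr) // (dvdn_prime2 _ p_pr) //
  => /orP[/orP[/eqP q3 | dv3y] | /eqP p3].
- by rewrite oG -eqq -q3; have -> : y = 4 by lia.
- by move: dv3y; rewrite /y (card_Hall sylT) p_part Euclid_dvdX.
- by move: eqp y_gt2; rewrite -p3 => -[->].
Qed.

End SimpleOrder.

(** * Groups of order 60 and their central extensions *)

(** The action on the right cosets of [M], with the cosets numbered so that the target is a
    symmetric group on |G : M| letters. *)
Lemma index_perm_morphism (gT : finGroupType) (G M : {group gT}) :
  exists f : {morphism G >-> 'S_#|G : M|}, 'ker f \subset M.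
Proof.
pose n := #|G : M|; pose E (i : 'I_n) : {set gT} := enum_val i.
have M_RC : (M : {set gT}) \in rcosets M G.
  by apply/rcosetsP; exists 1; rewrite ?mulg1.
pose rk C : 'I_n := enum_rank_in M_RC C.
have EK : cancel E rk by move=> i; apply: enum_valK_in.
have rkK C : C \in rcosets M G -> E (rk C) = C by move=> RC; apply: enum_rankK_in.
have RCg C g : C \in rcosets M G -> g \in G -> C :* g \in rcosets M G.
  case/rcosetsP=> x Gx -> Gg; apply/rcosetsP; exists (x * g); rewrite ?groupM //.
  by rewrite rcosetM.
pose f g : 'S_n := insubd (1 : 'S_n) [ffun i => rk (E i :* g)].
have fE g i : g \in G -> E (f g i) = E i :* g.
  move=> Gg; have injf : injectiveb [ffun i => rk (E i :* g)].
    apply/injectiveP=> j k; rewrite !ffunE => /(congr1 E).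
    rewrite !rkK ?RCg ?enum_valP // => /(congr1 (fun A => A :* g^-1)).
    by rewrite !rcosetK => /(can_inj EK).
  have fgE : pval (f g) = [ffun i => rk (E i :* g)].
    by rewrite -[pval _]/(val _) val_insubd injf.
  by rewrite -pvalE fgE ffunE rkK // RCg // enum_valP.
have fM : {in G &, {morph f : x y / x * y}}.
  move=> x y Gx Gy; apply/permP=> i; apply: (can_inj EK).
  by rewrite permM !fE ?groupM // rcosetM.
exists (Morphism fM); apply/subsetP=> g /morphpreP[Gg /set1P /= fg1].
by have := fE g (rk M) Gg; rewrite fg1 perm1 rkK // => ->; apply: rcoset_refl.
Qed.

Section SimpleOrder60.

Variables (gT : finGroupType) (G : {group gT}).
Hypothesis simG : simple G.

Lemma simple_index_injm (M : {group gT}) : M \proper G ->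
  exists f : {morphism G >-> 'S_#|G : M|}, 'injm f.
Proof.
case/andP=> sMG notsGM; have [f kerM] := index_perm_morphism G M; exists f.
have [_ sim] := simpleP _ simG.
case: (sim ('ker f)%G (ker_normal f)) => [-> // | kerG].
by rewrite -kerG kerM in notsGM.
Qed.

Hypothesis oG : #|G| = 60.

Lemma simple60_index (M : {group gT}) : M \proper G -> 4 < #|G : M|.
Proof.
move=> prM; have [f injf] := simple_index_injm prM.
have: #|G| %| #|G : M|`!.
  rewrite -(card_injm injf (subxx G)) -[#|G : M| in X in _ %| X`!]card_ord.
  by rewrite -card_Sym cardSg // subsetT.
by rewrite oG; case: #|G : M| => [|[|[|[|[|n]]]]].
Qed.

Lemma simple60_perfect : G^`(1) = G.
Proof.
have [_ sim] := simpleP _ simG; case: (sim _ (der_normal 1 G)) => // G'1.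
by have := simple_sol_prime (abelian_sol (introT derG1P G'1)) simG; rewrite oG.
Qed.

(** The index divides 15 and exceeds 4. Index 15 would make the abelian group [P] self-normalizing,
    so that no fusion occurs in [P] and transfer contradicts perfectness. *)
Lemma simple60_norm_Sylow2 (P : {group gT}) : 2.-Sylow(G) P -> #|G : 'N_G(P)| = 5.
Proof.
move=> sylP; have [sPG pP _] := and3P sylP.
have oP : #|P| = 4 by rewrite (card_Hall sylP) oG p_part.
have abP : abelian P by apply: (p2group_abelian pP); rewrite oP.
have prN : 'N_G(P) \proper G.
  rewrite properEneq subsetIl andbT; apply/eqP=> NG.
  have nsPG : P <| G by rewrite /normal sPG -NG subsetIr.
  have [_ sim] := simpleP _ simG; case: (sim _ nsPG) => eqP; have := oP; rewrite eqP.
    by rewrite cards1.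
  by rewrite oG.
have := simple60_index prN; have : #|G : 'N_G(P)| %| 15.
  have : #|G : 'N_G(P)| %| #|G : P| by apply: indexgS; rewrite subsetI sPG normG.
  by rewrite -divgS // oG oP.
case: (eqVneq #|G : 'N_G(P)| 15) => [k15 _ _ | ]; last first.
  move: #|_ : _| => k + dvk; have := dvdn_leq (isT : 0 < 15) dvk; move: dvk;
    do 16!case: k => [|k] //.
have NP : 'N_G(P) = P.
  apply/eqP; rewrite eq_sym eqEcard subsetI sPG normG /= -(leq_pmul2r (isT : 0 < 15)).
  by rewrite -{1}k15 Lagrange ?subsetIl // oG oP.
have foc : {in P & G, forall x u, x ^ u \in P -> [~ x, u] \in 1%G}.
  move=> x u Px Gu Pxu; have [v Nv eqv] := abelian_Sylow_fusion sylP abP Px Gu Pxu.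
  rewrite inE commgEl -eqv -commgEl; apply/commgP; apply: (centsP abP) => //.
  by rewrite -NP.
have := Sylow_focal sylP (sub1G P) _ foc; rewrite simple60_perfect (setIidPl sPG).
rewrite (derG1P abP) subxx => /(_ isT)/subset_leq_card; by rewrite oP cards1.
Qed.

(** The image in Sym(5) is simple; if it met Alt(5) trivially, their product would have 3600
    elements. *)
Lemma simple60_Alt5 : G \isog 'Alt_('I_5).
Proof.
have [P sylP] := Sylow_exists 2 G; have iN := simple60_norm_Sylow2 sylP.
have prN : 'N_G(P)%G \proper G.
  rewrite properEneq subsetIl andbT; apply/eqP=> NG.
  by rewrite NG indexgg in iN.
have [f injf] := simple_index_injm prN; rewrite /= iN in f injf.
have oAlt : #|'Alt_('I_5)| = 60.
  by apply/eqP; rewrite -(eqn_pmul2l (isT : 0 < 2)) card_Alt card_ord.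
have isoG : G \isog f @* G by apply: sub_isog.
suff <- : f @* G = 'Alt_('I_5) by [].
apply/eqP; rewrite eqEcard card_injm // oG oAlt leqnn andbT.
have simfG : simple (f @* G) by rewrite -(isog_simple isoG).
have [_ sim] := simpleP _ simfG.
have ns : (f @* G) :&: 'Alt_('I_5) <| f @* G.
  by rewrite /normal subsetIl normsI ?normG // (subset_trans (subsetT _)) // Alt_norm.
case: (sim _ ns) => [tiA | <-]; last exact: subsetIr.
have : #|(f @* G) * 'Alt_('I_5)| <= #|'Sym_('I_5)| by rewrite subset_leq_card ?subsetT.
by rewrite TI_cardMg // card_injm // oG oAlt card_Sym card_ord.
Qed.

End SimpleOrder60.

Lemma perfect_sol_trivg (gT : finGroupType) (G : {group gT}) :
  G \subset G^`(1) -> solvable G -> G :=: 1.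
Proof.
move=> perfG solG; apply/eqP/idPn=> ntG.
by have := sol_der1_proper solG (subxx G) ntG; rewrite properE perfG andbF.
Qed.

Lemma quotient_perfect (gT : finGroupType) (G N : {group gT}) :
  G \subset 'N(N) -> G \subset G^`(1) -> G / N \subset (G / N)^`(1).
Proof. by move=> nNG perfG; rewrite -quotient_der // quotientS. Qed.

(** Apart from 30, a proper divisor of 60 has at most two prime factors and Burnside's theorem
    applies. In order 30 a Sylow 2-subgroup of order 2 admits no fusion, so transfer applies. *)
Lemma perfect_dvd60_trivg (gT : finGroupType) (G : {group gT}) :
  G \subset G^`(1) -> #|G| %| 60 -> #|G| != 60 -> G :=: 1.
Proof.
move=> perfG; rewrite dvdn_divisors // => dvG n60.
have [le2 | oG] : (size (primes #|G|) <= 2)%N \/ #|G| = 30.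
  have /allP/(_ _ dvG) : all (fun n => [|| size (primes n) <= 2, n == 30 | n == 60])%N (divisors
    60) by [].
  by rewrite (negPf n60) orbF => /orP[|/eqP]; [left | right].
  exact: perfect_sol_trivg perfG (Burnside_p_a_q_b le2).
have [P sylP] := Sylow_exists 2 G; have oP : #|P| = 2.
  by rewrite (card_Hall sylP) oG p_part.
have foc : {in P & G, forall x u, x ^ u \in P -> [~ x, u] \in 1%G}.
  move=> x u Px Gu Pxu; have [->|ntx] := eqVneq x 1; first by rewrite comm1g.
  have sP : P :=: [set 1; x].
    apply/eqP; rewrite eq_sym eqEcard oP cards2 eq_sym ntx andbT.
    by apply/subsetP=> z /set2P[]->.
  move: Pxu; rewrite sP => /set2P[/eqP|xu]; first by rewrite conjg_eq1 (negPf ntx).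
  by rewrite commgEl xu mulVg.
have abP : abelian P by apply: cyclic_abelian; apply: prime_cyclic; rewrite oP.
have := Sylow_focal sylP (sub1G P) _ foc; rewrite (derG1P abP) => /(_ (subxx _)).
rewrite (setIidPl (subset_trans (pHall_sub sylP) perfG)) => /subset_leq_card.
by rewrite oP cards1.
Qed.

Lemma perfect60_simple (gT : finGroupType) (G : {group gT}) :
  G \subset G^`(1) -> #|G| = 60 -> simple G.
Proof.
move=> perfG oG; have ntG : G :!=: 1 by rewrite -cardG_gt1 oG.
apply/simpleP; split=> // N nsNG; have [sNG nNG] := andP nsNG.
have dvN : #|G / N| %| 60 by rewrite card_quotient // -oG dvdn_indexg.
have [o60 | n60] := eqVneq #|G / N| 60.
  left; apply/eqP; rewrite trivg_card1; apply/eqP.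
  have := Lagrange sNG; rewrite oG -card_quotient // o60.
  by case: #|N| => [|[|n]] //; rewrite !mulSn addnA; lia.
right; apply/eqP; rewrite eqEsubset sNG -quotient_sub1 //=.
by rewrite (perfect_dvd60_trivg (quotient_perfect nNG perfG) dvN n60).
Qed.

(** If [P] is not abelian, it is the product of the central subgroup [Z] and some <x, y>, so P' is
    generated by the central element c = [x, y]. As x^2 is in [Z], c^2 = [x^2, y] = 1. *)
Lemma der1_central_index4 (gT : finGroupType) (P Z : {group gT}) :
  Z \subset 'Z(P) -> #|P : Z| = 4 -> #|P^`(1)| <= 2.
Proof.
move=> sZZ iZ; have [/derG1P-> | nabP] := boolP (abelian P); first by rewrite cards1.
have [sZP cPZ] := subsetIP sZZ; have cZP : P \subset 'C(Z) by rewrite centsC.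
have nZP : P \subset 'N(Z) := cents_norm cZP.
have oPZ : #|P / Z| = 4 by rewrite card_quotient.
have sP'Z : P^`(1) \subset Z.
  apply: der1_min => //; apply: (@p2group_abelian _ 2).
    by rewrite /pgroup oPZ.
  by rewrite oPZ.
have abZ : abelian Z by apply: subset_trans cPZ _; apply: centS.
have abX u : u \in P -> abelian (<[u]> <*> Z).
  by move=> Pu; rewrite abelianY cycle_abelian abZ (subset_trans cPZ) ?centS ?cycle_subG.
have [x Px notZx] : exists2 x, x \in P & x \notin Z.
  by apply/subsetPn; rewrite -indexg_eq1 iZ.
pose X := (<[x]> <*> Z)%G.
have sXP : X \subset P by rewrite join_subG cycle_subG Px.
have sZX : Z \subset X := joing_subr _ _.
have Xx : x \in X by rewrite -cycle_subG joing_subl.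
have iX := Lagrange_index sXP sZX; rewrite iZ in iX.
have iX2 : #|P : X| = 2 /\ #|X : Z| = 2.
  have n1 : #|X : Z| != 1%N.
    by rewrite indexg_eq1; apply: contra notZx => /subsetP->.
  have n2 : #|P : X| != 1%N.
    by rewrite indexg_eq1; apply: contra nabP => /abelianS->//; apply: abX.
  have : #|P : X| \in divisors 4 by rewrite -dvdn_divisors // -iX dvdn_mulr.
  rewrite !inE; move: iX n1 n2; case: #|P : X| => [|[|[|[|[|a]]]]] //=.
    by move/eqP; rewrite -[4]/(2 * 2)%N eqn_pmul2l // => /eqP->.
  by move/eqP; rewrite -{2}[4]/(4 * 1)%N eqn_pmul2l // => ->.
have [iPX iXZ] := iX2.
have Zx2 : x ^+ 2 \in Z.
  apply: coset_idr; rewrite ?groupX ?(subsetP nZP) // morphX ?(subsetP nZP) //=.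
  apply/eqP; rewrite -order_dvdn -iXZ -card_quotient ?(subset_trans sXP) //.
  by rewrite order_dvdG ?mem_quotient.
have [y Py notXy] : exists2 y, y \in P & y \notin X.
  by apply/subsetPn; rewrite -indexg_eq1 iPX.
pose c := [~ x, y]; pose W := (<[x]> <*> <[y]>)%G.
have Zc : c \in Z by rewrite (subsetP sP'Z) ?mem_commg.
have defP : Z \* W = P.
  have sWP : W \subset P by rewrite join_subG !cycle_subG Px.
  rewrite cprodE ?(subset_trans sWP) //; have cWZ := subset_trans sWP cZP.
  rewrite -cent_joinEr //; apply/eqP; rewrite eqEsubset join_subG sZP sWP /=.
  have sXZW : X \subset Z <*> W.
    rewrite join_subG joing_subl andbT cycle_subG.
    by rewrite (subsetP (joing_subr _ _)) // -cycle_subG joing_subl.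
  have sZWP : Z <*> W \subset P by rewrite join_subG sZP.
  have := Lagrange_index sZWP sXZW; rewrite iPX => iZW.
  have : #|Z <*> W : X| != 1%N.
    rewrite indexg_eq1; apply: contra notXy => /subsetP->//.
    by rewrite (subsetP (joing_subr _ _)) // -cycle_subG joing_subr.
  rewrite -indexg_eq1 => n1; have [_ /(_ #|Z <*> W : X|)] := primeP (isT : prime 2).
  rewrite -{1}iZW dvdn_mull // => /(_ isT)/pred2P[e|e]; first by rewrite e in n1.
  by move/eqP: iZW; rewrite e -{2}[2]mul1n eqn_pmul2r.
have := der_cprod 1 defP; rewrite (derG1P abZ).
rewrite cprod1g => <-; rewrite der1_joing_cycles; first last.
  by apply: subsetP Zc; rewrite (subset_trans cPZ) // centS // join_subG !cycle_subG Px.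
have comx : commute x c by apply/commute_sym/(centsP cPZ).
rewrite -orderE dvdn_leq // order_dvdn -(commXg _ comx).
by apply/commgP; apply: (centsP cPZ).
Qed.

(** Transfer puts [Z] inside P' for a Sylow 2-subgroup P, and P / Z has order 4. *)
Lemma perfect_cover60_center (gT : finGroupType) (G Z : {group gT}) :
    G \subset G^`(1) -> Z \subset 'Z(G) -> 2.-group Z -> #|G : Z| = 60 ->
  #|Z| <= 2.
Proof.
move=> perfG sZZ zZ iZ; have [sZG cGZ] := subsetIP sZZ.
have [P sylP] := Sylow_exists 2 G; have [sPG pP _] := and3P sylP.
have nsZG : Z <| G by rewrite sub_center_normal.
have sZP : Z \subset P.
  by rewrite (subset_trans (pcore_max zZ nsZG)) // pcore_sub_Hall.
have sZP' : Z \subset P^`(1).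
  by rewrite -{1}(setIidPr sZP) (Sylow_cap_center sylP).
apply: leq_trans (subset_leq_card sZP') (@der1_central_index4 _ P Z _ _).
  by rewrite subsetI sZP centsC (subset_trans sPG) // centsC.
have oG := Lagrange sZG; rewrite iZ in oG.
rewrite -divgS // (card_Hall sylP) -oG partnM ?cardG_gt0 //.
by rewrite part_pnat_id // mulKn ?cardG_gt0 // p_part.
Qed.

(** * Uniqueness of the perfect double cover *)

Section DoubleCover.

Variables (gT rT : finGroupType) (K N : {group gT}) (L Z : {group rT}).
Hypotheses (perfK : K \subset K^`(1)) (perfL : L \subset L^`(1)).
Hypotheses (sNZK : N \subset 'Z(K)) (sZZL : Z \subset 'Z(L)).
Hypotheses (oN : #|N| = 2) (oZ : #|Z| = 2) (iN : #|K : N| = 60) (oL : #|L| = 120).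
Variable f : {morphism K / N >-> coset_of Z}.
Hypotheses (injf : 'injm f) (imf : f @* (K / N) = L / Z).

Let nsNK : N <| K. Proof. exact: sub_center_normal. Qed.
Let nsZL : Z <| L. Proof. exact: sub_center_normal. Qed.

(** The fibre product of [K] and [L] over their common quotient of order 60. *)
Let F := [set u in setX K L | f (coset N u.1) == coset Z u.2].

Let FP x y : reflect [/\ x \in K, y \in L & f (coset N x) = coset Z y] ((x, y) \in F).
Proof.
apply: (iffP setIdP) => [[/setXP[Kx Ly] /eqP] | [Kx Ly ->]] //.
by rewrite in_setX Kx Ly.
Qed.

Let group_set_F : group_set F.
Proof.
have [_ nNK] := andP nsNK; have [_ nZL] := andP nsZL.
apply/group_setP; split=> [|[x y] [x1 y1] /FP[Kx Ly fx] /FP[Kx1 Ly1 fx1]].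
  by apply/FP; rewrite !group1 !morph1.
apply/FP; rewrite !groupM //; split=> //.
rewrite !morphM ?(subsetP nNK) ?(subsetP nZL) ?mem_quotient //.
by rewrite fx fx1.
Qed.
Let FG := Group group_set_F.

Let fstF : [morphism of fun u : gT * rT => u.1] @* FG = K.
Proof.
apply/setP=> x; apply/morphimP/idP=> [[[x1 y1] _ /FP[Kx _ _] ->] // | Kx].
have : f (coset N x) \in L / Z by rewrite -imf mem_morphim ?mem_quotient.
case/morphimP=> y Ny Ly fx; have Fxy : (x, y) \in F by apply/FP.
by exists (x, y).
Qed.

Let sndF : [morphism of fun u : gT * rT => u.2] @* FG = L.
Proof.
apply/setP=> y; apply/morphimP/idP=> [[[x1 y1] _ /FP[_ Ly _] ->] // | Ly].
have : coset Z y \in f @* (K / N) by rewrite imf mem_quotient.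
case/morphimP=> _ _ /morphimP[x Nx Kx ->] fx.
have Fxy : (x, y) \in F by apply/FP.
by exists (x, y).
Qed.

Let D := (FG^`(1))%G.

Let fstD : [morphism of fun u : gT * rT => u.1] @* D = K.
Proof.
by rewrite morphim_der ?subsetT // fstF; apply/eqP; rewrite eqEsubset der_sub.
Qed.

Let sndD : [morphism of fun u : gT * rT => u.2] @* D = L.
Proof.
by rewrite morphim_der ?subsetT // sndF; apply/eqP; rewrite eqEsubset der_sub.
Qed.

Let C := setX_group N Z.

Let kerF x y : (x, y) \in F -> (x \in N) = (y \in Z).
Proof.
have [_ nNK] := andP nsNK; have [_ nZL] := andP nsZL.
case/FP=> Kx Ly fxy; apply/idP/idP=> [Nx | Zy].
  by apply: coset_idr; rewrite ?(subsetP nZL) // -fxy coset_id // morph1.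
apply: coset_idr; rewrite ?(subsetP nNK) //; apply/eqP.
by rewrite -(morph_injm_eq1 injf) ?mem_quotient // fxy coset_id.
Qed.

Let sCZF : C \subset 'Z(FG).
Proof.
have [sNK cKN] := subsetIP sNZK; have [sZL cLZ] := subsetIP sZZL.
apply/subsetP=> -[x y] /setXP[Nx Zy]; apply/setIP; split.
  by apply/FP; rewrite (subsetP sNK) // (subsetP sZL) // !coset_id // morph1.
apply/centP=> -[x1 y1] /FP[Kx1 Ly1 _].
by congr (_, _); [apply: (centsP cKN) | apply: (centsP cLZ)].
Qed.

Let sDF : D \subset FG. Proof. exact: der_sub. Qed.

(** [D] already projects onto [K], and an element of the fibre product with first coordinate 1 lies
    in the central subgroup [C]. Hence [D] is perfect. *)
Let defF : C \* D = FG.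
Proof.
have [sCF cFC] := subsetIP sCZF.
rewrite cprodE; last by rewrite centsC (subset_trans cFC) ?centS.
apply/eqP; rewrite eqEsubset mul_subG //=; apply/subsetP=> -[x y] Fxy.
have [Kx _ _] := FP _ _ Fxy; rewrite -fstD in Kx; case/morphimP: Kx => -[x1 y1] _ Dxy /= defx.
apply/mulsgP; exists (1, y * y1^-1) (x1, y1) => //; last by rewrite {1}defx; congr (_, _);
  rewrite ?mul1g ?mulgKV.
rewrite in_setX group1 /= -(@kerF 1) ?group1 //.
have -> : (1, y * y1^-1) = (x, y) * (x1, y1)^-1 by congr (_, _); rewrite defx mulgV.
by apply: (@groupM _ FG) => //; rewrite (groupV FG); apply: (subsetP sDF).
Qed.

Let perfD : D \subset D^`(1).
Proof.
have abC : abelian C.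
  by apply: abelianS sCZF _; apply: center_abelian.
have defD' := der_cprod 1 defF; rewrite (derG1P abC) cprod1g in defD'.
by rewrite defD'.
Qed.

(** [D] is itself a perfect central extension, by the 2-group E, of a group of order 60, so |E| <=
    2. A surjection of [D] onto a group of order 120 is then injective. *)
Let cardD : #|D| <= 120.
Proof.
pose E := (D :&: C)%G; have sED : E \subset D := subsetIl _ _.
have fstE : [morphism of fun u : gT * rT => u.1] @* E = N.
  apply/setP=> x; apply/morphimP/idP=> [[[x1 y1] _ /setIP[_ /setXP[Nx _]] ->] // | Nx].
  have : x \in K by apply: (subsetP (normal_sub nsNK)).
  rewrite -fstD => /morphimP[[x1 y] _ Dxy /= defx]; rewrite -{x1}defx in Dxy.
  have Cxy : (x, y) \in C by rewrite in_setX -(kerF (subsetP sDF _ Dxy)) andbb.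
  by exists (x, y) => //; apply/setIP.
have kerE : 'ker_D [morphism of fun u : gT * rT => u.1] \subset E.
  apply/subsetP=> -[a b] /setIP[Dab /morphpreP[_ /set1P /= a1]]; rewrite a1 in Dab *.
  by rewrite inE Dab in_setX -(kerF (subsetP sDF _ Dab)) group1.
have iE : #|D : E| = 60.
  rewrite -(index_morphim_ker [morphism of fun u : gT * rT => u.1]) ?subsetT //.
  rewrite fstE fstD iN -indexgI (setIidPl kerE) indexgg //.
have oC : #|C| = 4 by rewrite cardsX oN oZ.
have zE : 2.-group E.
  by apply: (pgroupS (subsetIr D C)); rewrite /pgroup oC.
have sEZ : E \subset 'Z(D).
  rewrite subsetI sED (subset_trans (subsetIr _ _)) //.
  by apply: subset_trans sCZF _; rewrite subIset // (centS sDF) orbT.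
by rewrite -(Lagrange sED) iE -[120%N]/(2 * 60)%N leq_pmul2r //
  (perfect_cover60_center perfD sEZ zE iE).
Qed.

Let isoD (aT : finGroupType) (X : {group aT}) (h : {morphism [set: gT * rT] >-> aT}) :
  h @* D = X -> #|X| = 120 -> D \isog X.
Proof.
move=> imh oX; pose hD := restrm_morphism (subsetT D) h.
have imhD : hD @* D = X by rewrite morphim_restrm setIid.
have injh : 'injm hD by rewrite -card_im_injm eqn_leq leq_morphim imhD oX cardD.
by rewrite -imhD; apply: sub_isog.
Qed.

Lemma double_cover_isog : K \isog L.
Proof.
have oK : #|K| = 120 by rewrite -(Lagrange (normal_sub nsNK)) oN iN.
by apply: isog_trans (isoD sndD oL); rewrite isog_sym; apply: (isoD fstD oK).
Qed.

End DoubleCover.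

(** * Order, perfectness and central involution of SL(2,5) *)

Section SL25.

Import GRing.Theory.
Local Open Scope ring_scope.

Let F := 'F_5.

Definition mx2 (a b c d : F) : 'M[F]_2 :=
  \matrix_(i, j) if i == 0 then (if j == 0 then a else b)
                 else (if j == 0 then c else d).

Lemma mx2E (A : 'M[F]_2) : A = mx2 (A 0 0) (A 0 1) (A 1 0) (A 1 1).
Proof.
apply/matrixP=> i j; rewrite !mxE.
by case: (unliftP 0 i) => [i' ->|->]; case: (unliftP 0 j) => [j' ->|->]; rewrite ?ord1 /=;
  congr (A _ _); apply: val_inj.
Qed.

Lemma mul_mx2 a b c d a' b' c' d' :
  mx2 a b c d *m mx2 a' b' c' d'
    = mx2 (a * a' + b * c') (a * b' + b * d') (c * a' + d * c') (c * b' + d * d').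
Proof.
apply/matrixP=> i j; rewrite !mxE !big_ord_recl big_ord0 !mxE /= addr0.
by case: (i == 0); case: (j == 0).
Qed.

Lemma det_mx2 a b c d : \det (mx2 a b c d) = a * d - b * c.
Proof.
rewrite (expand_det_row _ 0) !big_ord_recl big_ord0 !mxE /= addr0.
by rewrite /cofactor !det_mx11 !mxE /= expr0 expr1 mul1r mulN1r mulrN.
Qed.

Lemma one_mx2 : 1%:M = mx2 1 0 0 1.
Proof. by rewrite [LHS]mx2E !mxE. Qed.

Definition SL2_unit (A : 'M[F]_2) : {'GL_2[F]} := insubd (1%g : {'GL_2[F]}) A.

Lemma SL2_unitE A : \det A = 1 -> GLval (SL2_unit A) = A.
Proof.
move=> detA; have uA : A \in unitmx by rewrite unitmxE detA unitr1.
by rewrite /SL2_unit -[GLval _]/(val _) val_insubd uA.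
Qed.

Lemma SL2_inj (u v : {'GL_2[F]}) : GLval u = GLval v -> u = v.
Proof. exact: val_inj. Qed.

Lemma card_SL2_5 : #|'SL_2(5)%g| = 120.
Proof.
pose delta (u : {'GL_2[F]}) : {unit F} := insubd (1%g : {unit F}) (\det (GLval u)).
have dE u : val (delta u) = \det (GLval u) by rewrite val_insubd unitfE GL_det.
have dM : {in [set: {'GL_2[F]}] &, {morph delta : x y / (x * y)%g}}.
  by move=> u v _ _; apply: val_inj; rewrite /= !dE GL_ME det_mulmx.
pose h := Morphism dM.
have kerh : 'ker h = 'SL_2(5)%g.
  apply/setP=> u; rewrite !inE /= -(inj_eq val_inj) dE.
  by [].
have imh : (h @* [set: {'GL_2[F]}])%g = [set: {unit F}].
  apply/eqP; rewrite eqEsubset subsetT; apply/subsetP=> w _.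
  pose A := mx2 (val w) 0 0 1; have detA : \det A = val w.
    by rewrite det_mx2 mulr1 mulr0 subr0.
  have uA : A \in unitmx by rewrite unitmxE detA (valP w).
  pose u : {'GL_2[F]} := insubd (1%g : {'GL_2[F]}) A.
  have uE : GLval u = A by rewrite -[GLval u]/(val u) val_insubd uA.
  apply/morphimP; exists u; rewrite ?inE //.
  by apply: val_inj; rewrite /= dE uE detA.
have := card_morphim h [set: {'GL_2[F]}]; rewrite imh setTI card_finField_unit kerh.
have := card_GL_2 F; rewrite card_Fp // => oGL iSL.
have sSL : 'SL_2(5)%g \subset [set: {'GL_2[F]}] by apply: subsetT.
have := Lagrange sSL; rewrite -iSL oGL => /eqP.
by rewrite -[X in _ == X]/(120 * 4)%N eqn_pmul2r // => /eqP.
Qed.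

(** Elementary matrices are commutators with a diagonal one, and they generate every matrix with
    nonzero lower left entry; the others reach that form on multiplication by [L 1]. *)
Lemma SL2_perfect : ('SL_2(5) \subset 'SL_2(5)^`(1))%g.
Proof.
have detU a : \det (mx2 1 a 0 1) = 1 by rewrite det_mx2 mulr0 subr0 mulr1.
have detL a : \det (mx2 1 0 a 1) = 1 by rewrite det_mx2 mul0r subr0 mulr1.
have detD : \det (mx2 2 0 0 3) = 1 by rewrite det_mx2; apply/eqP.
have [U UE] : exists U : F -> {'GL_2[F]}, forall a, GLval (U a) = mx2 1 a 0 1.
  by exists (fun a => SL2_unit (mx2 1 a 0 1)) => a; apply: SL2_unitE.
have [L LE] : exists L : F -> {'GL_2[F]}, forall a, GLval (L a) = mx2 1 0 a 1.
  by exists (fun a => SL2_unit (mx2 1 0 a 1)) => a; apply: SL2_unitE.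
have [D DE] : exists D : {'GL_2[F]}, GLval D = mx2 2 0 0 3.
  by exists (SL2_unit (mx2 2 0 0 3)); apply: SL2_unitE.
have SLU a : U a \in 'SL_2(5)%g by rewrite inE UE detU.
have SLL a : L a \in 'SL_2(5)%g by rewrite inE LE detL.
have SLD : D \in 'SL_2(5)%g by rewrite inE DE detD.
(* Modulo 5, conjugation by D = diag(2, 1/2) multiplies the off-diagonal entry b by 4 = -1, so the
   commutator has entry -2 b; b = 2 a, or equally -3 a, gives a. *)
have dU a : U a \in ('SL_2(5)^`(1))%g.
  have -> : U a = [~ U (2 * a)%R, D]%g.
    apply: (mulgI (D * U (2 * a)%R)%g); rewrite -commgC.
    apply: SL2_inj; rewrite !GL_MxE !UE DE !mul_mx2.
    by congr mx2; ring.
  by rewrite mem_commg.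
have dL a : L a \in ('SL_2(5)^`(1))%g.
  have -> : L a = [~ L (- 3 * a)%R, D]%g.
    apply: (mulgI (D * L (- 3 * a)%R)%g); rewrite -commgC.
    apply: SL2_inj; rewrite !GL_MxE !LE DE !mul_mx2.
    by congr mx2; ring.
  by rewrite mem_commg.
have dS (u : {'GL_2[F]}) : u \in 'SL_2(5)%g -> GLval u 1 0 != 0 -> u \in ('SL_2(5)^`(1))%g.
  rewrite inE [GLval u]mx2E det_mx2; set a := GLval u 0 0; set b := GLval u 0 1.
  set c := GLval u 1 0; set d := GLval u 1 1 => /eqP detu; rewrite mxE /= => nzc.
  have -> : u = (U ((a - 1) / c)%R * L c * U ((d - 1) / c)%R)%g.
    apply: SL2_inj; rewrite !GL_MxE !UE LE !mul_mx2 [LHS]mx2E -/a -/b -/c -/d.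
    have -> : b = (a * d - 1) / c by rewrite -detu; field.
    congr mx2; field => //.
  by rewrite !groupM.
apply/subsetP=> u SLu; have [c0 | ] := eqVneq (GLval u 1 0) 0; last exact: dS.
rewrite -(groupMl _ (dL 1)); apply: dS; first by rewrite groupM.
move: SLu; rewrite inE [GLval u]mx2E det_mx2 c0 mulr0 subr0 => /eqP detu.
rewrite GL_MxE LE [GLval u]mx2E mul_mx2 c0 !mxE /= mulr0 addr0 mul1r.
by apply/eqP=> a0; move/eqP: detu; rewrite a0 mul0r eq_sym oner_eq0.
Qed.

Lemma SL2_opp : exists z : {'GL_2[F]}, #[z]%g = 2 /\ (z \in 'Z('SL_2(5)))%g.
Proof.
have detN : \det (mx2 (-1) 0 0 (-1)) = 1 by rewrite det_mx2 mulrNN mulr1 mulr0 subr0.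
have [z zE] : exists z : {'GL_2[F]}, GLval z = mx2 (-1) 0 0 (-1).
  by exists (SL2_unit (mx2 (-1) 0 0 (-1))); apply: SL2_unitE.
exists z; split.
  apply: nt_prime_order => //.
    apply: SL2_inj; rewrite (expgS _ 1) GL_MxE zE mul_mx2 GL_1E [RHS]one_mx2.
    by congr mx2; ring.
  apply/eqP=> z1; have := congr1 (fun A : 'M[F]_2 => A 0 0) zE.
  by rewrite z1 GL_1E !mxE.
apply/setIP; split; first by rewrite inE zE detN.
apply/centP=> u _; apply: SL2_inj; rewrite !GL_MxE zE [GLval u]mx2E !mul_mx2.
by congr mx2; ring.
Qed.

End SL25.

(** * Minimal insoluble subgroups *)

(** A maximal normal subgroup M has prime index and is nilpotent; for any other prime r dividing
    |G|, the Sylow r-subgroup of M is Sylow in [G] and characteristic in M. *)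
Lemma min_nonnil_normal_Sylow (gT : finGroupType) (G : {group gT}) :
  minimal_nonnilpotent G ->
  exists p, exists2 P : {group gT}, p.-Sylow(G) P & [/\ prime p, P <| G & P :!=: 1].
Proof.
move=> mnG; have solG := min_nonnil_sol mnG; have [nnG nilG] := min_nonnilP _ mnG.
have [|M maxM] := @ex_maxnormal_ntrivg _ G.
  by apply: contraNneq nnG => ->; apply: nilpotent1.
have nsMG := maxnormal_normal maxM; have [sMG nMG] := andP nsMG.
have simGM : simple (G / M) by rewrite quotient_simple.
have pr_p := simple_sol_prime (quotient_sol M solG) simGM; set p := #|G / M| in pr_p.
have [r piGr neq_rp] : exists2 r, r \in \pi(G) & r != p.
  have : ~~ p.-group G by apply: contra nnG; apply: pgroup_nil.
  by rewrite /pgroup /pnat cardG_gt0 => /allPn[r piGr neq]; exists r.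
have r_pr : prime r by move: piGr; rewrite mem_primes => /andP[].
have [R sylR] := Sylow_exists r M; exists r, R.
  rewrite pHallE (subset_trans (pHall_sub sylR) sMG) (card_Hall sylR) /=.
  rewrite -(Lagrange sMG) -card_quotient // partnM ?cardG_gt0 // -/p.
  by rewrite (@part_p'nat r p) ?muln1 // pnatE // !inE eq_sym.
have chR : R \char M.
  by rewrite (nilpotent_Hall_pcore (nilG M (maxnormal_proper maxM)) sylR) pcore_char.
split=> //; first exact: char_normal_trans chR nsMG.
rewrite -cardG_gt1 (card_Hall sylR) p_part_gt1 mem_primes r_pr cardG_gt0.
have : r %| #|G| by move: piGr; rewrite mem_primes => /and3P[].
rewrite -(Lagrange sMG) -card_quotient //.
by rewrite Euclid_dvdM // -/p (dvdn_prime2 r_pr pr_p) (negPf neq_rp) orbF.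
Qed.

Lemma min_nonnil_primes (gT : finGroupType) (G : {group gT}) a b r :
    minimal_nonnilpotent G -> prime a -> prime b -> prime r -> a != b ->
    a %| #|G| -> b %| #|G| -> r %| #|G| ->
  (r == a) || (r == b).
Proof.
move=> mnG a_pr b_pr r_pr neq_ab.
have [p [P sylP [p_pr nsPG ntP]]] := min_nonnil_normal_Sylow mnG.
have [q [Q [q_pr neq_qp qQ defG _]]] := min_nonnil_sdprod mnG sylP nsPG ntP.
have dvG s : prime s -> s %| #|G| -> (s == p) || (s == q).
  move=> s_pr; rewrite -(sdprod_card defG) Euclid_dvdM //.
  case/orP=> dvs; apply/orP; [left | right].
    by apply: (pnatPpi (pHall_pgroup sylP)); rewrite mem_primes s_pr cardG_gt0.
  by apply: (pnatPpi qQ); rewrite mem_primes s_pr cardG_gt0.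
move=> /(dvG a a_pr) pqa /(dvG b b_pr) pqb /(dvG r r_pr) pqr.
case/orP: pqa neq_ab => /eqP->; case/orP: pqb => /eqP->; rewrite ?eqxx // => _.
by rewrite orbC.
Qed.

Lemma cover_SL2_5 (gT : finGroupType) (K N : {group gT}) :
    K \subset K^`(1) -> N \subset 'Z(K) -> #|N| = 2 -> #|K : N| = 60 ->
  K \isog 'SL_2(5).
Proof.
move=> perfK sNZ oN iN; have [z [oz Zz]] := SL2_opp.
pose Z := <[z]>%G; have sZZ : Z \subset 'Z('SL_2(5)) by rewrite cycle_subG.
have nsNK : N <| K by apply: sub_center_normal.
have nsZL : Z <| 'SL_2(5) by apply: sub_center_normal.
have oZ : #|Z| = 2 by rewrite -orderE.
have iZ : #|'SL_2(5) : Z| = 60.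
  by rewrite -divgS ?normal_sub // card_SL2_5 oZ.
have A5 (rT : finGroupType) (G M : {group rT}) :
    G \subset G^`(1) -> M <| G -> #|G : M| = 60 -> G / M \isog 'Alt_('I_5).
  move=> perfG /andP[sMG nMG] iM; have oGM : #|G / M| = 60 by rewrite card_quotient.
  by apply: simple60_Alt5 => //; apply: perfect60_simple; rewrite ?quotient_perfect.
have isoKL : K / N \isog 'SL_2(5) / Z.
  apply: isog_trans (A5 _ _ _ perfK nsNK iN) _.
  by rewrite isog_sym; apply: A5 SL2_perfect nsZL iZ.
have [f injf imf] := isogP isoKL.
exact: (double_cover_isog perfK SL2_perfect sNZ sZZ oN oZ iN card_SL2_5 injf imf).
Qed.

Section MinimalInsoluble.

Variables (gT : finGroupType) (K : {group gT}).
Hypotheses (insolK : ~~ solvable K).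
Hypothesis solK : forall H : {group gT}, H \proper K -> solvable H.
Hypothesis paraK : forall H : {group gT}, H \subset K -> ~~ (H <| K) ->
  nilpotent H || minimal_nonnilpotent H.

Lemma min_insol_perfect : K \subset K^`(1).
Proof.
have := der_sub 1 K; rewrite subEproper => /predU1P[->|/solK solK']; first by [].
case/negP: insolK; rewrite (series_sol (der_normal 1 K)) solK'.
by rewrite abelian_sol // sub_der1_abelian.
Qed.

Variable N : {group gT}.
Hypothesis maxN : maxnormal N K K.
Let S := (K / N)%G.

Let nsNK : N <| K. Proof. exact: maxnormal_normal maxN. Qed.
Let sNK : N \subset K. Proof. exact: normal_sub nsNK. Qed.
Let nNK : K \subset 'N(N). Proof. exact: normal_norm nsNK. Qed.
Let solN : solvable N. Proof. exact/solK/maxnormal_proper/maxN. Qed.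
Let simS : simple S. Proof. by rewrite quotient_simple. Qed.

Let insolS : ~~ solvable S.
Proof. by apply: contra insolK => solS; rewrite (series_sol nsNK) solN. Qed.

(** A nontrivial proper subgroup of [S] has a non-normal preimage, to which the hypothesis applies,
    and the property passes to the quotient by [N]. *)
Let nilS (H : {group coset_of N}) : H \proper S -> nilpotent H || minimal_nonnilpotent H.
Proof.
move=> prH; have [A defH sNA sAK] := inv_quotientS nsNK (proper_sub prH).
have [nsAK | nAK] := boolP (A <| K).
  have [_ sim] := simpleP _ simS; case: (sim H) => [|->|eqHS].
  - by rewrite defH quotient_normal.
  - by rewrite nilpotent1.
  by rewrite eqHS properxx in prH.
case/orP: (paraK sAK nAK) => [nilA | mnA]; first by rewrite defH quotient_nil.
have [//|nnH] := boolP (nilpotent H); apply/min_nonnilP; split=> // B prB.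
have nsNA : N <| A by apply: normalS nsNK.
have sBA : B \subset A / N by rewrite -defH proper_sub.
have [C defB sNC sCA] := inv_quotientS nsNA sBA.
have [_ nilA] := min_nonnilP _ mnA; rewrite defB quotient_nil // nilA //.
rewrite properEneq sCA andbT; apply: contraTneq prB => eqCA.
by rewrite defB eqCA -defH properxx.
Qed.

Let oS : #|S| = 60. Proof. exact: simple_order_60 simS insolS nilS. Qed.
Let iN : #|K : N| = 60. Proof. by rewrite -card_quotient. Qed.

(** The complement in the Frobenius normalizer has prime order dividing p - 1, hence order 2. The
    normalizer is neither 1 nor [S], so its preimage is not normal in [K], and it is not
    nilpotent. *)
Lemma local_preimage p : (p == 3) || (p == 5) ->
  exists A : {group gT}, exists2 P : {group coset_of N},
    [/\ A \subset K, N \subset A & minimal_nonnilpotent A] &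
    [/\ p.-Sylow(S) P, A / N = 'N_S(P), #|P| = p, #|A| = (#|N| * (p * 2))%N
      & {in P^#, forall x, 'C_S[x] = P}].
Proof.
move=> p35; have p_pr : prime p by case/orP: p35 => /eqP->.
have [P sylP] := Sylow_exists p S.
have oP : #|P| = p by rewrite (card_Hall sylP) oS p_part; case/orP: p35 => /eqP->.
have ntP : P :!=: 1 by rewrite -cardG_gt1 oP prime_gt1.
have [_ cP [q [Q [q_pr _ oQ frobN _]]]] := simple_Sylow_structure simS insolS nilS p_pr sylP ntP.
have [defN _ _ _ _] := Frobenius_context frobN.
have q2 : q = 2.
  have := Frobenius_dvd_ker1 frobN; rewrite oQ oP; case/orP: p35 => /eqP->.
    by rewrite dvdn_prime2 // => /eqP.
  by rewrite -[5.-1]/(2 ^ 2)%N Euclid_dvdX // dvdn_prime2 // andbT => /eqP.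
have oN : #|'N_S(P)| = (p * 2)%N by rewrite -(sdprod_card defN) oP oQ q2.
have [A defA sNA sAK] := inv_quotientS nsNK (subsetIl S 'N(P)).
exists A, P; first split=> //; last first.
  split=> //; rewrite -oN [in RHS]defA card_quotient ?Lagrange //.
  exact: subset_trans sAK nNK.
have nnA : ~~ nilpotent A.
  apply: contraL (min_insol_perfect) => nilA.
  have nilN : nilpotent 'N_S(P) by rewrite [X in nilpotent X]defA quotient_nil.
  apply: contra (TI_Sylow_nil_not_perfect sylP ntP (simple_Sylow_TI simS insolS nilS sylP ntP)
    nilN).
  exact: quotient_perfect.
have nAK : ~~ (A <| K).
  apply/negP=> nsAK; have [_ sim] := simpleP _ simS.
  case: (sim (A / N)%G); first exact: quotient_normal.
    by rewrite /= -defA => N1; move: oN; rewrite N1 cards1; case/orP: p35 => /eqP->.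
  by rewrite /= -defA => NS; move: oN; rewrite NS oS; case/orP: p35 => /eqP->.
by have := paraK sAK nAK; rewrite (negPf nnA).
Qed.

(** The preimages for 3 and for 5 contain [N] and have prime divisors {2, 3} and {2, 5}. *)
Let pN : 2.-group N.
Proof.
apply/pgroupP=> r r_pr dvr.
have dv p : prime p -> p != 2 -> (p == 3) || (p == 5) -> (r == p) || (r == 2).
  move=> p_pr p_odd /local_preimage[A [P [_ _ mnA] [_ _ _ oA _]]].
  apply: (min_nonnil_primes mnA) => //; rewrite oA; last exact: dvdn_mulr.
    by rewrite dvdn_mull // dvdn_mulr.
  by rewrite dvdn_mull // dvdn_mull.
have := dv 3 isT isT isT; have := dv 5 isT isT isT; rewrite !inE.
by case: (r == 2); rewrite ?orbT // !orbF => /eqP->.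
Qed.

(** The preimage [A] has some normal Sylow subgroup. If it were a 2-group, its image would
    centralize the self-centralizing group of order 3, so it would lie in [N]; but the 2-part of |A|
    is 2 |N|. *)
Lemma min_insol_Sylow3 : exists A P : {group gT},
  [/\ A \subset K, N \subset A & ~~ nilpotent A] /\
  [/\ P <| A, 3.-Sylow(K) P & P :!=: 1].
Proof.
have [A [R [sAK sNA mnA] [sylR defA oR oA cR]]] := local_preimage (isT : (3 == 3) || (3 == 5)).
have [nnA _] := min_nonnilP _ mnA.
have [p [P sylP [p_pr nsPA ntP]]] := min_nonnil_normal_Sylow mnA.
have [p3 | neq3] := eqVneq p 3.
  exists A, P; do 2!split=> //; rewrite p3 in sylP.
  rewrite pHallE (subset_trans (normal_sub nsPA) sAK) (card_Hall sylP) /=.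
  rewrite -(Lagrange sNK) iN oA partnM ?cardG_gt0 // [in X in _ == X]partnM ?cardG_gt0 //.
  by rewrite eqn_pmul2l ?part_gt0 // !p_part.
have p2 : p = 2.
  have : p %| #|A|.
    by rewrite -(Lagrange (normal_sub nsPA)) dvdn_mulr //;
      have [] := pgroup_pdiv (pHall_pgroup sylP) ntP.
  rewrite oA !Euclid_dvdM // (dvdn_prime2 p_pr (isT : prime 3)) (negPf neq3) /=.
  rewrite (dvdn_prime2 p_pr (isT : prime 2)) => /orP[dvN | /eqP //].
  by have /eqP := pgroupP pN p p_pr dvN.
rewrite p2 in sylP; have nNA := subset_trans sAK nNK.
have sPA := normal_sub nsPA; have nNP := subset_trans sPA nNA.
have sTN : P / N \subset 'N_S(R) by rewrite -defA quotientS.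
have sRN : R \subset 'N_S(R) by rewrite subsetI normG (pHall_sub sylR).
have nsTN : P / N <| 'N_S(R) by rewrite -defA quotient_normal.
have tiTR : P / N :&: R = 1.
  apply: coprime_TIg; rewrite oR coprime_sym prime_coprime //.
  by have /p'natE <- := isT : prime 3;
    apply: sub_in_pnat (quotient_pgroup N (pHall_pgroup sylP)) => r _ /eqP->.
have cTR : P / N \subset 'C(R).
  apply/commG1P/trivgP; rewrite -tiTR commg_subI // subsetI.
    by rewrite subxx (subset_trans sTN) // subsetIr.
  by rewrite subxx (subset_trans sRN) // normal_norm.
have ntR : R :!=: 1 by rewrite -cardG_gt1 oR.
have [x Rx ntx] := trivgPn _ ntR.
have sTR : P / N \subset R.
  rewrite -(cR x) ?inE ?ntx // subsetI (subset_trans sTN) ?subsetIl //=.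
  by rewrite (subset_trans cTR) // -cent_set1 centS // sub1set.
have : P \subset N by rewrite -quotient_sub1 // -tiTR subsetI subxx.
move/subset_leq_card; rewrite (card_Hall sylP) oA partnM ?cardG_gt0 //.
rewrite (part_pnat_id pN) p_part -[(2 ^ _)%N]/2 leqNgt ltn_Pmulr //.
Qed.

(** [P] and [N] normalize each other and have coprime orders, so [P] centralizes [N]. Thus C_K(N) is
    normal and covers [S]; if proper it would be soluble, as would [S]. *)
Lemma min_insol_center : N \subset 'Z(K) /\ #|N| <= 2.
Proof.
have [A [P [[sAK sNA nnA] [nsPA sylP ntP]]]] := min_insol_Sylow3.
have [sPK pP _] := and3P sylP.
have tiPN : P :&: N = 1.
  apply: coprime_TIg; apply: (p'nat_coprime _ pN).
  by apply: sub_in_pnat pP => r _ /eqP->.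
have cPN : P \subset 'C(N).
  apply/commG1P/trivgP; rewrite -tiPN commg_subI // subsetI subxx.
    by rewrite (subset_trans sPK).
  by rewrite (subset_trans sNA) // normal_norm.
have sNZ : N \subset 'Z(K).
  rewrite subsetI sNK centsC; have := subsetIl K 'C(N); rewrite subEproper.
  case/predU1P=> [<-|prC]; first exact: subsetIr.
  have nsCK : 'C_K(N) <| K by rewrite /normal subsetIl normsI ?normG ?norms_cent.
  have [_ sim] := simpleP _ simS.
  case: (sim ('C_K(N) / N)%G); first exact: quotient_normal.
    move/eqP; rewrite -subG1 quotient_sub1 ?(subset_trans (subsetIl K _) nNK) // => sCN.
    case/eqP: ntP; apply/trivgP; rewrite -tiPN subsetI subxx.
    by apply: subset_trans sCN; rewrite subsetI sPK.
  by move=> eqS; case/negP: insolS; rewrite -eqS quotient_sol // solK.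
by split=> //; apply: perfect_cover60_center min_insol_perfect sNZ pN iN.
Qed.

Lemma min_insol_isog :
  ((K \isog 'Alt_('I_5)) /\ #|K| = 60) \/ ((K \isog 'SL_2(5)) /\ #|K| = 120).
Proof.
have [sNZ] := min_insol_center; rewrite leq_eqVlt => /predU1P[oN | ltN]; [right | left].
  by rewrite (cover_SL2_5 min_insol_perfect sNZ oN iN) -(Lagrange sNK) oN iN.
have N1 : N :=: 1 by apply/eqP; rewrite trivg_card1 eqn_leq -ltnS ltN cardG_gt0.
split; last by rewrite -(Lagrange sNK) iN N1 cards1.
apply: isog_trans (simple60_Alt5 simS oS); apply: isog_trans (quotient1_isog K) _.
by rewrite /= N1; apply: isog_refl.
Qed.

End MinimalInsoluble.

Lemma para_min_insol_eq (gT : finGroupType) (G K : {group gT}) :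
    para_nil_hamiltonian G -> K \subset G -> ~~ solvable K ->
    (forall H : {group gT}, H \proper K -> solvable H) ->
  K :=: G.
Proof.
case/andP=> nnG /forall_inP paraG sKG insolK solK.
have normalG (H : {group gT}) : H \subset G -> ~~ nilpotent H -> ~~ minimal_nonnilpotent H -> H
  <| G.
  move=> sHG nnH nmH; apply: contraR nnH => nHG.
  by have := paraG H; rewrite sHG nHG (negPf nmH) orbF; apply.
have paraK (H : {group gT}) : H \subset K -> ~~ (H <| K) -> nilpotent H || minimal_nonnilpotent H.
  move=> sHK; apply: contraR; rewrite negb_or => /andP[nnH nmH].
  by apply: normalS (normalG H _ _ _) => //; apply: subset_trans sKG.
have nsKG : K <| G.
  apply: normalG => //; first by apply: contra insolK; apply: nilpotent_sol.
  by apply: contra insolK; apply: min_nonnil_sol.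
have [|N maxN] := @ex_maxnormal_ntrivg _ K.
  by apply: contraNneq insolK => ->; apply: solvable1.
have [A [P [[sAK sNA nnA] [nsPA sylP ntP]]]] := min_insol_Sylow3 insolK solK paraK maxN.
move: sKG; rewrite subEproper => /predU1P[// | prKG].
have sANP : A \subset 'N_K(P) by rewrite subsetI sAK normal_norm.
have nnNK : ~~ nilpotent 'N_K(P) by apply: contra nnA; apply: nilpotentS.
have sNKG : 'N_K(P) \subset 'N_G(P) by rewrite setSI // proper_sub.
have nsNG : 'N_G(P) <| G.
  apply: normalG; first exact: subsetIl.
    by apply: contra nnNK; apply: nilpotentS.
  apply: contra nnNK => /min_nonnilP[_]; apply.
  (* The inclusion is strict: if N_K(P) = N_G(P), the Frattini argument gives G = K N_G(P) = K. *)
  rewrite properEneq sNKG andbT; apply/eqP=> eqN.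
  case/andP: prKG => _ /negP[]; rewrite -(Frattini_arg nsKG sylP) mul_subG //.
  by rewrite -eqN subsetIl.
have nsNK : 'N_K(P) <| K.
  have -> : 'N_K(P) = K :&: 'N_G(P) by rewrite setIA (setIidPl (proper_sub prKG)).
  exact: normalGI (proper_sub prKG) nsNG.
have nsPK : P <| K.
  apply: char_normal_trans nsNK.
  have sylPN : 3.-Sylow('N_K(P)) P.
    have sPN : P \subset 'N_K(P) by rewrite subsetI (pHall_sub sylP) normG.
    exact: pHall_subl sPN (subsetIl _ _) sylP.
  have nsPN : P <| 'N_K(P) by rewrite normalSG ?(pHall_sub sylP).
  by have := pcore_char 3 'N_K(P); rewrite (normal_Hall_pcore sylPN nsPN).
have nsN := maxnormal_normal maxN.
have /simpleP[_ sim] : simple (K / N) by rewrite quotient_simple.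
(* A normal 3-subgroup of [K] has image 1 or [S]: the first puts it in [N], of order at most 2, and
   the second makes [S] soluble. *)
case: (sim (P / N)%G (quotient_normal _ nsPK)) => [/eqP | PN].
  rewrite -subG1 quotient_sub1 ?(subset_trans (normal_sub nsPK) (normal_norm nsN)) // => sPN.
  have [_ leN] := min_insol_center insolK solK paraK maxN.
  have [_ dv3 _] := pgroup_pdiv (pHall_pgroup sylP) ntP.
  have := leq_trans (dvdn_leq (cardG_gt0 P) dv3) (leq_trans (subset_leq_card sPN) leN).
  by [].
case/negP: insolK; rewrite (series_sol nsN) solK ?(maxnormal_proper maxN) //.
by rewrite -PN quotient_sol // (pgroup_sol (pHall_pgroup sylP)).
Qed.

Theorem theorem3p6 (gT : finGroupType) (G : {group gT})
    (G_insoluble : ~~ solvable G) (G_para : para_nil_hamiltonian G) :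
  ((G \isog 'Alt_('I_5)) \/ (G \isog 'SL_2(5)))
  /\ (forall p : nat, prime p -> (p %| #|G|) = (p \in [:: 2; 3; 5])).
Proof.
have [K minK sKG] := @mingroup_exists gT (fun H => ~~ solvable H) G G_insoluble.
have [insolK minsolK] := mingroupP minK.
have solK (H : {group gT}) : H \proper K -> solvable H.
  case/andP=> sHK /negP notKH; apply/idPn=> insolH; apply: notKH.
  by rewrite (minsolK H insolH sHK).
have eqKG := para_min_insol_eq G_para sKG insolK solK.
have paraK (H : {group gT}) : H \subset K -> ~~ (H <| K) -> nilpotent H || minimal_nonnilpotent H.
  case/andP: G_para => _ /forall_inP paraG; rewrite eqKG => sHG nHG.
  by apply: paraG; rewrite sHG.
have [|N maxN] := @ex_maxnormal_ntrivg _ K.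
  by apply: contraNneq insolK => ->; apply: solvable1.
have primesE n p : primes n = [:: 2; 3; 5] -> 0 < n -> prime p -> (p %| n) = (p \in [:: 2; 3; 5]).
  by move=> <- n_gt0 p_pr; rewrite mem_primes p_pr n_gt0.
rewrite -eqKG; have [[isoK oK] | [isoK oK]] := min_insol_isog insolK solK paraK maxN.
  by split=> [|p p_pr]; [left | rewrite oK; apply: primesE].
by split=> [|p p_pr]; [right | rewrite oK; apply: primesE].
Qed.
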